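(* Assume Assumptions 1 and 3, and fix $T\ge1$. Set $J^T_T\equiv0$ and for $t=T-1,\dots,0$ define $$J^T_t(\pi)=\inf_{Q\in\mathcal Q_c}\Big(\tfrac1T c(\pi,Q)+\sum_{m=1}^M J^T_{t+1}\big(\hat\pi(m,\pi,Q)\big)\,\pi(Q^{-1}(m))\Big)$$ (terms with $\pi(Q^{-1}(m))=0$ being zero). Then for $t\ge1$ and $\pi\in\mathcal S$, and for $t=0$ and $\pi\in\mathcal S\cup\{\pi_0\}$, the infimum is attained by some $Q\in\mathcal Q_c$. Moreover, $J^T_t$ is continuous on $\mathcal S$ in the following sense: if $\pi_n\to\pi$ in $\mathcal S$ and $\lim_{L\to\infty}\sup_{n\ge1}\int_{\{\|x\|^2\ge L\}}\|x\|^2\pi_n(dx)=0$, then $J^T_t(\pi_n)\to J^T_t(\pi)$.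
   Context: Assumption 1: the source is $x_{t+1}=f(x_t,w_t)$ with $f:\mathbb R^d\times\mathbb R^d\to\mathbb R^d$ Borel, $\{w_t\}$ i.i.d. and independent of $x_0\sim\pi_0$; for each $x$ the law of $f(x,w_0)$ has a density $\phi(\cdot|x)$ which is strictly positive everywhere, bounded by $C$ and $C_1$-Lipschitz, uniformly in $x$. Assumption 3: (i) $\|f(x,w)\|\le K(\|x\|+\|w\|)$ for some $K>0$ and all $x,w$; (ii) $\mathbb U=\mathbb R^d$ and $c_0(x,u)=\|x-u\|^2$; (iii) the law $\nu_w$ of $w_t$ has $\int\|z\|^2\nu_w(dz)<\infty$; (iv) $\pi_0$ admits a density with $\int\|x\|^2\pi_0(dx)<\infty$, or $\pi_0=\delta_{x_0}$ is a point mass. $\mathcal S$: probability measures on $\mathbb R^d$ with density bounded by $C$ and $C_1$-Lipschitz (weak topology). $\mathcal Q_c$: Borel maps $Q:\mathbb R^d\to\{1,\dots,M\}$ with all cells convex, topologized by: fix $P$ with strictly positive density, identify $Q,Q'$ if $PQ=PQ'$, and $Q_n\to Q$ iff $PQ_n\to PQ$ weakly, where $PQ(A\times\{i\})=P(A\cap Q^{-1}(i))$. Cost $c(\pi,Q)=\sum_{i=1}^M\inf_{u\in\mathbb R^d}\int_{Q^{-1}(i)}\|x-u\|^2\pi(dx)$. $\hat\pi(m,\pi,Q)$ is the probability measure with density $z\mapsto\pi(Q^{-1}(m))^{-1}\int_{Q^{-1}(m)}\phi(z|x)\pi(dx)$. *)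

(* Defs.v *)
(* R^d is modelled as [d.-tuple R] with its
   canonical product (= Borel) sigma-algebra from measurable_structure.v. *)
From HB Require Import structures.
From mathcomp Require Import all_boot all_order all_algebra.
From mathcomp Require Import all_classical all_reals all_analysis.
Set Implicit Arguments. Unset Strict Implicit. Unset Printing Implicit Defensive.
Import Order.TTheory GRing.Theory Num.Theory.
Import numFieldNormedType.Exports.
Local Open Scope classical_set_scope.
Local Open Scope ring_scope.

Section Defs.
Variable R : realType.

Definition eucl_sqnorm {d : nat} (x : d.-tuple R) : R := \sum_(i < d) tnth x i ^+ 2.
Definition eucl_norm {d : nat} (x : d.-tuple R) : R := Num.sqrt (eucl_sqnorm x).
Definition eucl_sqdist {d : nat} (x u : d.-tuple R) : R :=
  \sum_(i < d) (tnth x i - tnth u i) ^+ 2.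
Definition eucl_dist {d : nat} (x u : d.-tuple R) : R := Num.sqrt (eucl_sqdist x u).
Definition eucl_cvx_comb {d : nat} (lam : R) (x y : d.-tuple R) : d.-tuple R :=
  [tuple lam * tnth x i + (1 - lam) * tnth y i | i < d].

(** Lebesgue integral of a nonnegative function on R^d, as the iterated
    (Tonelli) integral w.r.t. the one-dimensional Lebesgue measure. *)
Fixpoint leb_int_d (d : nat) : (d.-tuple R -> \bar R) -> \bar R :=
  match d with
  | 0 => fun f => f [tuple]
  | d'.+1 => fun f =>
      (\int[@lebesgue_measure R]_x leb_int_d (fun y : d'.-tuple R => f (cons_tuple x y)))%E
  end.

Definition has_leb_density {d : nat} (mu : set (d.-tuple R) -> \bar R)
    (p : d.-tuple R -> R) : Prop :=
  (forall x, 0 <= p x) /\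
  forall A : set (d.-tuple R), measurable A ->
    mu A = leb_int_d (fun x => ((\1_A x : R) * p x)%:E).

Definition in_S {d : nat} (C C1 : R) (mu : probability (d.-tuple R) R) : Prop :=
  exists p : d.-tuple R -> R, has_leb_density mu p /\
    (forall x, p x <= C) /\
    (forall x y, `|p x - p y| <= C1 * eucl_dist x y).

Definition bdd_cont_fun {d : nat} (g : d.-tuple R -> R) : Prop :=
  (exists B : R, forall x, `|g x| <= B) /\
  (forall x (e : R), 0 < e -> exists2 del : R, 0 < del &
     forall y, eucl_dist x y < del -> `|g x - g y| < e).

Definition weak_cvg_prob {d : nat} (mus : nat -> probability (d.-tuple R) R)
    (mu : probability (d.-tuple R) R) : Prop :=
  forall g : d.-tuple R -> R, bdd_cont_fun g ->
    ((fun n => \int[mus n]_x (g x)%:E) @ \oo --> \int[mu]_x (g x)%:E)%E.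

Definition qcell {d M : nat} (Q : d.-tuple R -> 'I_M) (i : 'I_M) : set (d.-tuple R) :=
  Q @^-1` [set i].
Definition Q_c (d M : nat) : set (d.-tuple R -> 'I_M) :=
  [set Q | forall i : 'I_M, measurable (qcell Q i) /\
     forall x y (lam : R), qcell Q i x -> qcell Q i y -> 0 <= lam <= 1 ->
       qcell Q i (eucl_cvx_comb lam x y)].

Definition quant_cost {d M : nat} (pi : set (d.-tuple R) -> \bar R)
    (Q : d.-tuple R -> 'I_M) : \bar R :=
  (\sum_(i < M) ereal_inf [set \int[pi]_(x in qcell Q i) (eucl_sqdist x u)%:E
                            | u in [set: d.-tuple R]])%E.

(** hat pi(m, pi, Q): the measure with density
    z |-> pi(Q^{-1}(m))^{-1} int_{Q^{-1}(m)} phi(z|x) pi(dx),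
    where [phi x z] stands for phi(z|x). *)
Definition hat_pi {d M : nat} (phi : d.-tuple R -> d.-tuple R -> R)
    (m : 'I_M) (pi : set (d.-tuple R) -> \bar R) (Q : d.-tuple R -> 'I_M)
    : set (d.-tuple R) -> \bar R :=
  fun A => leb_int_d (fun z =>
    ((\1_A z : R)%:E * ((fine (pi (qcell Q m)))^-1)%:E *
      \int[pi]_(x in qcell Q m) (phi x z)%:E)%E).

Definition J_objective {d M : nat} (Th : nat) (phi : d.-tuple R -> d.-tuple R -> R)
    (W : (set (d.-tuple R) -> \bar R) -> \bar R)
    (pi : set (d.-tuple R) -> \bar R) (Q : d.-tuple R -> 'I_M) : \bar R :=
  (((Th%:R)^-1)%:E * quant_cost pi Q +
   \sum_(m < M) (if pi (qcell Q m) == 0 then 0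
                 else W (hat_pi phi m pi Q) * pi (qcell Q m)))%E.

Fixpoint J_togo {d : nat} (M Th : nat) (phi : d.-tuple R -> d.-tuple R -> R)
    (k : nat) : (set (d.-tuple R) -> \bar R) -> \bar R :=
  match k with
  | 0 => fun _ => 0%E
  | k'.+1 => fun pi =>
      ereal_inf [set @J_objective d M Th phi (J_togo M Th phi k') pi Q | Q in @Q_c d M]
  end.

Definition J_T {d : nat} (M Th : nat) (phi : d.-tuple R -> d.-tuple R -> R)
    (t : nat) : (set (d.-tuple R) -> \bar R) -> \bar R :=
  J_togo M Th phi (Th - t).

End Defs.

Arguments Q_c {R} d M.

(* Main.v *)
(** Disjoint convex cells are separated pairwise by affine functionals, which can
    be normalized and hence have a limit along an ultrafilter for any sequence of
    quantizers.  A limit cell is an intersection of half-spaces whose bounding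
    hyperplanes are shared out by a lexicographic rule, so it is again convex and
    Borel, and the quantizers agree with the limit outside thin slabs around
    hyperplanes.  Such slabs carry little of the mass of [1 + ||x||^2], because
    the measures in question do not charge hyperplanes.

    The cost-to-go is positively homogeneous in the measure, so the normalization
    of [hat_pi] cancels the weight of the cell, and the Bellman objective becomes
    a sum over the cells of a functional of the restriction of the measure to the
    cell.  Closeness in total variation weighted by [1 + ||x||^2] is stable under
    restriction to a cell and under the transition kernel; by induction every
    cost-to-go is continuous for it, and compactness of the quantizers gives
    minimizers.

    On densities with a common Lipschitz constant, weak convergence implies
    pointwise convergence of the densities (test against small tents), hence
    convergence in total variation (Scheffe), and uniform integrability of
    [||x||^2] upgrades this to the weighted total variation.

    The second moment of a measure in [S] may be infinite; then every quantizer
    has infinite cost.  For a Dirac mass all quantizers have the same cost. *)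

Require Import Defs.
From HB Require Import structures.
From mathcomp Require Import all_boot all_order all_algebra.
From mathcomp Require Import all_classical all_reals all_analysis.
From mathcomp Require Import measurable_realfun ring lra.
Set Implicit Arguments. Unset Strict Implicit. Unset Printing Implicit Defensive.
Import Order.TTheory GRing.Theory Num.Theory.
Import numFieldNormedType.Exports.
Local Open Scope classical_set_scope.
Local Open Scope ring_scope.

(** * Separation of convex sets *)

(** Dynamic programming runs on finite measures rather than on probabilities: once the weights of
    the cells are absorbed, the objective sees only restrictions of the measure to cells and their
    images under the kernel. Two obstacles shape this reduction. [hat_pi] is a bare set function,
    identified with a measure on measurable sets only, so the cost-to-go must first be shown to
    depend on nothing else. And the joint measurability of [phi] has to be derived from that of [f]
    before Tonelli can identify [hat_pi] with the image of a restricted measure. Compactness takes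
    the form of a cluster property: for every sequence of quantizers there is one from which
    infinitely many terms differ only on a set of small weighted mass. An ultrafilter yields the
    limits of all separating coefficients at once. The weight is dictated by the quadratic cost: it
    dominates every [||x - u||^2] up to a factor, and the linear growth of [f] with the second
    moment of the noise makes the kernel bounded for it. *)

Lemma planar_sep (R : realType) (E : set (R * R)) :
  (forall p q (l : R), E p -> E q -> 0 <= l <= 1 ->
     E (l * p.1 + (1 - l) * q.1, l * p.2 + (1 - l) * q.2)) ->
  (forall t, E (0, t) -> 0 <= t) ->
  exists ab : R * R, (ab.1 != 0 \/ ab.2 != 0) /\
    forall p, E p -> 0 <= ab.1 * p.1 + ab.2 * p.2.
Proof.
move=> cE E0.
have [posE|] := pselect (forall p, E p -> 0 <= p.1).
  exists (1, 0); split; first by left; rewrite oner_neq0.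
  by move=> p /posE /= ?; rewrite mul1r mul0r addr0.
move=> /existsNP[q /not_implyP[Eq /negP]]; rewrite -ltNge => q0.
have [negE|] := pselect (forall p, E p -> p.1 <= 0).
  exists (-1, 0); split; first by left; rewrite oppr_eq0 oner_neq0.
  by move=> p /negE /= ?; rewrite mul0r addr0 mulN1r oppr_ge0.
move=> /existsNP[p /not_implyP[Ep /negP]]; rewrite -ltNge => p0.
(* The segment from [v] to [u] meets the axis [p.1 = 0] in a point of [E], whose height is
   nonnegative. Hence slopes on the left never exceed slopes on the right, and the supremum of the
   left ones separates. *)
have cross u v : E u -> E v -> 0 < u.1 -> v.1 < 0 -> v.2 / v.1 <= u.2 / u.1.
  move=> Eu Ev u0 v0.
  have uv : 0 < u.1 - v.1 by lra.
  have l01 : 0 <= - v.1 / (u.1 - v.1) <= 1.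
    apply/andP; split; first by apply: divr_ge0; lra.
    by rewrite ler_pdivrMr//; lra.
  have := cE _ _ _ Eu Ev l01.
  rewrite (_ : _ * _ + _ = 0) => [/E0|]; last by field; rewrite gt_eqF.
  rewrite (_ : _ + _ = (u.1 * v.2 - v.1 * u.2) / (u.1 - v.1)); last first.
    by field; rewrite gt_eqF.
  rewrite pmulr_lge0 ?invr_gt0// => H.
  rewrite ler_ndivrMr// mulrAC ler_pdivrMr//; lra.
pose S := [set v.2 / v.1 | v in [set v | E v /\ v.1 < 0]].
have S0 : S !=set0 by exists (q.2 / q.1), q.
have Sub : has_ubound S.
  by exists (p.2 / p.1) => _ [v [Ev v0] <-]; exact: cross.
exists (- sup S, 1); split; first by right; rewrite oner_neq0.
move=> u Eu /=; rewrite mul1r.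
have [u0|u0|u0] := ltgtP u.1 0.
- have : u.2 / u.1 <= sup S by apply: ub_le_sup => //; exists u.
  by rewrite ler_ndivrMr//; lra.
- have : sup S <= u.2 / u.1.
    by apply: ge_sup => // _ [v [Ev v0] <-]; exact: cross.
  by rewrite ler_pdivlMr//; lra.
- by rewrite u0 mulr0 add0r; apply: E0; rewrite -u0 -surjective_pairing.
Qed.

(* Induction on [n]: the part of [D] in [z n = 0] yields a functional [a], and
   the image of [D] under [(z n, a . z)] is separated from 0 in the plane. *)
Lemma origin_sep (R : realType) (n : nat) (D : set (nat -> R)) :
  (forall z w (l : R), D z -> D w -> 0 <= l <= 1 ->
     D (fun k => l * z k + (1 - l) * w k)) ->
  (forall z, D z -> exists2 k, (k < n.+1)%N & z k != 0) ->
  exists a : nat -> R, (exists2 k, (k < n.+1)%N & a k != 0) /\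
    forall z, D z -> 0 <= \sum_(k < n.+1) a k * z k.
Proof.
elim: n D => [|n IH] D cD D0.
  have D1 z : D z -> z 0%N != 0.
    by move=> /D0[k]; rewrite ltnS leqn0 => /eqP ->.
  have [posD|] := pselect (forall z, D z -> 0 <= z 0%N).
    exists (fun=> 1); split; first by exists 0%N => //; rewrite oner_neq0.
    by move=> z /posD; rewrite big_ord1 mul1r.
  move=> /existsNP[z /not_implyP[Dz /negP]]; rewrite -ltNge => z0.
  exists (fun=> -1); split; first by exists 0%N => //; rewrite oppr_eq0 oner_neq0.
  move=> w Dw; rewrite big_ord1 mulN1r oppr_ge0 leNgt; apply/negP => w0.
  have zw : 0 < w 0%N - z 0%N by lra.
  have l01 : 0 <= w 0%N / (w 0%N - z 0%N) <= 1.
    apply/andP; split; first by apply: divr_ge0; lra.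
    by rewrite ler_pdivrMr//; lra.
  have /D1/negP := cD _ _ _ Dz Dw l01; apply; apply/eqP.
  by field; rewrite gt_eqF.
pose D' := [set z | D z /\ z n.+1 = 0].
have [||a [[k kn ak] aD]] := IH D'.
- move=> z w l [Dz z0] [Dw w0] l01; split; first exact: cD.
  by rewrite z0 w0 !mulr0 addr0.
- move=> z [Dz z0]; have [k] := D0 _ Dz.
  rewrite ltnS leq_eqVlt => /predU1P[->|]; first by rewrite z0 eqxx.
  by move=> kn zk; exists k.
pose E := [set (z n.+1, \sum_(k < n.+1) a k * z k) | z in D].
have [||[al be] /= [ab0 abE]] := @planar_sep R E.
- move=> _ _ l [z Dz <-] [w Dw <-] l01 /=.
  exists (fun k => l * z k + (1 - l) * w k); first exact: cD.
  congr pair; rewrite !mulr_sumr -big_split /=; apply: eq_bigr => i _; ring.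
- by move=> t [z Dz [z0 <-]]; apply: aD; split.
exists (fun k => if k == n.+1 then al else be * a k); split.
  have [al0|al0] := eqVneq al 0; last by exists n.+1; rewrite ?eqxx.
  exists k; first exact: ltnW.
  rewrite ltn_eqF// mulf_neq0//; case: ab0 => //; by rewrite al0 eqxx.
move=> z Dz; rewrite big_ord_recr /= eqxx addrC.
rewrite (eq_bigr (fun i : 'I_n.+1 => be * (a i * z i))) => [|i _]; last first.
  by rewrite ltn_eqF ?ltn_ord// -mulrA.
by rewrite -mulr_sumr; apply: (abE (_, _)); exists z.
Qed.

Section Affine.
Variables (R : realType) (d : nat).
Implicit Types (c : nat -> R) (x y : d.-tuple R).

(** Indices below [d] hold the linear part, index [d] the constant. Coefficients are functions on
    [nat], so that inductions on the dimension shift indices without casts. *)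
Definition aff c x : R := \sum_(k < d) c k * tnth x k + c d.

(** The sensitivity of [aff] to its coefficients ([aff_dist]): slabs of width proportional to it
    absorb coefficient errors uniformly in [x]. *)
Definition l1wt x : R := 1 + \sum_(k < d) `|tnth x k|.

Lemma aff_comb c l x y :
  aff c (eucl_cvx_comb l x y) = l * aff c x + (1 - l) * aff c y.
Proof.
rewrite /aff; under eq_bigr => k _ do rewrite tnth_mktuple mulrDr.
rewrite big_split /= !mulrDr !mulr_sumr.
under eq_bigr => k _ do rewrite mulrCA.
under [X in _ + X + _]eq_bigr => k _ do rewrite mulrCA.
ring.
Qed.

Lemma affN c x : aff (fun k => - c k) x = - aff c x.
Proof.
rewrite /aff opprD; congr (_ + _); rewrite -sumrN.
by apply: eq_bigr => k _; rewrite mulNr.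
Qed.

Lemma aff_dist c c' x eta : (forall k, (k < d.+1)%N -> `|c k - c' k| <= eta) ->
  `|aff c x - aff c' x| <= eta * l1wt x.
Proof.
move=> cc'.
rewrite (_ : aff c x - aff c' x =
  \sum_(k < d) (c k - c' k) * tnth x k + (c d - c' d)); last first.
  rewrite /aff; under [X in _ = X + _]eq_bigr => k _ do rewrite mulrBl.
  by rewrite sumrB; ring.
rewrite /l1wt mulrDr mulr1 addrC (le_trans (ler_normD _ _))// lerD ?cc'//.
rewrite (le_trans (ler_norm_sum _ _ _))// mulr_sumr ler_sum// => k _.
by rewrite normrM ler_wpM2r// cc'// ltnW// ltnS.
Qed.

Lemma l1wt_gt0 x : 0 < l1wt x.
Proof. by rewrite ltr_wpDr// sumr_ge0. Qed.

End Affine.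

Definition cvx_set (R : realType) d (A : set (d.-tuple R)) :=
  forall x y (l : R), A x -> A y -> 0 <= l <= 1 -> A (eucl_cvx_comb l x y).

(** The difference set of [A] and [B] is convex and avoids the origin, which yields the linear part;
    the constant is minus its supremum over [B]. The normalization bounds the coefficients and keeps
    their limits from vanishing. *)
Lemma cvx_sep (R : realType) (d : nat) (A B : set (d.+1.-tuple R)) :
  cvx_set A -> cvx_set B -> A `&` B = set0 ->
  exists c : nat -> R, \sum_(k < d.+2) `|c k| = 1 /\
    (forall x, A x -> 0 <= aff c x) /\ (forall x, B x -> aff c x <= 0).
Proof.
move=> cA cB AB.
suff [c [c0 [cA0 cB0]]] : exists c : nat -> R,
    (exists2 k, (k < d.+2)%N & c k != 0) /\
    (forall x, A x -> 0 <= aff c x) /\ (forall x, B x -> aff c x <= 0).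
  have s0 : 0 < \sum_(k < d.+2) `|c k|.
    rewrite lt_def sumr_ge0// andbT psumr_eq0//; apply/negP => /allP c00.
    case: c0 => k kd; rewrite -normr_eq0; apply/negP/negPn.
    by have := c00 (Ordinal kd); rewrite mem_index_enum => /(_ isT).
  exists (fun k => (\sum_(k < d.+2) `|c k|)^-1 * c k).
  have affZ x : aff (fun k => (\sum_(k < d.+2) `|c k|)^-1 * c k) x =
      (\sum_(k < d.+2) `|c k|)^-1 * aff c x.
    rewrite /aff mulrDr mulr_sumr; congr (_ + _).
    by apply: eq_bigr => k _; rewrite mulrA.
  split.
    under eq_bigr => k _ do rewrite normrM.
    by rewrite -mulr_sumr gtr0_norm ?invr_gt0// mulVf// gt_eqF.
  split=> x xAB; rewrite affZ.
    by rewrite pmulr_rge0 ?invr_gt0// cA0.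
  by rewrite pmulr_rle0 ?invr_gt0// cB0.
have d2 : (d.+1 < d.+2)%N by [].
have aff0 (s : R) (x : d.+1.-tuple R) : aff (fun k => if k == d.+1 then s else 0) x = s.
  rewrite /aff eqxx big1 ?add0r// => k _.
  by rewrite ltn_eqF ?ltn_ord// mul0r.
(* Cells may be empty; a constant functional, with no linear part, then separates. *)
have [[y0 By0]|/set0P/negP/negPn/eqP B0] := pselect (B !=set0); last first.
  exists (fun k => if k == d.+1 then 1 else 0); split.
    by exists d.+1; rewrite ?eqxx ?oner_neq0.
  by split=> x; [rewrite aff0 ler01|rewrite B0].
have [[x0 Ax0]|/set0P/negP/negPn/eqP A0] := pselect (A !=set0); last first.
  exists (fun k => if k == d.+1 then -1 else 0); split.
    by exists d.+1; rewrite ?eqxx ?oppr_eq0 ?oner_neq0.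
  by split=> x; [rewrite A0|rewrite aff0 oppr_le0 ler01].
(* The default 0 of [nth] makes the entries beyond the dimension vanish, so convexity of [D] holds
   at every index. *)
pose D := [set (fun k => nth 0 p.1 k - nth 0 p.2 k) | p in A `*` B].
have [||a [[k kd ak] aD]] := @origin_sep R d D.
- move=> _ _ l [[x y] [/= Ax By] <-] [[x' y'] [/= Ax' By'] <-] l01.
  exists (eucl_cvx_comb l x x', eucl_cvx_comb l y y').
    by split; [exact: cA|exact: cB].
  apply/funext => k; change (nth 0 (eucl_cvx_comb l x x') k -
    nth 0 (eucl_cvx_comb l y y') k = l * (nth 0 x k - nth 0 y k) +
    (1 - l) * (nth 0 x' k - nth 0 y' k)).
  case: (ltnP k d.+1) => kd.
    have nthE (t : d.+1.-tuple R) : nth 0 t k = tnth t (Ordinal kd).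
      by rewrite (tnth_nth 0).
    by rewrite !nthE !tnth_mktuple; ring.
  by rewrite !nth_default ?size_tuple//; ring.
- move=> _ [[x y] [/= Ax By] <-]; apply: contrapT => H.
  suff xy : x = y by have : (A `&` B) x by [split => //; rewrite xy]; rewrite AB.
  apply: eq_from_tnth => i; rewrite !(tnth_nth 0).
  apply: contrapT => /eqP xy; apply: H; exists i => //.
  by rewrite subr_eq0.
have ab x y : A x -> B y ->
    \sum_(k < d.+1) a k * tnth y k <= \sum_(k < d.+1) a k * tnth x k.
  move=> Ax By; rewrite -subr_ge0 -sumrB.
  have -> : \sum_(i < d.+1) (a i * tnth x i - a i * tnth y i) =
      \sum_(k < d.+1) a k * (nth 0 x k - nth 0 y k).
    by apply: eq_bigr => i _; rewrite !(tnth_nth 0) mulrBr.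
  by apply: (aD (fun k => nth 0 x k - nth 0 y k)); exists (x, y).
pose S := [set \sum_(k < d.+1) a k * tnth y k | y in B].
have S0 : S !=set0 by exists (\sum_(k < d.+1) a k * tnth y0 k), y0.
have Sub : has_ubound S.
  by exists (\sum_(k < d.+1) a k * tnth x0 k) => _ [y By <-]; exact: ab.
have affE x : aff (fun k => if k == d.+1 then - sup S else a k) x =
    \sum_(k < d.+1) a k * tnth x k - sup S.
  rewrite /aff eqxx; congr (_ - _); apply: eq_bigr => i _.
  by rewrite ltn_eqF ?ltn_ord.
exists (fun k => if k == d.+1 then - sup S else a k); split.
  exists k; first exact: ltnW.
  by rewrite ltn_eqF.
split=> x xAB; rewrite affE ?subr_ge0 ?subr_le0.
  by apply: ge_sup => // _ [y By <-]; exact: ab.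
by apply: ub_le_sup => //; exists x.
Qed.

(** * Limits of quantizers *)

Lemma sum_pow_near0_gt0 (R : realType) (n : nat) (c : nat -> R) : 0 < c 0%N ->
  \forall e \near 0^'+, 0 < \sum_(k < n.+1) c k * e ^+ k.
Proof.
move=> c0.
apply: (@cvgr_gt _ _ _ _ _ (c 0%N)) => //.
apply: cvg_at_right_filter.
have -> : c 0%N = \sum_(k < n.+1) c k * 0 ^+ k :> R.
  rewrite big_ord_recl /= expr0 mulr1 big1 ?addr0// => i _.
  by rewrite /bump /= exprS mul0r mulr0.
apply: cvg_big => [|k _]; first exact: add_continuous.
apply: cvgM; first exact: cvg_cst.
by apply: exprn_continuous.
Qed.

(** The lowest nonzero coefficient decides the sign to the right of 0: as long as the constant term
    vanishes, a factor [e] splits off. *)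
Lemma sum_pow_sign (R : realType) (n : nat) (c : nat -> R) :
  (exists2 k, (k < n)%N & c k != 0) ->
  (\forall e \near 0^'+, 0 < \sum_(k < n) c k * e ^+ k) \/
  (\forall e \near 0^'+, \sum_(k < n) c k * e ^+ k < 0).
Proof.
elim: n c => [|n IH] c [k kn ck]; first by [].
have [c0|c0|c0] := ltgtP 0 (c 0%N); [by left; exact: sum_pow_near0_gt0| |].
  right; have := @sum_pow_near0_gt0 R n (fun k => - c k).
  rewrite oppr_gt0 => /(_ c0); apply: filterS => e.
  under eq_bigr => i _ do rewrite mulNr.
  by rewrite sumrN oppr_gt0.
have shiftE e : \sum_(k < n.+1) c k * e ^+ k = e * \sum_(k < n) c k.+1 * e ^+ k.
  rewrite big_ord_recl -c0 mul0r add0r mulr_sumr; apply: eq_bigr => i _.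
  by rewrite /bump /= exprS mulrCA.
have e0 : \forall e \near (0 : R)^'+, 0 < e by exact: nbhs_right_gt.
case: (IH (fun k => c k.+1)).
- by case: k => [|k] in kn ck *; [rewrite -c0 eqxx in ck|exists k].
- by move=> H; left; near=> e; rewrite shiftE mulr_gt0//; near: e.
- by move=> H; right; near=> e; rewrite shiftE pmulr_rlt0//; near: e.
Unshelve. all: by end_near. Qed.

Section HalfSpace.
Variables (R : realType) (d : nat).
Implicit Types (c : nat -> R) (x y : d.-tuple R).

(** Translation along the moment curve. It turns [aff c] into a polynomial in [e] with coefficients
    [aff c x, c 0, c 1, ...], so the curve leaves every hyperplane at once. *)
Definition moment_shift x (e : R) : d.-tuple R :=
  [tuple tnth x k + e ^+ k.+1 | k < d].

(* For small [e] the sign of [aff c (moment_shift x e)] is that of the first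
   nonzero number among [aff c x, c 0, c 1, ...]; thus [half c] and [half (- c)]
   are complementary and both convex. *)
Definition half c : set (d.-tuple R) :=
  [set x | \forall e \near 0^'+, 0 < aff c (moment_shift x e)].

Definition shift_coef c x (k : nat) : R := if k is k'.+1 then c k' else aff c x.

Lemma aff_shift c x e : aff c (moment_shift x e) =
  \sum_(k < d.+1) shift_coef c x k * e ^+ k.
Proof.
rewrite big_ord_recl /= expr0 mulr1 /aff addrAC; congr (_ + _).
by rewrite -big_split; apply: eq_bigr => k _; rewrite tnth_mktuple mulrDr.
Qed.

Lemma half_sign c x : (exists2 k, (k < d.+1)%N & c k != 0) ->
  half c x \/ half (fun k => - c k) x.
Proof.
move=> [k kd ck].
case: (@sum_pow_sign R d.+1 (shift_coef c x)).
(* The polynomial is not zero: if [aff c x] and the linear coefficients all vanished, so would the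
   constant [c d]. *)
- have [ax|] := eqVneq (aff c x) 0; last by exists 0%N.
  apply: contrapT => H.
  have c0 i : (i < d)%N -> c i = 0.
    by move=> id; apply/eqP/negP => ci; apply: H; exists i.+1 => //; exact/negP.
  move: ax ck; rewrite /aff big1 ?add0r; last by move=> i _; rewrite c0 ?mul0r.
  move: kd; rewrite ltnS leq_eqVlt => /predU1P[->|kd]; first by move=> -> /eqP.
  by rewrite (c0 _ kd) eqxx.
- by move=> H; left; apply: filterS H => e; rewrite aff_shift.
- by move=> H; right; apply: filterS H => e; rewrite affN oppr_gt0 aff_shift.
Qed.

Lemma half_disj c x : half c x -> half (fun k => - c k) x -> False.
Proof.
move=> h1 h2; near ((0 : R)^'+) => e.
have : 0 < aff c (moment_shift x e) by near: e.
have : 0 < aff (fun k => - c k) (moment_shift x e) by near: e.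
by rewrite affN oppr_gt0 => /lt_trans /[apply]; rewrite ltxx.
Unshelve. all: by end_near. Qed.

Lemma half_gt0 c x : 0 < aff c x -> half c x.
Proof.
move=> cx; have := @sum_pow_near0_gt0 R d
  (shift_coef c x) cx.
by apply: filterS => e; rewrite aff_shift.
Qed.

Lemma half_ge0 c x : half c x -> 0 <= aff c x.
Proof.
move=> hx; rewrite leNgt; apply/negP => cx; apply: (half_disj hx).
by apply: half_gt0; rewrite affN oppr_gt0.
Qed.

Lemma half_cvx c : cvx_set (half c).
Proof.
move=> x y l hx hy /andP[l0 l1].
near=> e.
have -> : moment_shift (eucl_cvx_comb l x y) e =
    eucl_cvx_comb l (moment_shift x e) (moment_shift y e).
  by apply: eq_from_tnth => i; rewrite !tnth_mktuple; ring.
rewrite aff_comb.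
have ax : 0 < aff c (moment_shift x e) by near: e.
have ay : 0 < aff c (moment_shift y e) by near: e.
have [->|ln0] := eqVneq l 0; first by rewrite mul0r add0r subr0 mul1r.
rewrite ltr_pwDl//; first by rewrite mulr_gt0// lt_def ln0.
by apply: mulr_ge0; [rewrite subr_ge0|exact: ltW].
Unshelve. all: by end_near. Qed.

Lemma measurable_aff c : measurable_fun [set: d.-tuple R] (aff c).
Proof.
apply: measurable_funD => //; apply: measurable_sum => k.
by apply: measurable_funM => //; exact: measurable_tnth.
Qed.

Lemma measurable_aff_gt0 c : measurable [set x : d.-tuple R | 0 < aff c x].
Proof.
have := measurable_fun_ltr (measurable_cst (0 : R)) (measurable_aff c).
move=> /(_ measurableT [set true] I).
by rewrite setTI; congr measurable; apply/seteqP; split=> x /=.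
Qed.

Lemma measurable_aff_eq0 c : measurable [set x : d.-tuple R | aff c x = 0].
Proof.
rewrite -[X in measurable X]setTI.
by apply: (measurable_aff c _ (measurable_set1 0)).
Qed.

(** On the hyperplane itself the deciding polynomial no longer depends on the point, so [half c] is
    an open half-space together with all or none of its boundary. *)
Lemma measurable_half c : measurable (half c).
Proof.
pose P := \forall e \near (0:R)^'+, 0 < \sum_(k < d) c k * e ^+ k.+1.
have zeroE x : aff c x = 0 -> half c x <-> P.
  move=> ax.
  have E e : aff c (moment_shift x e) = \sum_(k < d) c k * e ^+ k.+1.
    by rewrite aff_shift big_ord_recl /= ax mul0r add0r.
  by split; apply: filterS => e; rewrite E.
have -> : half c = [set x | 0 < aff c x] `|`
    ([set x | aff c x = 0] `&` [set _ | P]).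
  apply/seteqP; split=> x /=.
    move=> hx; have := half_ge0 hx; rewrite le_eqVlt => /predU1P[ax|]; last by left.
    by right; rewrite -ax; split => //; exact/(zeroE x).
  by move=> [/half_gt0//|[ax /zeroE]]; exact.
apply: measurableU; first exact: measurable_aff_gt0.
have [p|np] := pselect P.
  rewrite (_ : [set _ | P] = setT) ?setIT; first exact: measurable_aff_eq0.
  by apply/seteqP; split.
by rewrite (_ : [set _ | P] = set0) ?setI0//; apply/seteqP; split.
Qed.

End HalfSpace.

(* A point [x] is put in the cell that contains [moment_shift x e] for small
   [e], a point off all the hyperplanes. *)
Lemma quantizer_of_family (R : realType) (d M : nat) (c : 'I_M -> 'I_M -> nat -> R) :
  (forall i j k, c j i k = - c i j k) ->
  (forall i j, i != j -> exists2 k, (k < d.+1)%N & c i j k != 0) ->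
  (forall y : d.-tuple R, (forall i j, i != j -> aff (c i j) y != 0) ->
     exists i, forall j, j != i -> 0 < aff (c i j) y) ->
  exists2 Q : d.-tuple R -> 'I_M, Q_c d M Q &
    forall x j, j != Q x -> half (c (Q x) j) x.
Proof.
move=> anti nz cov.
have cN i j : c j i = (fun k => - c i j k) by apply/funext => k.
have ex (x : d.-tuple R) : exists i, forall j, j != i -> half (c i j) x.
  (* For small [e] the shifted point is off the hyperplane, and its side there tells which of the
     two complementary halves contains [x]. *)
  have nearP i j : \forall e \near (0:R)^'+, i != j ->
      aff (c i j) (moment_shift x e) != 0 /\
      (0 < aff (c i j) (moment_shift x e) -> half (c i j) x).
    have [->|ij] := eqVneq i j; first by near=> e.
    have [h|h] := @half_sign R d (c i j) x (nz _ _ ij).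
      by apply: filterS (h) => e ce _; rewrite gt_eqF.
    apply: filterS (h) => e; rewrite affN oppr_gt0 => ce _; split.
      by rewrite lt_eqF.
    by move=> /(lt_trans ce); rewrite ltxx.
  have near_all : \forall e \near (0:R)^'+, forall i j, i != j ->
      aff (c i j) (moment_shift x e) != 0 /\
      (0 < aff (c i j) (moment_shift x e) -> half (c i j) x).
    by apply: filter_forall => i; apply: filter_forall => j; exact: nearP.
  near ((0:R)^'+) => e.
  have eP : forall i j, i != j -> aff (c i j) (moment_shift x e) != 0 /\
      (0 < aff (c i j) (moment_shift x e) -> half (c i j) x) by near: e.
  have [|i iP] := cov (moment_shift x e); first by move=> i j /eP[].
  exists i => j ji; have [|_] := eP i j; first by rewrite eq_sym.
  by apply; exact: iP.
have [Q QP] := choice ex.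
(* If [x] were in this intersection but in another cell, it would lie in two opposite halves, which
   are disjoint. *)
have cellE i : qcell Q i = \bigcap_(j in [set j | j != i]) half (c i j).
  apply/seteqP; split=> x /=; rewrite /qcell /=.
    by move=> <- j /= ji; exact: QP.
  move=> H; apply: contrapT => /eqP Qi.
  have h1 : half (c i (Q x)) x by exact: H.
  have h2 : half (c (Q x) i) x by apply: QP; rewrite eq_sym.
  by move: h2; rewrite (cN i (Q x)); exact: half_disj.
exists Q => // i; split.
  rewrite cellE; apply: fin_bigcap_measurable; first exact: finite_finset.
  by move=> j _; exact: measurable_half.
move=> x y l; rewrite cellE => hx hy l01 j ji.
by apply: half_cvx => //; [exact: hx|exact: hy].
Unshelve. all: by end_near. Qed.

(** A bounded sequence clusters by compactness of the segment, and a cluster point of an ultrafilter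
    is a limit. *)
Lemma ultra_cvg_bounded (R : realType) (U : set_system nat) (u : nat -> R) (B : R) :
  UltraFilter U -> (forall n, `|u n| <= B) -> exists l : R, u n @[n --> U] --> l.
Proof.
move=> UU uB.
have UB : (u @ U) `[- B, B]%classic.
  apply: (@filterE _ U) => n; rewrite /= in_itv /=.
  by have := uB n; rewrite ler_norml.
have [l [_ cl]] := @segment_compact R (- B) B (u @ U) _ UB.
exists l => A lA.
have [//|UA] := in_ultra_setVsetC (u @^-1` A) UU.
by have [x [nAx Ax]] := cl (~` A) A UA lA; exfalso; exact: nAx.
Qed.

(** Compactness of the quantizers, before any measure enters: [Q] is built from the limits of the
    separating functionals. Away from the limit hyperplanes, coefficients within [eta] of their
    limits have the same strict signs, so the cells agree. *)
Lemma quantizer_cluster (R : realType) (d M : nat)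
    (Qs : nat -> d.+1.-tuple R -> 'I_M) : (forall n, Q_c d.+1 M (Qs n)) ->
  exists c : 'I_M -> 'I_M -> nat -> R, exists Q : d.+1.-tuple R -> 'I_M,
    [/\ Q_c d.+1 M Q,
      forall i j, i != j -> exists2 k, (k < d.+2)%N & c i j k != 0 &
      forall (eta : R) N, 0 < eta -> exists2 n, (N <= n)%N &
        forall y, (forall i j, i != j -> eta * l1wt y < `|aff (c i j) y|) ->
          Qs n y = Q y].
Proof.
move=> Qc.
have [c0 c0P] : exists c0 : nat -> 'I_M -> 'I_M -> nat -> R, forall n i j,
    i != j -> \sum_(k < d.+2) `|c0 n i j k| = 1 /\
      (forall x, Qs n x = i -> 0 <= aff (c0 n i j) x) /\
      (forall x, Qs n x = j -> aff (c0 n i j) x <= 0).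
  have /choice[g gP] : forall p : nat * 'I_M * 'I_M, exists c : nat -> R,
      p.1.2 != p.2 -> \sum_(k < d.+2) `|c k| = 1 /\
      (forall x, Qs p.1.1 x = p.1.2 -> 0 <= aff c x) /\
      (forall x, Qs p.1.1 x = p.2 -> aff c x <= 0).
    move=> [[n i] j] /=; have [->|ij] := eqVneq i j; first by exists (fun=> 0).
    have [||| c cP] := @cvx_sep R d (qcell (Qs n) i) (qcell (Qs n) j).
    - by move=> x y l Ax Ay l01; exact: (Qc n i).2.
    - by move=> x y l Ax Ay l01; exact: (Qc n j).2.
    - apply/seteqP; split=> // x [/= ix jx]; move: ij.
      by rewrite -ix -jx eqxx.
    - by exists c.
  by exists (fun n i j => g (n, i, j)) => n i j ij; exact: (gP (n, i, j)).
(* The separators of [(i, j)] and [(j, i)] are chosen independently; keeping the one with [i < j]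
   makes the family antisymmetric. *)
pose cs n (i j : 'I_M) k := if (i < j)%N then c0 n i j k
  else if (j < i)%N then - c0 n j i k else 0.
have csabs n i j : i != j -> \sum_(k < d.+2) `|cs n i j k| = 1.
  move=> ij; rewrite /cs; have [ltij|ltij|/ord_inj/eqP] := ltngtP i j.
  - exact: (c0P n i j ij).1.
  - under eq_bigr do rewrite normrN.
    by apply: (c0P n j i _).1; rewrite eq_sym.
  - by rewrite (negbTE ij).
have csge0 n i j x : i != j -> Qs n x = i -> 0 <= aff (cs n i j) x.
  move=> ij Qx; have [ltij|ltij|/ord_inj/eqP] := ltngtP i j.
  - rewrite (_ : cs n i j = c0 n i j); first exact: (c0P n i j ij).2.1.
    by apply/funext => k; rewrite /cs ltij.
  - rewrite (_ : cs n i j = (fun k => - c0 n j i k)); last first.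
      by apply/funext => k; rewrite /cs ltnNge ltnW//= ltij.
    by rewrite affN oppr_ge0; apply: (c0P n j i _).2.2 => //; rewrite eq_sym.
  - by rewrite (negbTE ij).
(* [U] refines the filter of cofinite sets, so events that hold along [U] occur for arbitrarily
   large [n]. *)
have [U [UU ooU]] := @ultraFilterLemma nat \oo _.
have [c1 c1P] : exists c1 : 'I_M -> 'I_M -> nat -> R, forall i j k,
    i != j -> (k < d.+2)%N -> c0 n i j k @[n --> U] --> c1 i j k.
  have /choice[g gP] : forall p : 'I_M * 'I_M * nat, exists l : R,
      p.1.1 != p.1.2 -> (p.2 < d.+2)%N -> c0 n p.1.1 p.1.2 p.2 @[n --> U] --> l.
    move=> [[i j] k] /=; have [->|ij] := eqVneq i j; first by exists 0.
    case: (ltnP k d.+2) => kd; last by exists 0.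
    have [n|l ul] := @ultra_cvg_bounded R U (fun n => c0 n i j k) 1 UU.
      rewrite -(c0P n i j ij).1 (bigD1 (Ordinal kd)) //= lerDl.
      by rewrite sumr_ge0.
    by exists l.
  by exists (fun i j k => g (i, j, k)) => i j k; exact: (gP (i, j, k)).
pose c (i j : 'I_M) k := if (i < j)%N then c1 i j k
  else if (j < i)%N then - c1 j i k else 0.
have cscvg i j k : (k < d.+2)%N -> cs n i j k @[n --> U] --> c i j k.
  move=> kd; rewrite /cs /c; have [ltij|ltij|_] := ltngtP i j.
  - by apply: c1P => //; apply/negP => /eqP ij; rewrite ij ltnn in ltij.
  - by apply: cvgN; apply: c1P => //; apply/negP => /eqP ij; rewrite ij ltnn in ltij.
  - exact: cvg_cst.
have anti i j k : c j i k = - c i j k.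
  by rewrite /c; case: (ltngtP i j) => _; rewrite ?opprK ?oppr0.
(* The normalization survives the limit, so the limit coefficients are not all zero. *)
have nz i j : i != j -> exists2 k, (k < d.+2)%N & c i j k != 0.
  move=> ij; apply: contrapT => H.
  have c00 k : (k < d.+2)%N -> c i j k = 0.
    by move=> kd; apply/eqP/negP => ck; apply: H; exists k => //; exact/negP.
  have s1 : \sum_(k < d.+2) `|cs n i j k| @[n --> U] --> \sum_(k < d.+2) `|c i j k|.
    apply: cvg_big => [|k _]; first exact: add_continuous.
    by apply: cvg_norm; exact: cscvg.
  have s2 : \sum_(k < d.+2) `|cs n i j k| @[n --> U] --> (1 : R).
    by under eq_cvg do rewrite csabs//; exact: cvg_cst.
  have : \sum_(k < d.+2) `|c i j k| = 1 by exact: (cvg_unique (@Rhausdorff R) s1 s2).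
  rewrite big1 => [/eqP|k _]; last by rewrite c00 ?normr0.
  by rewrite eq_sym oner_eq0.
have close (eta : R) i j : 0 < eta ->
    \forall n \near U, forall k, (k < d.+2)%N -> `|c i j k - cs n i j k| <= eta.
  move=> eta0.
  have : \forall n \near U, forall k : 'I_d.+2, `|c i j k - cs n i j k| <= eta.
    apply: filter_forall => k.
    by have /cvgrPdist_le := cscvg i j k (ltn_ord k); exact.
  by apply: filterS => n H k kd; exact: (H (Ordinal kd)).
have key eta n i j y : (forall k, (k < d.+2)%N -> `|c i j k - cs n i j k| <= eta) ->
    i != j -> Qs n y = i -> eta * l1wt y < `|aff (c i j) y| -> 0 < aff (c i j) y.
  move=> cl ij Qy H; have := aff_dist y cl; have := csge0 n i j y ij Qy.
  move: H; rewrite ltr_normr ler_norml => + a0 /andP[a1 a2].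
  by move=> /orP[|]; lra.
have [y H|Q Qcc Qhalf] := @quantizer_of_family R d.+1 M c anti nz.
  (* [y] is off all limit hyperplanes. Coefficients this close change the values at [y] by at most
     half, so the cell of [Qs n] that contains [y] wins all its comparisons. *)
  have : \forall n \near U, forall i j, i != j -> forall k, (k < d.+2)%N ->
      `|c i j k - cs n i j k| <= `|aff (c i j) y| / (2 * l1wt y).
    apply: filter_forall => i; apply: filter_forall => j.
    have [->|ij] := eqVneq i j; first exact: filterE.
    have e0 : 0 < `|aff (c i j) y| / (2 * l1wt y).
      by rewrite divr_gt0 ?normr_gt0 ?H// mulr_gt0 ?l1wt_gt0.
    by apply: filterS (close _ i j e0) => n + _.
  move=> /filter_ex[n cl]; exists (Qs n y) => j jQ.
  have ij : Qs n y != j by rewrite eq_sym.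
  apply: (key _ n _ _ _ (cl _ _ ij)) => //.
  rewrite invfM mulrA mulfVK ?gt_eqF ?l1wt_gt0//.
  by have := H _ _ ij; rewrite -normr_gt0 => ?; lra.
exists c, Q; split => // eta N eta0.
have : \forall n \near U, (N <= n)%N /\ forall i j, forall k, (k < d.+2)%N ->
      `|c i j k - cs n i j k| <= eta.
  apply: filterI; first by apply: ooU; exact: nbhs_infty_ge.
  by apply: filter_forall => i; apply: filter_forall => j; exact: close.
move=> /filter_ex[n [Nn cl]]; exists n => // y yP.
(* Were the cells different, [key] would put [y] strictly on the side of [Qs n y], against its
   membership in the opposite half. *)
apply/eqP/negP => /negP QQ.
have h1 : 0 < aff (c (Qs n y) (Q y)) y.
  exact: (key eta n (Qs n y) (Q y) y (cl _ _) QQ erefl (yP _ _ QQ)).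
have := half_ge0 (Qhalf y (Qs n y) QQ).
rewrite (_ : c (Q y) (Qs n y) = (fun k => - c (Qs n y) (Q y) k)).
  by rewrite affN oppr_ge0 leNgt h1.
by apply/funext => k; rewrite anti.
Qed.

(** * Lebesgue measure on tuples *)

Section PushforwardMeasure.
Context d1 d2 (T1 : measurableType d1) (T2 : measurableType d2) (R : realType).

Definition push_measure (m : {measure set T1 -> \bar R}) (f : T1 -> T2)
    (mf : measurable_fun [set: T1] f) : {measure set T2 -> \bar R} :=
  measure_function_pushforward__canonical__measure_function_Measure m mf.

Lemma push_measureE m f mf A : @push_measure m f mf A = m (f @^-1` A).
Proof. by []. Qed.

Lemma integral_push_measure m f mf (g : T2 -> \bar R) :
  measurable_fun [set: T2] g -> (forall y, 0 <= g y)%E ->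
  (\int[@push_measure m f mf]_y g y = \int[m]_x g (f x))%E.
Proof.
move=> mg g0.
rewrite [LHS](@ge0_integral_pushforward _ _ _ _ _ f mf m setT g)//.
Qed.

End PushforwardMeasure.

Section IntegralDensity.
Import HBNNSimple.
Local Open Scope ereal_scope.

(** The formula on sets extends to simple functions by linearity, and to [g] by monotone convergence
    under both measures. *)
Lemma integral_density d (T : measurableType d) (R : realType)
    (mu lam : {measure set T -> \bar R}) (p : T -> R) :
  measurable_fun [set: T] p -> (forall x, (0 <= p x)%R) ->
  (forall A, measurable A -> mu A = \int[lam]_x ((\1_A x : R) * p x)%:E) ->
  forall g : T -> \bar R, measurable_fun [set: T] g -> (forall x, 0 <= g x) ->
  \int[mu]_x g x = \int[lam]_x (g x * (p x)%:E).
Proof.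
move=> mp p0 muE g mg g0.
pose g_ := nnsfun_approx measurableT mg.
have mgp n : measurable_fun setT (fun x => ((g_ n x)%:E * (p x)%:E)).
  apply: emeasurable_funM; last exact/measurable_EFinP.
  exact/measurable_EFinP.
transitivity (limn (fun n => \int[mu]_x (g_ n x)%:E)).
  rewrite -monotone_convergence//.
  - by apply: eq_integral => x _; apply/esym/cvg_lim => //; exact: cvg_nnsfun_approx.
  - by move=> n; exact/measurable_EFinP.
  - by move=> n x _; rewrite lee_fin.
  - by move=> x _ m n mn; rewrite lee_fin; exact/lefP/nd_nnsfun_approx.
rewrite [X in limn X](_ : _ = (fun n => \int[lam]_x ((g_ n x)%:E * (p x)%:E))).
  rewrite -monotone_convergence//.
  - apply: eq_integral => x _; apply/cvg_lim => //.
    by apply: cvgeZr => //; exact: cvg_nnsfun_approx.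
  - by move=> n x _; rewrite mule_ge0// lee_fin.
  - move=> x _ m n mn; rewrite lee_wpmul2r ?lee_fin//.
    exact/lefP/nd_nnsfun_approx.
apply/funext => n.
under eq_integral do rewrite fimfunE// -fsumEFin//.
rewrite ge0_integral_fsum//; last 2 first.
- by move=> r; exact/measurable_EFinP/measurableT_comp.
- by move=> r x _; rewrite nnfun_muleindic_ge0.
transitivity (\int[lam]_x \sum_(r \in range (g_ n))
    ((r * \1_(g_ n @^-1` [set r]) x)%:E * (p x)%:E)); last first.
  apply: eq_integral => x _; rewrite fimfunE// -fsumEFin//.
  by rewrite ge0_mule_fsuml// => r; exact: nnfun_muleindic_ge0.
rewrite ge0_integral_fsum//; last 2 first.
- move=> r; apply: emeasurable_funM; last exact/measurable_EFinP.
  exact/measurable_EFinP/measurableT_comp.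
- by move=> r x _; apply: mule_ge0; [exact: nnfun_muleindic_ge0|rewrite lee_fin].
apply: eq_fsbigr => r /[!inE] -[t _ rE].
have r0 : (0 <= r)%R by rewrite -rE.
rewrite integralZl_indic_nnsfun// integral_indic// setIT muE//.
rewrite -ge0_integralZl_EFin//.
- by apply: eq_integral => x _; rewrite !EFinM muleA.
- by move=> x _; rewrite lee_fin mulr_ge0.
- by apply/measurable_EFinP/measurable_funM.
Qed.

End IntegralDensity.

Section Tonelli.
Local Open Scope ereal_scope.
Context d1 d2 (T1 : measurableType d1) (T2 : measurableType d2) (R : realType).
Variable m1 : {measure set T1 -> \bar R}.

(* An alias that carries finiteness of [m1], so that Tonelli applies to it. *)
Definition fin_measure (_ : m1 setT < +oo) : set T1 -> \bar R := m1.

Section FinMeasure.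
Hypothesis fin1 : m1 setT < +oo.

HB.instance Definition _ := Measure.on (fin_measure fin1).

Lemma fin_measure_fin : fin_num_fun (fin_measure fin1).
Proof.
move=> A mA; rewrite ge0_fin_numE//; apply: le_lt_trans fin1.
by apply: le_measure; rewrite ?inE.
Qed.

HB.instance Definition _ := Measure_isFinite.Build _ _ _ (fin_measure fin1)
  fin_measure_fin.

End FinMeasure.

Variable m2 : {sigma_finite_measure set T2 -> \bar R}.
Hypothesis fin1 : m1 setT < +oo.
Variable f : T1 * T2 -> \bar R.
Hypotheses (mf : measurable_fun setT f) (f0 : forall x, 0 <= f x).

Lemma finite_tonelli : \int[m1 \x m2]_z f z = \int[m1]_x \int[m2]_y f (x, y).
Proof. exact: (fubini_tonelli1 (m1 := fin_measure fin1) f mf f0). Qed.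

Lemma finite_tonelli_swap :
  \int[m1]_x \int[m2]_y f (x, y) = \int[m2]_y \int[m1]_x f (x, y).
Proof. exact: (fubini_tonelli (m1 := fin_measure fin1) f mf f0). Qed.

End Tonelli.

Section LebesgueTuple.
Variable R : realType.

Section ConsMeasure.
Variables (n : nat) (m : {sigma_finite_measure set (n.-tuple R) -> \bar R}).

Lemma measurable_cons_pair :
  measurable_fun [set: R * n.-tuple R] (fun p => cons_tuple p.1 p.2).
Proof. exact: (measurable_cons (f := fst) (g := snd)). Qed.

Definition cons_measure : set (n.+1.-tuple R) -> \bar R :=
  push_measure ((@lebesgue_measure R) \x m)%E measurable_cons_pair.

HB.instance Definition _ := Measure.on cons_measure.

(** Consing has a measurable inverse, so an exhaustion by products [F k] times [G k] carries over to
    tuples. *)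
Lemma cons_measure_sigma_finite : sigma_finite setT cons_measure.
Proof.
have /sigma_finiteP[F [TF ndF Foo]] := sigma_finiteT (@lebesgue_measure R).
have /sigma_finiteP[G [TG ndG Goo]] := sigma_finiteT m.
pose uncons (t : n.+1.-tuple R) := (thead t, [tuple of behead t]).
have muncons : measurable_fun [set: n.+1.-tuple R] uncons.
  apply: measurable_fun_pair; first exact: (measurable_tnth ord0).
  exact: measurable_behead.
have consK (p : R * n.-tuple R) : uncons (cons_tuple p.1 p.2) = p.
  by case: p => x y; congr pair; apply: val_inj.
exists (fun k => uncons @^-1` (F k `*` G k)).
  apply/esym/seteqP; split=> // t _.
  have [i _ Fi] : (\bigcup_k F k) (thead t) by rewrite -TF.
  have [j _ Gj] : (\bigcup_k G k) [tuple of behead t] by rewrite -TG.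
  exists (maxn i j) => //; split => /=.
    by move: Fi; exact/subsetPset/ndF/leq_maxl.
  by move: Gj; exact/subsetPset/ndG/leq_maxr.
move=> k; have [mF Fk] := Foo k; have [mG Gk] := Goo k; split.
  rewrite -[X in measurable X]setTI; apply: muncons => //.
  exact: measurableX.
rewrite /cons_measure push_measureE.
rewrite (_ : _ @^-1` _ = F k `*` G k); last first.
  by apply/funext => p; rewrite /preimage /mkset consK.
by rewrite /= product_measure1E// lte_mul_pinfty// ge0_fin_numE.
Qed.

HB.instance Definition _ := Measure_isSigmaFinite.Build _ _ _ cons_measure
  cons_measure_sigma_finite.

End ConsMeasure.

(** The measure behind [leb_int_d], by the same recursion; sigma-finiteness is carried along because
    Tonelli needs it at each step. *)
Fixpoint leb_tuple (d : nat) : {sigma_finite_measure set (d.-tuple R) -> \bar R} :=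
  match d with
  | 0 => \d_([tuple] : 0.-tuple R)
  | d'.+1 => cons_measure (leb_tuple d')
  end.

Lemma leb_int_dE d (g : d.-tuple R -> \bar R) :
  measurable_fun [set: d.-tuple R] g -> (forall x, 0 <= g x)%E ->
  leb_int_d g = (\int[leb_tuple d]_x g x)%E.
Proof.
elim: d g => [|d IH] g mg g0 /=.
  by rewrite integral_dirac// diracT mul1e.
rewrite /cons_measure integral_push_measure//.
rewrite (@fubini_tonelli1 _ _ _ _ _ (@lebesgue_measure R) (leb_tuple d)
  (fun p => g (cons_tuple p.1 p.2)))//; last first.
  exact: (measurableT_comp mg (@measurable_cons_pair d)).
apply: eq_integral => x _; rewrite IH//.
apply: (measurableT_comp mg).
exact: (measurableT_comp (@measurable_cons_pair d) (pair1_measurable x)).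
Qed.

(** Slice by the first coordinate. If another linear coefficient is nonzero, every slice is again a
    hyperplane; if only [c 0] is, all slices but the one at [x0] are empty; with no linear part the
    set is empty. *)
Lemma leb_int_d_hyperplane d (c : nat -> R) (g : d.-tuple R -> \bar R) :
  (exists2 k, (k < d.+1)%N & c k != 0) ->
  (forall x, aff c x != 0 -> g x = 0%E) -> leb_int_d g = 0%E.
Proof.
elim: d c g => [|d IH] c g [k kd ck] g0 /=.
  apply: g0; rewrite /aff big_ord0 add0r.
  by move: kd ck; rewrite ltnS leqn0 => /eqP ->.
pose cx (x : R) k := if k == d then c d.+1 + c 0%N * x else c k.+1.
have affE x y : aff c (cons_tuple x y : d.+1.-tuple R) = aff (cx x) y.
  transitivity (c 0%N * x + \sum_(i < d) c i.+1 * tnth y i + c d.+1).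
    rewrite /aff big_ord_recl tnth0; congr (_ + _ + _).
    by apply: eq_bigr => i _; rewrite tnthS.
  rewrite /aff /cx eqxx [in RHS](eq_bigr (fun i : 'I_d => c i.+1 * tnth y i)).
    ring.
  by move=> i _; rewrite ltn_eqF ?ltn_ord.
have slice0 x : (exists2 k, (k < d.+1)%N & cx x k != 0) ->
    leb_int_d (fun y : d.-tuple R => g (cons_tuple x y)) = 0%E.
  by move=> cxk; apply: (IH (cx x)) => // y; rewrite -affE; exact: g0.
have [[j jd cj]|nc] := pselect (exists2 j, (j < d)%N & c j.+1 != 0).
  apply: integral0_eq => x _; apply: slice0; exists j; first exact: ltnW.
  by rewrite /cx ltn_eqF.
have [c00|c00] := eqVneq (c 0%N) 0.
  apply: integral0_eq => x _; apply: slice0; exists d => //.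
  rewrite /cx eqxx c00 mul0r addr0.
  move: kd ck; rewrite ltnS leq_eqVlt => /predU1P[->//|].
  case: k => [|k]; first by rewrite c00 eqxx.
  by rewrite ltnS => kd ck; exfalso; apply: nc; exists k.
pose x0 := - c d.+1 / c 0%N.
rewrite -(integral_set1 (fun x => leb_int_d (fun y : d.-tuple R => g (cons_tuple x y))) x0).
rewrite [RHS]integral_mkcond; apply: eq_integral => x _.
rewrite patchE; case: ifPn => // xx0; apply: slice0; exists d => //.
rewrite /cx eqxx; apply: contra xx0 => /eqP H; rewrite inE /x0 /=.
apply: (canRL (mulfK c00)); rewrite mulrC.
by apply/eqP; rewrite -addr_eq0 addrC H.
Qed.

End LebesgueTuple.

Section Restriction.
Local Open Scope ereal_scope.
Context d (T : measurableType d) (R : realType).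
Implicit Types (mu : {measure set T -> \bar R}) (A B : set T).

(* Restriction to [A]; the zero measure when [A] is not measurable. *)
Definition mres mu A : {measure set T -> \bar R} :=
  match pselect (measurable A) with
  | left mA => measure_function_mrestr__canonical__measure_function_Measure mu mA
  | right _ => mzero
  end.

Arguments mres : simpl never.

Lemma mresE mu A B : measurable A -> mres mu A B = mu (B `&` A).
Proof. by rewrite /mres; case: pselect. Qed.

Lemma integral_mres mu A (g : T -> \bar R) : measurable A ->
  measurable_fun [set: T] g -> (forall x, 0 <= g x) ->
  \int[mres mu A]_x g x = \int[mu]_(x in A) g x.
Proof.
move=> mA mg g0.
rewrite (@integral_density _ _ _ (mres mu A) mu (\1_A))//; last first.
  move=> B mB; rewrite mresE// -[in LHS](setIT (B `&` A)) -integral_indic//.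
    by apply: eq_integral => x _; rewrite indicI.
  exact: measurableI.
rewrite [RHS]integral_mkcond; apply: eq_integral => x _.
by rewrite patchE indicE; case: ifPn; rewrite ?mule1 ?mule0.
Qed.

End Restriction.

(** * Lipschitz functions and their averages over cubes *)

Section Boxes.
Variable R : realType.

(** Dominates the Euclidean distance, so Lipschitz constants are kept, and splits over the
    coordinates. *)
Definition l1dist d (x y : d.-tuple R) : R := \sum_(i < d) `|tnth x i - tnth y i|.

Lemma eucl_dist_le_l1 d (x y : d.-tuple R) : eucl_dist x y <= l1dist x y.
Proof.
have l0 : 0 <= l1dist x y by apply: sumr_ge0.
rewrite /eucl_dist -[leRHS]ger0_norm// -sqrtr_sqr ler_sqrt ?sqr_ge0//.
rewrite /eucl_sqdist expr2 [X in _ <= X * _]/l1dist mulr_suml ler_sum// => i _.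
rewrite -real_normK ?num_real// expr2 ler_wpM2l//.
by rewrite /l1dist (bigD1 i)//= lerDl sumr_ge0.
Qed.

Lemma measurable_l1dist d (y : d.-tuple R) :
  measurable_fun [set: d.-tuple R] (fun x => l1dist x y).
Proof.
apply: measurable_sum => i; apply: measurableT_comp => //.
by apply: measurable_funB => //; exact: measurable_tnth.
Qed.

(** A sublevel set is a countable union over rational points [q] of the sets where the Lipschitz
    upper bound based at [q] is already below the level. *)
Lemma l1_lipschitz_measurable d (L : R) (p : d.-tuple R -> R) : 0 <= L ->
  (forall x y, `|p x - p y| <= L * l1dist x y) -> measurable_fun [set: d.-tuple R] p.
Proof.
move=> L0 lip; apply: (measurability _ (RGenInftyO.measurableE R)).
move=> _ [_ [a ->] <-]; rewrite setTI.
pose rq (q : d.-tuple rat) : d.-tuple R := [tuple ratr (tnth q i) | i < d].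
have -> : p @^-1` `]-oo, a[ =
    \bigcup_q [set x | p (rq q) + L * l1dist x (rq q) < a].
  apply/seteqP; split=> x /=; rewrite in_itv /=; last first.
    move=> [q _ /=]; apply: le_lt_trans; rewrite -lerBlDl.
    exact: le_trans (ler_norm _) (lip _ _).
  (* A rational point within [del] in each coordinate loses at most [2 * L * d * del], which is less
     than [a - p x]; the [+ 1] keeps the denominator positive. *)
  move=> pxa; pose del := (a - p x) / (2 * L * d%:R + 1).
  have D0 : 0 < 2 * L * d%:R + 1 by rewrite ltr_wpDl// !mulr_ge0.
  have del0 : 0 < del by rewrite divr_gt0// subr_gt0.
  have /choice[q qP] : forall i : 'I_d, exists q : rat,
      `|tnth x i - ratr q| <= del.
    move=> i; have : tnth x i - del < tnth x i + del by lra.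
    move=> /rat_in_itvoo[q]; rewrite in_itv /= => /andP[q1 q2].
    by exists q; rewrite ler_norml; apply/andP; split; lra.
  exists [tuple q i | i < d] => //=.
  have lq : l1dist x (rq [tuple q i | i < d]) <= d%:R * del.
    rewrite /l1dist (le_trans (ler_sum (G := fun=> del) _ _))//.
      by move=> i _; rewrite !tnth_mktuple.
    by rewrite sumr_const card_ord mulr_natl.
  have := lip (rq [tuple q i | i < d]) x; rewrite ler_norml => /andP[_].
  have -> : l1dist (rq [tuple q i | i < d]) x = l1dist x (rq [tuple q i | i < d]).
    by apply: eq_bigr => i _; rewrite distrC.
  have := ler_wpM2l L0 lq.
  have : 2 * (L * (d%:R * del)) < a - p x.
    rewrite (_ : a - p x = del * (2 * L * d%:R + 1)); last first.
      by rewrite /del mulfVK// gt_eqF.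
    by rewrite (_ : 2 * _ = del * (2 * L * d%:R)); [lra|ring].
  lra.
apply: countable_bigcupT_measurable; first exact: countableP.
move=> q; have mpl : measurable_fun [set: d.-tuple R] (fun x => p (rq q) + L * l1dist x (rq q)).
  apply: measurable_funD => //; apply: measurable_funM => //.
  exact: measurable_l1dist.
have := measurable_fun_ltr mpl (measurable_cst a).
move=> /(_ measurableT [set true] I).
by rewrite setTI; congr measurable; apply/seteqP; split=> x /=.
Qed.

Definition box d (z : d.-tuple R) (r : R) : set (d.-tuple R) :=
  [set y | forall i, `|tnth y i - tnth z i| <= r].

Lemma box_l1dist d (z y : d.-tuple R) r : box z r y -> l1dist y z <= d%:R * r.
Proof.
move=> yz; rewrite /l1dist (le_trans (ler_sum (G := fun=> r) _ _))//.
by rewrite sumr_const card_ord mulr_natl.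
Qed.

Lemma measurable_box d (z : d.-tuple R) r : measurable (box z r).
Proof.
have -> : box z r = \bigcap_(i in [set: 'I_d])
    ((fun y : d.-tuple R => `|tnth y i - tnth z i| <= r) @^-1` [set true]).
  by apply/seteqP; split=> y /= H i => [_|]; exact: H.
apply: fin_bigcap_measurable; first exact: finite_finset.
move=> i _; rewrite -[X in measurable X]setTI.
apply: measurable_fun_ler => //; apply: measurableT_comp => //.
by apply: measurable_funB => //; exact: measurable_tnth.
Qed.

Lemma leb_int_d0 d : leb_int_d (fun _ : d.-tuple R => 0%E) = 0%E.
Proof. by elim: d => [|d IH] //=; apply: integral0_eq => x _. Qed.

Lemma leb_int_box d (z : d.-tuple R) (r : R) : 0 <= r ->
  leb_int_d (fun y => (\1_(box z r) y : R)%:E) = ((2 * r) ^+ d)%:E.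
Proof.
move=> r0; elim: d z => [|d IH] z /=.
  by rewrite expr0 indicE mem_set// => -[].
pose z' := [tuple of behead z].
have zE i : tnth z (lift ord0 i) = tnth z' i.
  by rewrite !(tnth_nth 0) /= nth_behead.
have boxE x y : box z r (cons_tuple x y) <-> `|x - thead z| <= r /\ box z' r y.
  split=> [H|[H1 H2] i].
    split; first exact: (H ord0).
    by move=> i; have := H (lift ord0 i); rewrite tnthS zE.
  by case: (unliftP ord0 i) => [j ->|->] //; rewrite tnthS zE.
transitivity (\int[@lebesgue_measure R]_(x in `[(thead z - r)%R, (thead z + r)%R])
    ((2 * r) ^+ d)%:E)%E; last first.
  rewrite integral_cst//= lebesgue_measure_itv /= lte_fin.
  case: ifPn => [_|]; last first.
    rewrite -leNgt => Hr; have -> : r = 0 by lra.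
    by rewrite mulr0 exprS mul0r mule0.
  by rewrite -EFinD -EFinM exprSr; congr (_ * _)%:E; ring.
rewrite [RHS]integral_mkcond; apply: eq_integral => x _; rewrite patchE.
have xE : (x \in `[thead z - r, thead z + r]%classic) = (`|x - thead z| <= r).
  by apply/idP/idP; rewrite inE /= in_itv /= ler_norml => /andP[? ?]; apply/andP; split; lra.
rewrite xE; case: ifPn => H.
  rewrite -(IH z'); congr leb_int_d; apply/funext => y; congr (_%:E).
  rewrite !indicE; congr ((_ : bool)%:R); apply/idP/idP; rewrite !inE.
    by move=> /boxE[].
  by move=> ?; apply/boxE.
transitivity (leb_int_d (fun _ : d.-tuple R => 0%E : \bar R)); last exact: leb_int_d0.
congr leb_int_d; apply/funext => y.
by rewrite indicE memNset// => /boxE[xr _]; rewrite xr in H.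
Qed.

Lemma leb_tuple_box d (z : d.-tuple R) (r : R) : 0 <= r ->
  leb_tuple R d (box z r) = ((2 * r) ^+ d)%:E.
Proof.
move=> r0; rewrite -(leb_int_box z r0) leb_int_dE//.
- by rewrite integral_indic ?setIT//; exact: measurable_box.
- by apply/measurable_EFinP; apply: measurable_indic; exact: measurable_box.
Qed.

(** On the box [q] differs from [q z] by at most [L * (d * r)]. Both bounds are additive, which
    avoids subtracting extended reals. *)
Lemma box_average d (q : d.-tuple R -> R) (L r : R) (z : d.-tuple R) :
  0 <= L -> 0 <= r -> (forall x, 0 <= q x) ->
  (forall x y, `|q x - q y| <= L * l1dist x y) ->
  let I := leb_int_d (fun y => ((\1_(box z r) y : R) * q y)%:E) in
  (I <= ((q z + L * (d%:R * r)) * (2 * r) ^+ d)%:E)%E /\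
  ((q z * (2 * r) ^+ d)%:E <= I + (L * (d%:R * r) * (2 * r) ^+ d)%:E)%E.
Proof.
move=> L0 r0 q0 lip I.
have mq := l1_lipschitz_measurable L0 lip.
have mb : measurable_fun [set: d.-tuple R] (\1_(box z r) : _ -> R).
  by apply: measurable_indic; exact: measurable_box.
have cstE (a : R) : 0 <= a ->
    (\int[leb_tuple R d]_y ((\1_(box z r) y : R) * a)%:E = (a * (2 * r) ^+ d)%:E)%E.
  move=> a0; rewrite EFinM -(leb_tuple_box z r0) -[in RHS](setIT (box z r)).
  rewrite -integral_indic//; last exact: measurable_box.
  rewrite -ge0_integralZl_EFin//; do ?[exact/measurable_EFinP|by move=> x _; rewrite lee_fin].
  by apply: eq_integral => x _; rewrite mulrC EFinM.
have IE : I = (\int[leb_tuple R d]_y ((\1_(box z r) y : R) * q y)%:E)%E.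
  rewrite /I leb_int_dE//; first exact/measurable_EFinP/measurable_funM.
  by move=> x; rewrite lee_fin mulr_ge0.
have dr0 : 0 <= L * (d%:R * r) by rewrite !mulr_ge0.
have near_q y : box z r y -> `|q y - q z| <= L * (d%:R * r).
  by move=> zy; rewrite (le_trans (lip _ _))// ler_wpM2l// box_l1dist.
split.
  rewrite IE -cstE ?addr_ge0//; apply: ge0_le_integral => //.
  - by move=> y _; rewrite lee_fin mulr_ge0.
  - exact/measurable_EFinP/measurable_funM.
  - exact/measurable_EFinP/measurable_funM.
  - move=> y _; rewrite lee_fin indicE; case: (boolP (y \in box z r)); last by rewrite !mul0r.
    by rewrite inE !mul1r => /near_q; rewrite ler_norml => /andP[_]; lra.
rewrite IE -(cstE _ dr0) -cstE// -ge0_integralD//.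
- apply: ge0_le_integral => //.
  + by move=> y _; rewrite lee_fin mulr_ge0.
  + exact/measurable_EFinP/measurable_funM.
  + by apply: emeasurable_funD; exact/measurable_EFinP/measurable_funM.
  + move=> y _; rewrite -EFinD lee_fin indicE; case: (boolP (y \in box z r)); last by rewrite !mul0r addr0.
    by rewrite inE !mul1r => /near_q; rewrite ler_norml => /andP[+ _]; lra.
- by move=> y _; rewrite lee_fin mulr_ge0.
- exact/measurable_EFinP/measurable_funM.
- by move=> y _; rewrite lee_fin mulr_ge0.
- exact/measurable_EFinP/measurable_funM.
Qed.

End Boxes.

(** * The transition kernel *)

Section Kernel.
Variables (R : realType) (d : nat).
Variables (f : d.-tuple R -> d.-tuple R -> d.-tuple R)
  (nu_w : probability (d.-tuple R) R).
Hypothesis f_meas : measurable_fun [set: d.-tuple R * d.-tuple R]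
  (fun p : d.-tuple R * d.-tuple R => f p.1 p.2).

(** The law of [f x w] for [x] drawn from [mu] and independent noise [w]. Building it from [f] gives
    a measure before anything is known about the measurability of [phi]. *)
Definition kpush (mu : {measure set (d.-tuple R) -> \bar R}) :
    {measure set (d.-tuple R) -> \bar R} :=
  push_measure
    (lebesgue_integral_fubini_product_measure1__canonical__measure_function_Measure mu nu_w)
    f_meas.

Arguments kpush : simpl never.

Lemma kpushE mu A : kpush mu A = (\int[mu]_x nu_w (f x @^-1` A))%E.
Proof.
rewrite /kpush push_measureE /= /product_measure1; apply: eq_integral => x _ /=.
by congr (nu_w _); apply/seteqP; split=> w; rewrite /xsection /= inE.
Qed.

Lemma integral_kpush (mu : {measure set (d.-tuple R) -> \bar R})
    (h : d.-tuple R -> \bar R) : (mu setT < +oo)%E ->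
  measurable_fun [set: d.-tuple R] h -> (forall x, 0 <= h x)%E ->
  (\int[kpush mu]_z h z = \int[mu]_x \int[nu_w]_w h (f x w))%E.
Proof.
move=> fin mh h0; rewrite /kpush integral_push_measure//.
rewrite (finite_tonelli nu_w fin (f := fun p => h (f p.1 p.2)))//.
exact: (measurableT_comp mh f_meas).
Qed.

Variables (phi : d.-tuple R -> d.-tuple R -> R) (C1 : R).
Hypothesis phi_law : forall x (A : set (d.-tuple R)), measurable A ->
  nu_w (f x @^-1` A) = leb_int_d (fun z => ((\1_A z : R) * phi x z)%:E).
Hypothesis phi_pos : forall x z, 0 < phi x z.
Hypothesis phi_lip : forall x z z', `|phi x z - phi x z'| <= C1 * eucl_dist z z'.

Lemma phi_l1_lip x z z' : `|phi x z - phi x z'| <= `|C1| * l1dist z z'.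
Proof.
apply: (le_trans (phi_lip _ _ _)).
apply: (@le_trans _ _ (`|C1| * eucl_dist z z')).
  by rewrite ler_wpM2r ?ler_norm// sqrtr_ge0.
by rewrite ler_wpM2l// eucl_dist_le_l1.
Qed.

Lemma measurable_phi2 x : measurable_fun [set: d.-tuple R] (phi x).
Proof. by apply: (@l1_lipschitz_measurable _ _ `|C1|) => // *; exact: phi_l1_lip. Qed.

Lemma measurable_f2 x : measurable_fun [set: d.-tuple R] (f x).
Proof. exact: (measurableT_comp f_meas (pair1_measurable x)). Qed.

(** Each transition law has a density, so their mixture ignores hyperplanes whatever [mu] is: one
    step of the source restores [affine_null]. *)
Lemma kpush_hyperplane mu (c : nat -> R) :
  (exists2 k, (k < d.+1)%N & c k != 0) -> kpush mu [set x | aff c x = 0] = 0%E.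
Proof.
move=> cn0; rewrite kpushE integral0_eq// => x _.
rewrite phi_law; last exact: measurable_aff_eq0.
apply: (leb_int_d_hyperplane cn0) => z cz.
by rewrite indicE memNset ?mul0r//=; exact/eqP.
Qed.

(* [phi x z] is the limit of [nu_w (f x @^-1` box z r) / (2 r)^d] as [r] tends to
   0, and these quotients are measurable in [x]. *)
Lemma measurable_phi : measurable_fun [set: d.-tuple R * d.-tuple R]
  (fun p : d.-tuple R * d.-tuple R => phi p.1 p.2).
Proof.
pose r (n : nat) : R := n.+1%:R^-1.
have r0 n : 0 < r n by rewrite invr_gt0.
pose I n (p : d.-tuple R * d.-tuple R) := nu_w (f p.1 @^-1` box p.2 (r n)).
have Ifin n p : I n p \is a fin_num.
  apply: fin_num_measure; rewrite -[X in measurable X]setTI.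
  by apply: measurable_f2 => //; exact: measurable_box.
pose h n (p : d.-tuple R * d.-tuple R) := fine (I n p) / (2 * r n) ^+ d.
have mI n : measurable_fun setT (I n).
  pose A : set ((d.-tuple R * d.-tuple R) * d.-tuple R) :=
    [set q | box q.1.2 (r n) (f q.1.1 q.2)].
  have mA : measurable A.
    have -> : A = \bigcap_(i in [set: 'I_d])
        ((fun q : (d.-tuple R * d.-tuple R) * d.-tuple R =>
          `|tnth (f q.1.1 q.2) i - tnth q.1.2 i| <= r n) @^-1` [set true]).
      by apply/seteqP; split=> y /= H i => [_|]; exact: H.
    apply: fin_bigcap_measurable; first exact: finite_finset.
    move=> i _; rewrite -[X in measurable X]setTI.
    apply: measurable_fun_ler => //; apply: measurableT_comp => //.
    apply: measurable_funB.
      apply: (measurableT_comp (measurable_tnth i)).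
      apply: (measurableT_comp f_meas (g := fun q : (d.-tuple R * d.-tuple R) * d.-tuple R => (q.1.1, q.2))).
      apply: measurable_fun_pair => //.
      exact: (measurableT_comp measurable_fst measurable_fst).
    apply: (measurableT_comp (measurable_tnth i)).
    exact: (measurableT_comp measurable_snd measurable_fst).
  have := @measurable_fun_xsection _ _ _ _ _ nu_w A mA.
  congr measurable_fun; apply/funext => p /=; rewrite /I; congr (nu_w _).
  by apply/seteqP; split=> w; rewrite /xsection /= inE.
apply: (@measurable_fun_cvg _ _ _ setT h) => [n|p _].
  apply: measurable_funM => //.
  exact: (measurableT_comp (fine_measurable measurableT) (mI n)).
(* The bounds of [box_average], divided by the volume of the box. *)
have hb n : `|phi p.1 p.2 - h n p| <= `|C1| * d%:R * r n.
  have [] := @box_average R d (phi p.1) `|C1| (r n) p.2 (normr_ge0 _) (ltW (r0 n))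
    (fun z => ltW (phi_pos _ _)) (@phi_l1_lip p.1).
  have V0 : 0 < (2 * r n) ^+ d by rewrite exprn_gt0// mulr_gt0.
  rewrite -phi_law; last exact: measurable_box.
  rewrite -/(I n p) -(fineK (Ifin n p)) -EFinD !lee_fin => H1 H2.
  rewrite ler_norml lerNl opprB lerBlDr /h ler_pdivrMr// lerBlDr -lerBlDl ler_pdivlMr//.
  by rewrite mulrBl; apply/andP; split; lra.
apply/cvgrPdist_le => e e0.
have D0 : 0 < `|C1| * d%:R + 1 by rewrite ltr_wpDl// mulr_ge0.
have H : \forall n \near \oo, n.+1%:R^-1 <= (`|C1| * d%:R + 1)^-1 * e.
  have e1 : 0 < (`|C1| * d%:R + 1)^-1 * e by rewrite mulr_gt0// invr_gt0.
  have := @near_infty_natSinv_lt R (PosNum e1).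
  by apply: filterS => m /ltW.
near=> n; apply: (le_trans (hb n)).
apply: (@le_trans _ _ ((`|C1| * d%:R + 1) * r n)).
  by apply: ler_wpM2r; [exact: ltW|rewrite lerDl].
rewrite -ler_pdivlMl//.
by near: n; exact: H.
Unshelve. all: by end_near. Qed.

(* The division is by 0 when the cell is null; both sides are then 0. *)
Lemma hat_piE M (mu : {measure set (d.-tuple R) -> \bar R})
    (Q : d.-tuple R -> 'I_M) (m : 'I_M) A : (mu setT < +oo)%E ->
  measurable (qcell Q m) -> measurable A ->
  hat_pi phi m mu Q A =
    ((fine (mu (qcell Q m)))^-1%:E * kpush (mres mu (qcell Q m)) A)%E.
Proof.
move=> fin mQ mA; set nu := mres mu (qcell Q m).
have nufin : (nu setT < +oo)%E.
  rewrite /nu mresE// setTI; apply: le_lt_trans fin.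
  by apply: le_measure; rewrite ?inE.
have mphi1 z : measurable_fun [set: d.-tuple R] (fun x => (phi x z)%:E).
  apply/measurable_EFinP.
  exact: (measurableT_comp measurable_phi (pair2_measurable z)).
have inE' z : (\int[mu]_(x in qcell Q m) (phi x z)%:E = \int[nu]_x (phi x z)%:E)%E.
  by rewrite /nu integral_mres// => x; rewrite lee_fin ltW.
have mF : measurable_fun [set: d.-tuple R * d.-tuple R]
    (fun p : d.-tuple R * d.-tuple R => ((\1_A p.2 : R) * phi p.1 p.2)%:E).
  apply/measurable_EFinP; apply: measurable_funM; last exact: measurable_phi.
  exact: (measurableT_comp (measurable_indic mA) measurable_snd).
have F0 p : (0 <= ((\1_A p.2 : R) * phi p.1 p.2)%:E)%E.
  by rewrite lee_fin mulr_ge0// ltW.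
have GE z : (\int[nu]_x ((\1_A z : R) * phi x z)%:E =
    (\1_A z : R)%:E * \int[nu]_x (phi x z)%:E)%E.
  rewrite -ge0_integralZl_EFin//.
  by move=> x _; rewrite lee_fin ltW.
have mG := measurable_fun_fubini_tonelli_G (m1 := fin_measure nufin) _ mF F0.
have c0 : (0 <= (fine (mu (qcell Q m)))^-1%:E)%E.
  by rewrite lee_fin invr_ge0 fine_ge0.
have G0 z : (0 <= \int[nu]_x ((\1_A z : R) * phi x z)%:E)%E.
  by apply: integral_ge0 => x _; exact: (F0 (x, z)).
rewrite /hat_pi.
rewrite (_ : (fun z => _) = (fun z => (fine (mu (qcell Q m)))^-1%:E *
    \int[nu]_x ((\1_A z : R) * phi x z)%:E)%E); last first.
  by apply/funext => z; rewrite inE' GE muleCA muleA.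
rewrite leb_int_dE; last 2 first.
- by apply: emeasurable_funM => //; exact: mG.
- by move=> z; rewrite mule_ge0.
rewrite ge0_integralZl_EFin; do ?[by []|exact: mG|by rewrite -lee_fin|by move=> z _; exact: G0].
(* After the exchange, the inner integral over [z] is the transition law by [phi_law]. *)
congr (_ * _)%E; rewrite -(finite_tonelli_swap (leb_tuple R d) nufin mF F0).
rewrite kpushE; apply: eq_integral => x _; rewrite phi_law// leb_int_dE//.
- apply/measurable_EFinP; apply: measurable_funM; first exact: measurable_indic.
  exact: measurable_phi2.
- by move=> z; exact: (F0 (x, z)).
Qed.

End Kernel.

(** * Weighted total variation *)

Lemma near_right0 (R : realType) (P : R -> Prop) :
  (forall a b, 0 < a -> a <= b -> P b -> P a) -> (exists2 b, 0 < b & P b) ->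
  \forall a \near 0^'+, P a.
Proof.
move=> mono [b b0 Pb]; near=> a; apply: (mono a b) => //; near: a; exact: nbhs_right_le.
Unshelve. all: by end_near. Qed.

Section Weighted.
Variables (R : realType) (d : nat).
Local Notation T := (d.-tuple R).
Implicit Types (mu nu : {measure set T -> \bar R}) (A B : set T) (x u : T).

Definition wt x : R := 1 + eucl_sqnorm x.

Lemma eucl_sqnorm_ge0 x : 0 <= eucl_sqnorm x.
Proof. by apply: sumr_ge0 => i _; exact: sqr_ge0. Qed.

Lemma wt_ge1 x : 1 <= wt x.
Proof. by rewrite lerDl eucl_sqnorm_ge0. Qed.

Lemma wt_ge0 x : 0 <= wt x.
Proof. exact: le_trans ler01 (wt_ge1 x). Qed.

Lemma measurable_sqnorm : measurable_fun [set: T] (@eucl_sqnorm R d).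
Proof.
apply: measurable_sum => i; apply: measurable_funX; exact: measurable_tnth.
Qed.

Lemma measurable_wt : measurable_fun [set: T] wt.
Proof. by apply: measurable_funD => //; exact: measurable_sqnorm. Qed.

Lemma measurable_EFin_wt : measurable_fun [set: T] (fun x => (wt x)%:E).
Proof. by apply/measurable_EFinP; exact: measurable_wt. Qed.

Lemma measurable_sqdist u : measurable_fun [set: T] (fun x => eucl_sqdist x u).
Proof.
apply: measurable_sum => i; apply: measurable_funX.
by apply: measurable_funB => //; exact: measurable_tnth.
Qed.

Lemma eucl_sqdist_ge0 x u : 0 <= eucl_sqdist x u.
Proof. by apply: sumr_ge0 => i _; exact: sqr_ge0. Qed.

Lemma sqdist_le x u : eucl_sqdist x u <= 2 * (1 + eucl_sqnorm u) * wt x.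
Proof.
apply: (@le_trans _ _ (2 * eucl_sqnorm x + 2 * eucl_sqnorm u)).
  rewrite /eucl_sqdist /eucl_sqnorm !mulr_sumr -big_split ler_sum//= => i _.
  by have := sqr_ge0 (tnth x i + tnth u i); nra.
rewrite /wt; have := eucl_sqnorm_ge0 x; have := eucl_sqnorm_ge0 u; nra.
Qed.

Lemma sqnorm_le_sqdist x u : eucl_sqnorm u <= 2 * eucl_sqdist x u + 2 * eucl_sqnorm x.
Proof.
rewrite /eucl_sqdist /eucl_sqnorm !mulr_sumr -big_split ler_sum//= => i _.
by have := sqr_ge0 (2 * tnth x i - tnth u i); nra.
Qed.

Definition affine_null mu := forall c : nat -> R,
  (exists2 k, (k < d.+1)%N & c k != 0) -> mu [set x | aff c x = 0] = 0%E.

Definition good mu := (\int[mu]_x (wt x)%:E < +oo)%E /\ affine_null mu.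

(* Closeness in the total variation norm weighted by [wt]. *)
Definition wclose mu nu (e : R) := forall h : T -> R, measurable_fun [set: T] h ->
  (forall x, 0 <= h x <= wt x) ->
  (\int[mu]_x (h x)%:E <= \int[nu]_x (h x)%:E + e%:E)%E /\
  (\int[nu]_x (h x)%:E <= \int[mu]_x (h x)%:E + e%:E)%E.

(** The additive form of the two bounds makes sense for infinite values. *)
Definition wcontinuous (G : {measure set T -> \bar R} -> \bar R) :=
  forall mu, good mu -> forall e : R, 0 < e -> \forall del \near 0^'+,
    forall nu, good nu -> wclose mu nu del ->
      (G mu <= G nu + e%:E)%E /\ (G nu <= G mu + e%:E)%E.

Lemma wclose_sym mu nu e : wclose mu nu e -> wclose nu mu e.
Proof. by move=> H h mh hw; have [] := H h mh hw; split. Qed.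

Lemma wclose_refl mu e : 0 <= e -> wclose mu mu e.
Proof. by move=> e0 h mh hw; split; rewrite leeDl ?lee_fin. Qed.

Lemma wclose_le mu nu a b : a <= b -> wclose mu nu a -> wclose mu nu b.
Proof.
move=> ab H h mh hw; have [H1 H2] := H h mh hw.
by split; [apply: le_trans H1 _|apply: le_trans H2 _]; rewrite leeD2l ?lee_fin.
Qed.

Lemma wclose_scale mu nu e c (h : T -> R) : wclose mu nu e -> 0 < c ->
  measurable_fun [set: T] h -> (forall x, 0 <= h x <= c * wt x) ->
  (\int[mu]_x (h x)%:E <= \int[nu]_x (h x)%:E + (c * e)%:E)%E.
Proof.
move=> H c0 mh hw.
have mg : measurable_fun [set: T] (fun x => c^-1 * h x) by exact: measurable_funM.
have gw x : 0 <= c^-1 * h x <= wt x.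
  have /andP[h1 h2] := hw x.
  by rewrite mulr_ge0 ?invr_ge0 ?(ltW c0)//= ler_pdivrMl.
have [H1 _] := H _ mg gw.
have E (m : {measure set T -> \bar R}) :
    (\int[m]_x (h x)%:E = c%:E * \int[m]_x (c^-1 * h x)%:E)%E.
  rewrite -ge0_integralZl_EFin ?(ltW c0)//.
  - by apply: eq_integral => x _; rewrite -EFinM mulVKf// gt_eqF.
  - by move=> x _; rewrite lee_fin; case/andP: (gw x).
  - exact/measurable_EFinP.
by rewrite !E EFinM -muleDr ?lee_pmul2l ?fin_num_adde_defl ?lte_fin.
Qed.

Lemma good_fin mu : good mu -> (mu setT < +oo)%E.
Proof.
move=> [H _]; apply: le_lt_trans H.
rewrite -[leLHS]mul1e -integral_cst//; apply: ge0_le_integral => //.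
- exact: measurable_EFin_wt.
- by move=> x _; rewrite lee_fin wt_ge1.
Qed.

Lemma integral_subset_wt mu A : measurable A ->
  (\int[mu]_(x in A) (wt x)%:E <= \int[mu]_x (wt x)%:E)%E.
Proof.
move=> mA; apply: ge0_subset_integral => //.
- exact: measurable_EFin_wt.
- by move=> x _; rewrite lee_fin wt_ge0.
Qed.

Lemma integral_mresE mu A (h : T -> R) : measurable A -> measurable_fun [set: T] h ->
  (forall x, 0 <= h x) ->
  (\int[mres mu A]_x (h x)%:E = \int[mu]_x ((\1_A x : R) * h x)%:E)%E.
Proof.
move=> mA mh h0; rewrite integral_mres//; last exact/measurable_EFinP.
rewrite integral_mkcond; apply: eq_integral => x _.
by rewrite patchE indicE; case: ifPn; rewrite ?mul1r ?mul0r.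
Qed.

Lemma good_mres mu A : measurable A -> good mu -> good (mres mu A).
Proof.
move=> mA [fin nul]; split.
  rewrite integral_mres//; last 2 first.
  - exact: measurable_EFin_wt.
  - by move=> x; rewrite lee_fin wt_ge0.
  exact: le_lt_trans (integral_subset_wt _ mA) fin.
move=> c c0; rewrite mresE//; apply/eqP; rewrite eq_le measure_ge0 andbT.
rewrite -(nul c c0); apply: le_measure; rewrite ?inE//.
- by apply: measurableI => //; exact: measurable_aff_eq0.
- exact: measurable_aff_eq0.
Qed.

(** The cell is exchanged first, under [mu], at a cost bounded by the weighted mass of [D]; then the
    measure, on the common cell [A']. Hence only [mu] has to be small on [D]. *)
Lemma wclose_mres mu nu e1 e2 A A' D : measurable A -> measurable A' -> measurable D ->
  (forall x, ~ D x -> (A x <-> A' x)) -> wclose mu nu e1 ->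
  (\int[mu]_(x in D) (wt x)%:E <= e2%:E)%E ->
  wclose (mres mu A) (mres nu A') (e1 + e2).
Proof.
move=> mA mA' mD AA' cl De h mh hw.
have h0 x : 0 <= h x by case/andP: (hw x).
have hle x : h x <= wt x by case/andP: (hw x).
have mi B : measurable B -> measurable_fun [set: T] (fun x => (\1_B x : R) * h x).
  by move=> mB; apply: measurable_funM.
have i0 B x : 0 <= (\1_B x : R) * h x by rewrite mulr_ge0.
have ile B x : 0 <= (\1_B x : R) * h x <= wt x.
  rewrite i0 /= indicE; case: (_ \in _); rewrite ?mul1r ?mul0r//.
  exact: wt_ge0.
have key B B' : measurable B -> measurable B' -> (forall x, ~ D x -> B x -> B' x) ->
    (\int[mu]_x ((\1_B x : R) * h x)%:E <= \int[mu]_x ((\1_B' x : R) * h x)%:E + e2%:E)%E.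
  move=> mB mB' BB'.
  apply: (@le_trans _ _ (\int[mu]_x ((\1_B' x : R) * h x)%:E + \int[mu]_(x in D) (wt x)%:E)%E); last exact: leeD2l.
  rewrite [X in (_ <= _ + X)%E]integral_mkcond.
  rewrite (eq_integral (fun x => ((\1_D x : R) * wt x)%:E)) => [|x _]; last first.
    by rewrite patchE indicE; case: ifPn; rewrite ?mul1r ?mul0r.
  have mDw : measurable_fun [set: T] (fun x => ((\1_D x : R) * wt x)%:E).
    by apply/measurable_EFinP; apply: measurable_funM => //; exact: measurable_wt.
  rewrite -ge0_integralD//; last 3 first.
  - by move=> x _; rewrite lee_fin.
  - by apply/measurable_EFinP; exact: mi.
  - by move=> x _; rewrite lee_fin mulr_ge0 ?wt_ge0.
  apply: ge0_le_integral => //.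
  - by move=> x _; rewrite lee_fin.
  - by apply/measurable_EFinP; exact: mi.
  - apply: emeasurable_funD => //; by apply/measurable_EFinP; exact: mi.
  - move=> x _; rewrite -EFinD lee_fin !indicE.
    have [xD|xD] := boolP (x \in D).
      rewrite mul1r; case: (x \in B); rewrite ?mul1r ?mul0r.
        by case: (x \in B'); rewrite ?mul1r ?mul0r ?add0r// lerDl wt_ge0.
      by rewrite addr_ge0 ?wt_ge0// mulr_ge0.
    rewrite mul0r addr0; have [xB|_] := boolP (x \in B); last by rewrite mul0r mulr_ge0.
    rewrite mem_set//; apply: BB'; first by move=> Dx; move: xD; rewrite mem_set.
    by rewrite inE in xB.
have [H1 H2] := cl _ (mi _ mA') (ile A').
rewrite !integral_mresE//; split.
- apply: (le_trans (key A A' mA mA' _)); first by move=> x /AA' [].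
  by rewrite EFinD addeA leeD2r.
- apply: (le_trans H2); rewrite EFinD addeA [leRHS]addeAC leeD2r//.
  by apply: key => // x /AA' [].
Qed.

End Weighted.

(** * Slabs around hyperplanes and compactness of quantizers relative to a measure *)

Section SmallDiscrepancy.
Variables (R : realType) (d : nat).
Local Notation T := (d.-tuple R).
Implicit Types (mu nu : {measure set T -> \bar R}).

Definition slab (c : nat -> R) (eta : R) : set T :=
  [set y | `|aff c y| <= eta * l1wt y].

Lemma measurable_l1wt : measurable_fun [set: T] (@l1wt R d).
Proof.
apply: measurable_funD => //; apply: measurable_sum => k.
by apply: measurableT_comp => //; exact: measurable_tnth.
Qed.

Lemma measurable_slab c eta : measurable (slab c eta).
Proof.
have m1 : measurable_fun [set: T] (fun y => `|aff c y|).
  by apply: measurableT_comp => //; exact: measurable_aff.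
have m2 : measurable_fun [set: T] (fun y => eta * l1wt y).
  by apply: measurable_funM => //; exact: measurable_l1wt.
have := measurable_fun_ler m1 m2.
move=> /(_ measurableT [set true] I).
by rewrite setTI; congr measurable; apply/seteqP; split=> x /=.
Qed.

(* The slabs decrease to the null hyperplane [aff c y = 0]. *)
Lemma slab_small mu c : good mu -> (exists2 k, (k < d.+1)%N & c k != 0) ->
  forall e : R, 0 < e -> \forall n \near \oo,
    (\int[mu]_(x in slab c n.+1%:R^-1) (wt x)%:E <= e%:E)%E.
Proof.
move=> [fin nul] c0 e e0.
pose H := [set x : T | aff c x = 0].
have mH : measurable H by exact: measurable_aff_eq0.
pose f_ n x : \bar R := ((\1_(slab c n.+1%:R^-1) x : R) * wt x)%:E.
pose f0 x : \bar R := ((\1_H x : R) * wt x)%:E.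
have mf_ n : measurable_fun setT (f_ n).
  apply/measurable_EFinP; apply: measurable_funM; last exact: measurable_wt.
  by apply: measurable_indic; exact: measurable_slab.
have mf0 : measurable_fun setT f0.
  apply/measurable_EFinP; apply: measurable_funM; last exact: measurable_wt.
  exact: measurable_indic.
have intE A : (\int[mu]_(x in A) (wt x)%:E = \int[mu]_x ((\1_A x : R) * wt x)%:E)%E.
  rewrite integral_mkcond; apply: eq_integral => x _.
  by rewrite patchE indicE; case: ifPn; rewrite ?mul1r ?mul0r.
have [|||_ _] := @dominated_convergence _ _ _ mu setT measurableT f_ f0
    (fun x => (wt x)%:E) mf_ mf0.
- apply: aeW => x _; have [ax|ax] := eqVneq (aff c x) 0.
    rewrite (_ : (fun n => f_ n x) = cst (f0 x)); first exact: cvg_cst.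
    apply/funext => n; rewrite /f_ /f0 /= !indicE !mem_set//=.
    by rewrite /slab /= ax normr0 mulr_ge0// ltW// l1wt_gt0.
  apply: (@cvg_near_cst _ _ _ _ _ _) => /=.
  have e1 : 0 < `|aff c x| / l1wt x by rewrite divr_gt0 ?l1wt_gt0// normr_gt0.
  have := @near_infty_natSinv_lt R (PosNum e1); apply: filterS => n /= nx.
  rewrite /f_ /f0 !indicE !memNset//=; first exact/eqP.
  by apply/negP; rewrite -ltNge -ltr_pdivlMr ?l1wt_gt0.
- apply/integrableP; split; first exact: measurable_EFin_wt.
  under eq_integral do rewrite gee0_abs ?lee_fin ?wt_ge0//.
  exact: fin.
- apply: aeW => x n _; rewrite /f_ gee0_abs ?lee_fin ?mulr_ge0 ?wt_ge0//.
  rewrite indicE; case: (_ \in _); rewrite ?mul1r// mul0r; exact: wt_ge0.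
have -> : (\int[mu]_x f0 x = 0)%E.
  rewrite /f0 -intE; apply: null_set_integral => //.
    by apply: (measurable_funS measurableT) => //; exact: measurable_EFin_wt.
  exact: nul.
move=> /fine_cvgP[finn /cvgrPdist_le/(_ e e0)].
move=> H2; near=> n.
have fn : (\int[mu]_x f_ n x)%E \is a fin_num by near: n.
have : `|0 - fine (\int[mu]_x f_ n x)%E| <= e by near: n.
rewrite sub0r normrN intE -/(f_ n) => H3.
rewrite -(fineK fn) lee_fin; exact: le_trans (ler_norm _) H3.
Unshelve. all: by end_near. Qed.

End SmallDiscrepancy.

Section NeqSet.
Variables (R : realType) (d M : nat).

Definition neq_set (Q Q' : d.-tuple R -> 'I_M) : set (d.-tuple R) :=
  [set x | Q x <> Q' x].

Lemma measurable_neq_set Q Q' : Q_c d M Q -> Q_c d M Q' -> measurable (neq_set Q Q').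
Proof.
move=> qQ qQ'.
have -> : neq_set Q Q' = ~` (\bigcup_(i in [set: 'I_M]) (qcell Q i `&` qcell Q' i)).
  apply/seteqP; split=> x /=.
    by move=> H [i _ [/= Q1 Q2]]; apply: H; rewrite Q1 Q2.
  by move=> H E; apply: H; exists (Q x).
apply: measurableC; apply: fin_bigcup_measurable; first exact: finite_finset.
by move=> i _; apply: measurableI; [exact: (qQ i).1|exact: (qQ' i).1].
Qed.

Lemma const_quantizer : (0 < M)%N -> exists Q : d.-tuple R -> 'I_M, Q_c d M Q.
Proof.
move=> M_gt0; exists (fun=> Ordinal M_gt0) => i; split.
  rewrite /qcell preimage_cst; case: ifPn => _; [exact: measurableT|exact: measurable0].
by move=> x y l.
Qed.

End NeqSet.

(** Disagreement with the cluster quantizer is confined to slabs around the limit hyperplanes, whose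
    weighted mass is small for a good [mu]. The same [Q] serves all [e] and [N]. *)
Lemma quantizer_cluster_mu (R : realType) (d M : nat)
    (mu : {measure set (d.+1.-tuple R) -> \bar R})
    (Qs : nat -> d.+1.-tuple R -> 'I_M) : good mu -> (forall n, Q_c d.+1 M (Qs n)) ->
  exists2 Q, Q_c d.+1 M Q & forall (e : R) N, 0 < e ->
    exists2 n, (N <= n)%N &
      (\int[mu]_(x in neq_set (Qs n) Q) (wt x)%:E <= e%:E)%E.
Proof.
move=> gmu Qc; have [c [Q [Qcc nz H]]] := quantizer_cluster Qc.
exists Q => // e N e0.
(* One share [e / K] for each ordered pair of cells; the [+ 1] keeps [K] positive. *)
pose K : R := (M * M)%:R + 1.
have K0 : 0 < K by rewrite ltr_wpDl.
have eK0 : 0 < e / K by rewrite divr_gt0.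
have : \forall m \near \oo, forall p : 'I_M * 'I_M, p.1 != p.2 ->
    (\int[mu]_(x in slab (c p.1 p.2) m.+1%:R^-1) (wt x)%:E <= (e / K)%:E)%E.
  apply: filter_forall => -[i j] /=; have [->|ij] := eqVneq i j.
    exact: filterE.
  by apply: filterS (slab_small gmu (nz _ _ ij) eK0) => m + _.
move=> /filter_ex[m mP].
have [|n Nn nP] := H m.+1%:R^-1 N; first by rewrite invr_gt0.
exists n => //.
have mneq : measurable (neq_set (Qs n) Q) by exact: measurable_neq_set.
pose g (p : 'I_M * 'I_M) (x : d.+1.-tuple R) : \bar R := if p.1 != p.2 then
   ((\1_(slab (c p.1 p.2) m.+1%:R^-1) x : R) * wt x)%:E else 0%E.
have g0 p x : (0 <= g p x)%E.
  by rewrite /g; case: ifP => // _; rewrite lee_fin mulr_ge0// wt_ge0.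
have mg p : measurable_fun setT (g p).
  rewrite /g; case: (p.1 != p.2); last exact: measurable_cst.
  apply/measurable_EFinP.
  apply: measurable_funM; last exact: measurable_wt.
  by apply: measurable_indic; exact: measurable_slab.
have intE A : (\int[mu]_(x in A) (wt x)%:E = \int[mu]_x ((\1_A x : R) * wt x)%:E)%E.
  rewrite integral_mkcond; apply: eq_integral => x _.
  by rewrite patchE indicE; case: ifPn; rewrite ?mul1r ?mul0r.
apply: (@le_trans _ _ (\int[mu]_x \sum_(p : 'I_M * 'I_M) g p x)%E).
  rewrite intE; apply: ge0_le_integral => //.
  - by move=> x _; rewrite lee_fin mulr_ge0// wt_ge0.
  - apply/measurable_EFinP; apply: measurable_funM; last exact: measurable_wt.
    exact: measurable_indic.
  - exact: emeasurable_sum.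
  - move=> x _; rewrite indicE; have [xD|_] := boolP (x \in neq_set (Qs n) Q); last first.
      by rewrite mul0r sume_ge0.
    have [p pn xp] : exists2 p : 'I_M * 'I_M, p.1 != p.2 &
        slab (c p.1 p.2) m.+1%:R^-1 x.
      apply: contrapT => nop; move: xD; rewrite inE; apply; apply: nP => i j ij.
      by rewrite ltNge; apply/negP => H1; apply: nop; exists (i, j).
    rewrite (bigD1 p)//= {1}/g pn indicE mem_set// mul1r.
    by rewrite leeDl// sume_ge0.
rewrite ge0_integral_sum//.
apply: (@le_trans _ _ (\sum_(p : 'I_M * 'I_M) (e / K)%:E)%E).
  apply: lee_sum => p _; have := mP p; rewrite /g; case: (p.1 != p.2) => [/(_ isT)|_].
    by rewrite -intE.
  by rewrite integral0 lee_fin ltW.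
rewrite sumEFin lee_fin sumr_const card_prod card_ord -mulr_natl.
by rewrite mulrCA ler_piMr ?(ltW e0)// ler_pdivrMr// mul1r /K lerDl.
Qed.

(** * Optimal partitions *)

Section DynamicProgramming.
Variables (R : realType) (d M : nat).
Local Notation T := (d.+1.-tuple R).
Implicit Types (mu nu : {measure set T -> \bar R}) (Q : T -> 'I_M).

Variable G : {measure set T -> \bar R} -> \bar R.
Hypothesis G_ge0 : forall mu, good mu -> (0 <= G mu)%E.
Hypothesis G_fin : forall mu, good mu -> (G mu < +oo)%E.
Hypothesis G_cont : wcontinuous G.

(** [G] stands for the value of a single cell, later [stage_value]; being nonnegative, finite and
    continuous on good measures is all that the induction has to supply. *)
Definition part_sum mu Q : \bar R := (\sum_(i < M) G (mres mu (qcell Q i)))%E.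

Definition part_inf mu : \bar R := ereal_inf [set part_sum mu Q | Q in Q_c d.+1 M].

Lemma part_sum_ge0 mu Q : good mu -> Q_c d.+1 M Q -> (0 <= part_sum mu Q)%E.
Proof.
by move=> gmu qQ; apply: sume_ge0 => i _; apply/G_ge0/good_mres => //; exact: (qQ i).1.
Qed.

Lemma part_sum_fin mu Q : good mu -> Q_c d.+1 M Q -> (part_sum mu Q < +oo)%E.
Proof.
by move=> gmu qQ; apply: lte_sum_pinfty => i _; apply/G_fin/good_mres => //; exact: (qQ i).1.
Qed.

(** Joint continuity in measure and quantizer at [(mu, Q)]; the distance between quantizers is
    measured by [mu] alone. *)
Lemma part_sum_stable mu Q (e : R) : good mu -> Q_c d.+1 M Q -> 0 < e ->
  exists2 del : R, 0 < del & forall nu Q', good nu -> Q_c d.+1 M Q' ->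
    wclose mu nu del -> (\int[mu]_(x in neq_set Q' Q) (wt x)%:E <= del%:E)%E ->
    (part_sum mu Q <= part_sum nu Q' + e%:E)%E /\
    (part_sum nu Q' <= part_sum mu Q + e%:E)%E.
Proof.
move=> gmu qQ e0; pose K : R := M%:R + 1.
have K0 : 0 < K by rewrite ltr_wpDl.
have eK0 : 0 < e / K by rewrite divr_gt0.
have near_all : \forall del \near (0 : R)^'+, forall i : 'I_M,
    forall nu, good nu -> wclose (mres mu (qcell Q i)) nu del ->
      (G (mres mu (qcell Q i)) <= G nu + (e / K)%:E)%E /\
      (G nu <= G (mres mu (qcell Q i)) + (e / K)%:E)%E.
  apply: filter_forall => i; apply: G_cont => //.
  by apply: good_mres => //; exact: (qQ i).1.
have [del [del0 delP]] : exists del : R, 0 < del /\ forall i : 'I_M,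
    forall nu, good nu -> wclose (mres mu (qcell Q i)) nu del ->
      (G (mres mu (qcell Q i)) <= G nu + (e / K)%:E)%E /\
      (G nu <= G (mres mu (qcell Q i)) + (e / K)%:E)%E.
  near (0 : R)^'+ => del; exists del; split; near: del; last exact: near_all.
  exact: nbhs_right_gt.
have sumK : (\sum_(i < M) (e / K)%:E <= e%:E)%E.
  rewrite sumEFin lee_fin sumr_const card_ord -mulr_natl.
  by rewrite mulrCA ler_piMr ?(ltW e0)// ler_pdivrMr// mul1r /K lerDl.
(* One half for the measures and one for the quantizers: [wclose_mres] adds the two errors. *)
exists (del / 2); first by rewrite divr_gt0.
move=> nu Q' gnu qQ' cl De.
have cell_close i : wclose (mres mu (qcell Q i)) (mres nu (qcell Q' i)) del.
  rewrite (splitr del); apply: (@wclose_mres _ _ mu nu _ _ _ _ (neq_set Q' Q)) => //.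
  - exact: (qQ i).1.
  - exact: (qQ' i).1.
  - exact: measurable_neq_set.
  - by move=> x /contrapT; rewrite /qcell /= => ->.
have gi i : good (mres nu (qcell Q' i)) by apply: good_mres => //; exact: (qQ' i).1.
split.
- apply: (@le_trans _ _ (\sum_(i < M) (G (mres nu (qcell Q' i)) + (e / K)%:E))%E).
    by apply: lee_sum => i _; exact: (delP i _ (gi i) (cell_close i)).1.
  by rewrite big_split /= leeD2l.
- apply: (@le_trans _ _ (\sum_(i < M) (G (mres mu (qcell Q i)) + (e / K)%:E))%E).
    by apply: lee_sum => i _; exact: (delP i _ (gi i) (cell_close i)).2.
  by rewrite big_split /= leeD2l.
Unshelve. all: by end_near. Qed.

Lemma part_inf_ge0 mu : good mu -> (0 <= part_inf mu)%E.
Proof.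
by move=> gmu; apply: le_ereal_inf_tmp => _ [Q qQ <-]; exact: part_sum_ge0.
Qed.

Hypothesis M_gt0 : (0 < M)%N.

Lemma part_inf_fin mu : good mu -> (part_inf mu < +oo)%E.
Proof.
move=> gmu; have [Q qQ] := const_quantizer R d.+1 M_gt0.
apply: le_lt_trans (part_sum_fin gmu qQ).
by apply: ereal_inf_lbound; exists Q.
Qed.

Lemma part_inf_fin_num mu : good mu -> part_inf mu \is a fin_num.
Proof. by move=> gmu; rewrite ge0_fin_numE ?part_inf_fin// part_inf_ge0. Qed.

Lemma part_inf_approx mu (e : R) : good mu -> 0 < e ->
  exists2 Q, Q_c d.+1 M Q & (part_sum mu Q < part_inf mu + e%:E)%E.
Proof.
move=> gmu e0; have [_ [Q qQ <-] H] := lb_ereal_inf_adherent e0 (part_inf_fin_num gmu).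
by exists Q.
Qed.

(** A minimizing sequence has a cluster quantizer, to which stability transfers the infimum. *)
Lemma part_inf_attained mu : good mu ->
  exists2 Q, Q_c d.+1 M Q & part_inf mu = part_sum mu Q.
Proof.
move=> gmu.
have ex n : exists Q, Q_c d.+1 M Q /\ (part_sum mu Q < part_inf mu + (n.+1%:R^-1)%:E)%E.
  have [|Q qQ H] := @part_inf_approx mu n.+1%:R^-1 gmu; first by rewrite invr_gt0.
  by exists Q.
have [Qs QsP] := choice ex.
have [Q qQ clu] := quantizer_cluster_mu gmu (fun n => (QsP n).1).
exists Q => //; apply/eqP; rewrite eq_le; apply/andP; split.
  by apply: ereal_inf_lbound; exists Q.
apply/lee_addgt0Pr => e e0.
have e20 : 0 < e / 2 by rewrite divr_gt0.
have [del del0 delP] := part_sum_stable gmu qQ e20.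
have [N _ NP] := @near_infty_natSinv_lt R (PosNum e20).
have [n Nn nP] := clu del N del0.
have [|H _] := delP mu (Qs n) gmu (QsP n).1 _ nP; first exact/wclose_refl/ltW.
apply: (le_trans H); rewrite [in leRHS](splitr e) EFinD addeA leeD2r//.
apply/ltW/(lt_le_trans (QsP n).2); rewrite leeD2l// lee_fin.
exact/ltW/(NP n Nn).
Qed.

(** For the upper bound on [part_inf nu], a minimizer of [mu] is fixed. The lower bound needs
    compactness, because the minimizer varies with [nu]. *)
Lemma part_inf_continuous : wcontinuous part_inf.
Proof.
move=> mu gmu e e0.
apply: near_right0.
  move=> a b a0 ab H nu gnu cl; apply: H => //; exact: wclose_le cl.
suff [del1 d10 H1] : exists2 del : R, 0 < del & forall nu, good nu ->
    wclose mu nu del -> (part_inf mu <= part_inf nu + e%:E)%E.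
  have [Q qQ infE] := part_inf_attained gmu.
  have [del2 d20 H2] := part_sum_stable gmu qQ e0.
  exists (Num.min del1 del2); first by rewrite lt_min d10.
  move=> nu gnu cl; split; first by apply: H1 => //; apply: wclose_le cl; rewrite ge_min lexx.
  have [||_ H] := H2 nu Q gnu qQ.
  - by apply: wclose_le cl; rewrite ge_min lexx orbT.
  - rewrite (_ : neq_set Q Q = set0) ?integral_set0 ?lee_fin ?ltW//.
    by apply/seteqP; split=> x.
  rewrite infE; apply: le_trans H.
  by apply: ereal_inf_lbound; exists Q.
(* Otherwise measures approaching [mu] have minimizers that beat [part_inf mu] by more than [e]. A
   cluster quantizer of these, taken relative to the fixed [mu], contradicts stability. *)
apply: contrapT => nodel.
have ex n : exists p : {measure set T -> \bar R} * (T -> 'I_M),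
    good p.1 /\ wclose mu p.1 n.+1%:R^-1 /\ Q_c d.+1 M p.2 /\
    (part_sum p.1 p.2 + e%:E < part_inf mu)%E.
  apply: contrapT => nop; apply: nodel; exists n.+1%:R^-1; first by rewrite invr_gt0.
  move=> nu gnu cl; rewrite leNgt; apply/negP => lt.
  have [Q qQ infE] := part_inf_attained gnu.
  by apply: nop; exists (nu, Q); rewrite /= -infE.
have [p pP] := choice ex.
have [Q qQ clu] := quantizer_cluster_mu gmu (fun n => (pP n).2.2.1).
have [del del0 delP] := part_sum_stable gmu qQ e0.
have [N _ NP] := @near_infty_natSinv_lt R (PosNum del0).
have [n Nn nP] := clu del N del0.
have [gn [cln [qn ltn]]] := pP n.
have [|H _] := delP (p n).1 (p n).2 gn qn _ nP.
  by apply: wclose_le cln; exact/ltW/(NP n Nn).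
have inf_le : (part_inf mu <= part_sum mu Q)%E by apply: ereal_inf_lbound; exists Q.
by have := lt_le_trans ltn (le_trans inf_le H); rewrite ltxx.
Qed.

End DynamicProgramming.

(** * The cost-to-go *)

Section QuadCost.
Variables (R : realType) (d : nat).
Local Notation T := (d.-tuple R).
Implicit Types (mu nu : {measure set T -> \bar R}) (x u : T).

Definition quad_cost mu : \bar R :=
  ereal_inf [set (\int[mu]_x (eucl_sqdist x u)%:E)%E | u in [set: T]].

Lemma measurable_EFin_sqdist u : measurable_fun [set: T] (fun x => (eucl_sqdist x u)%:E).
Proof. by apply/measurable_EFinP; exact: measurable_sqdist. Qed.

Lemma quad_cost_ge0 mu : (0 <= quad_cost mu)%E.
Proof.
apply: le_ereal_inf_tmp => _ [u _ <-]; apply: integral_ge0 => x _.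
by rewrite lee_fin eucl_sqdist_ge0.
Qed.

Lemma quad_cost_le mu u : (quad_cost mu <= \int[mu]_x (eucl_sqdist x u)%:E)%E.
Proof. by apply: ereal_inf_lbound; exists u. Qed.

Lemma sqdist_int_fin mu u : good mu -> (\int[mu]_x (eucl_sqdist x u)%:E < +oo)%E.
Proof.
move=> [fin _].
have c0 : 0 <= 2 * (1 + eucl_sqnorm u) by rewrite mulr_ge0// addr_ge0// eucl_sqnorm_ge0.
apply: (@le_lt_trans _ _ ((2 * (1 + eucl_sqnorm u))%:E * \int[mu]_x (wt x)%:E)%E).
  rewrite -ge0_integralZl_EFin//; last 2 first.
  - by move=> x _; rewrite lee_fin wt_ge0.
  - exact: measurable_EFin_wt.
  apply: ge0_le_integral => //.
  - by move=> x _; rewrite lee_fin eucl_sqdist_ge0.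
  - exact: measurable_EFin_sqdist.
  - by apply: emeasurable_funM => //; exact: measurable_EFin_wt.
  - by move=> x _; rewrite -EFinM lee_fin sqdist_le.
by rewrite lte_mul_pinfty.
Qed.

Lemma quad_cost_fin mu : good mu -> (quad_cost mu < +oo)%E.
Proof.
move=> gmu; apply: le_lt_trans (sqdist_int_fin [tuple 0 | i < d] gmu).
exact: quad_cost_le.
Qed.

(** Weighted closeness controls the cost uniformly only for bounded [u]. An almost optimal [u0] for
    [mu] gives the upper bound on [quad_cost nu]; for the lower one, far points [u] are excluded
    because the mass makes them expensive. *)
Lemma quad_cost_continuous : wcontinuous quad_cost.
Proof.
move=> mu gmu e e0.
have cfin : quad_cost mu \is a fin_num.
  by rewrite ge0_fin_numE ?quad_cost_ge0// quad_cost_fin.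
have sq0 u : 0 <= eucl_sqnorm u by exact: eucl_sqnorm_ge0.
have transfer mu' nu' u del : wclose mu' nu' del ->
    (\int[mu']_x (eucl_sqdist x u)%:E <= \int[nu']_x (eucl_sqdist x u)%:E
      + (2 * (1 + eucl_sqnorm u) * del)%:E)%E.
  move=> cl; apply: (wclose_scale cl).
  - by rewrite mulr_gt0// ltr_wpDr.
  - exact: measurable_sqdist.
  - by move=> x; rewrite eucl_sqdist_ge0 sqdist_le.
have e20 : 0 < e / 2 by rewrite divr_gt0.
have [_ [u0 _ <-] u0P] := lb_ereal_inf_adherent e20 cfin.
have c0 : 0 < 2 * (1 + eucl_sqnorm u0) by rewrite mulr_gt0// ltr_wpDr.
have near1 : \forall del \near (0 : R)^'+,
    forall nu, good nu -> wclose mu nu del -> (quad_cost nu <= quad_cost mu + e%:E)%E.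
  near=> del => nu gnu cl.
  apply: (le_trans (quad_cost_le nu u0)).
  apply: (le_trans (transfer _ _ u0 _ (wclose_sym cl))).
  rewrite [in leRHS](splitr e) EFinD addeA leeD//; first exact/ltW/u0P.
  rewrite lee_fin mulrC -ler_pdivlMr//.
  by near: del; apply: nbhs_right_le; rewrite divr_gt0.
have near2 : \forall del \near (0 : R)^'+,
    forall nu, good nu -> wclose mu nu del -> (quad_cost mu <= quad_cost nu + e%:E)%E.
  (* The null measure has cost 0; excluding far points below requires positive mass. *)
  have [mu0|mu0] := eqVneq (mu setT) 0%E.
    apply: filterE => del nu _ _.
    apply: (@le_trans _ _ 0%E); last by rewrite adde_ge0 ?quad_cost_ge0// lee_fin ltW.
    apply: (le_trans (quad_cost_le mu u0)).
    rewrite null_set_integral//.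
    by apply: (measurable_funS measurableT) => //; exact: measurable_EFin_sqdist.
  have afin : mu setT \is a fin_num by rewrite ge0_fin_numE// good_fin.
  pose a := fine (mu setT); have aE : mu setT = a%:E by rewrite fineK.
  have a0 : 0 < a by rewrite -lte_fin -aE lt0e mu0 measure_ge0.
  pose z : T := [tuple 0 | i < d].
  have sqz x : eucl_sqdist x z = eucl_sqnorm x.
    by apply: eq_bigr => i _; rewrite tnth_mktuple subr0.
  have sz : eucl_sqnorm z = 0.
    by rewrite /eucl_sqnorm big1// => i _; rewrite tnth_mktuple expr0n.
  have sfin : (\int[mu]_x (eucl_sqdist x z)%:E)%E \is a fin_num.
    rewrite ge0_fin_numE ?sqdist_int_fin// integral_ge0// => x _.
    by rewrite lee_fin eucl_sqdist_ge0.
  pose s := fine (\int[mu]_x (eucl_sqdist x z)%:E)%E.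
  have sE : (\int[mu]_x (eucl_sqdist x z)%:E = s%:E)%E by rewrite fineK.
  have s0 : 0 <= s.
    by apply: fine_ge0; apply: integral_ge0 => x _; rewrite lee_fin eucl_sqdist_ge0.
  (* For close [nu] the mass is at least [a / 2] and the second moment at most [s + 1]. With this
     [B], a point with [||u||^2 > B] then costs at least [s] under [nu], and [s] is the cost of the
     origin under [mu]. *)
  pose B := 4 * (2 * s + 1) / a.
  have B0 : 0 <= B by rewrite divr_ge0 ?(ltW a0)// mulr_ge0// addr_ge0// mulr_ge0.
  have B10 : 0 < 2 * (1 + B) by rewrite mulr_gt0// ltr_wpDr.
  near=> del => nu gnu cl.
  have del1 : 2 * del <= 1.
    by rewrite mulrC -ler_pdivlMr//; near: del; apply: nbhs_right_le; rewrite divr_gt0.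
  have dela : 2 * del <= a.
    by rewrite mulrC -ler_pdivlMr//; near: del; apply: nbhs_right_le; rewrite divr_gt0.
  have dele : 2 * (1 + B) * del <= e.
    by rewrite mulrC -ler_pdivlMr//; near: del; apply: nbhs_right_le; rewrite divr_gt0.
  have del0 : 0 < del by near: del; exact: nbhs_right_gt.
  rewrite -leeBlDr//; apply: le_ereal_inf_tmp => _ [u _ <-]; rewrite leeBlDr//.
  have [uB|uB] := leP (eucl_sqnorm u) B.
    apply: (le_trans (quad_cost_le mu u)); apply: (le_trans (transfer _ _ u _ cl)).
    rewrite leeD2l// lee_fin; apply: le_trans dele.
    by rewrite ler_pM2r// ler_pM2l// lerD2l.
  apply: (le_trans (quad_cost_le mu z)); rewrite sE.
  pose F := fine (\int[nu]_x (eucl_sqdist x u)%:E)%E.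
  have FE : (\int[nu]_x (eucl_sqdist x u)%:E = F%:E)%E.
    rewrite fineK// ge0_fin_numE ?sqdist_int_fin// integral_ge0// => x _.
    by rewrite lee_fin eucl_sqdist_ge0.
  pose s' := fine (\int[nu]_x (eucl_sqdist x z)%:E)%E.
  have s'E : (\int[nu]_x (eucl_sqdist x z)%:E = s'%:E)%E.
    rewrite fineK// ge0_fin_numE ?sqdist_int_fin// integral_ge0// => x _.
    by rewrite lee_fin eucl_sqdist_ge0.
  pose a' := fine (nu setT).
  have a'E : nu setT = a'%:E by rewrite fineK// ge0_fin_numE// good_fin.
  have ss' : s' <= s + 2 * del.
    have := transfer _ _ z _ (wclose_sym cl).
    by rewrite sz addr0 mulr1 s'E sE -EFinD lee_fin.
  have aa' : a <= a' + del.
    have [||+ _] := cl (fun=> 1); first by [].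
      by move=> x; rewrite ler01 wt_ge1.
    by rewrite !integral_cst// !mul1e aE a'E -EFinD lee_fin.
  have : eucl_sqnorm u * a' <= 2 * F + 2 * s'.
    rewrite -lee_fin EFinD !EFinM -a'E -FE -s'E -integral_cst//.
    have msd v : measurable_fun [set: T] (fun x => (eucl_sqdist x v)%:E).
      exact: measurable_EFin_sqdist.
    have sd0 v x : (0 <= (eucl_sqdist x v)%:E)%E by rewrite lee_fin eucl_sqdist_ge0.
    rewrite -!ge0_integralZl_EFin// -ge0_integralD//.
    - apply: ge0_le_integral => //.
      + by move=> x _; rewrite lee_fin.
      + by apply: emeasurable_funD; apply: emeasurable_funM.
      + move=> x _; rewrite -!EFinM -EFinD lee_fin sqz.
        exact: sqnorm_le_sqdist.
    - by move=> x _; rewrite mule_ge0// lee_fin.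
    - by apply: emeasurable_funM.
    - by move=> x _; rewrite mule_ge0// lee_fin.
    - by apply: emeasurable_funM.
  rewrite FE -EFinD lee_fin => H.
  have : B * (a / 2) <= eucl_sqnorm u * a' by apply: ler_pM => //; [lra|exact: ltW|lra].
  rewrite /B (_ : _ * (a / 2) = 2 * (2 * s + 1)); last by field; rewrite gt_eqF.
  lra.
near=> del => nu gnu cl; split.
- by apply: (near near2 del) => //; near: del.
- by apply: (near near1 del) => //; near: del.
Unshelve. all: by end_near. Qed.

End QuadCost.

Section KernelClose.
Variables (R : realType) (d : nat).
Local Notation T := (d.-tuple R).
Variables (f : T -> T -> T) (nu_w : probability T R).
Hypothesis f_meas : measurable_fun [set: T * T] (fun p : T * T => f p.1 p.2).
Variable K : R.
Hypothesis K_gt0 : 0 < K.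
Hypothesis f_growth : forall x w, eucl_norm (f x w) <= K * (eucl_norm x + eucl_norm w).
Hypothesis nu_mom : (\int[nu_w]_z (eucl_sqnorm z)%:E < +oo)%E.

(** With [m] the second moment of the noise, the mean of [wt (f x w)] is at most
    [1 + 2 K^2 (||x||^2 + m)], which this constant times [wt x] dominates. *)
Definition growth_const : R :=
  1 + 2 * K ^+ 2 * (1 + fine (\int[nu_w]_z (eucl_sqnorm z)%:E)%E).

Lemma fine_nu_mom_ge0 : 0 <= fine (\int[nu_w]_z (eucl_sqnorm z)%:E)%E.
Proof.
by apply: fine_ge0; apply: integral_ge0 => x _; rewrite lee_fin eucl_sqnorm_ge0.
Qed.

Lemma growth_const_gt0 : 0 < growth_const.
Proof.
rewrite /growth_const ltr_pwDl// mulr_ge0// ?addr_ge0 ?fine_nu_mom_ge0//.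
by rewrite mulr_ge0// sqr_ge0.
Qed.

Lemma sqnorm_growth x w :
  eucl_sqnorm (f x w) <= 2 * K ^+ 2 * (eucl_sqnorm x + eucl_sqnorm w).
Proof.
have nE y : eucl_sqnorm y = eucl_norm (y : T) ^+ 2.
  by rewrite /eucl_norm sqr_sqrtr// eucl_sqnorm_ge0.
have n0 y : 0 <= eucl_norm (y : T) by exact: sqrtr_ge0.
rewrite !nE; apply: (@le_trans _ _ ((K * (eucl_norm x + eucl_norm w)) ^+ 2)).
  by rewrite ler_pXn2r ?nnegrE// mulr_ge0 ?(ltW K_gt0)// addr_ge0.
rewrite exprMn (_ : 2 * K ^+ 2 * _ = K ^+ 2 * (2 * (eucl_norm x ^+ 2 + eucl_norm w ^+ 2))); last by ring.
rewrite ler_wpM2l ?sqr_ge0//.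
by have := sqr_ge0 (eucl_norm x - eucl_norm w); nra.
Qed.

Lemma kernel_wt x : (\int[nu_w]_w (wt (f x w))%:E <= (growth_const * wt x)%:E)%E.
Proof.
have k0 : 0 <= 2 * K ^+ 2 by rewrite mulr_ge0// sqr_ge0.
have s0 (y : T) : 0 <= eucl_sqnorm y by exact: eucl_sqnorm_ge0.
have ms : measurable_fun [set: T] (fun w : T => (eucl_sqnorm w)%:E).
  by apply/measurable_EFinP; exact: measurable_sqnorm.
have b0 : 0 <= 1 + 2 * K ^+ 2 * eucl_sqnorm x by rewrite addr_ge0// mulr_ge0.
apply: (@le_trans _ _ (\int[nu_w]_w ((1 + 2 * K ^+ 2 * eucl_sqnorm x)%:E +
    (2 * K ^+ 2)%:E * (eucl_sqnorm w)%:E))%E).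
  apply: ge0_le_integral => //.
  - by move=> w _; rewrite lee_fin wt_ge0.
  - exact: (measurableT_comp (@measurable_EFin_wt R d) (measurable_f2 f_meas x)).
  - by apply: emeasurable_funD => //; apply: emeasurable_funM.
  - move=> w _; rewrite -EFinM -EFinD lee_fin /wt -addrA -mulrDr lerD2l.
    exact: sqnorm_growth.
rewrite ge0_integralD//; last 2 first.
- by move=> w _; rewrite mule_ge0// lee_fin.
- by apply: emeasurable_funM.
rewrite integral_cst// [X in (_ * X + _)%E](_ : _ = 1%E); last exact: probability_setT.
rewrite mule1 ge0_integralZl_EFin//; last first.
  by move=> w _; rewrite lee_fin.
have mfin : (\int[nu_w]_z (eucl_sqnorm z)%:E)%E \is a fin_num.
  by rewrite ge0_fin_numE// integral_ge0// => w _; rewrite lee_fin.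
rewrite -(fineK mfin) -EFinM -EFinD lee_fin /growth_const /wt.
have := fine_nu_mom_ge0; have := s0 x; move: (fine _) (eucl_sqnorm x) (2 * K ^+ 2) k0.
by move=> m s k k0 s1 m0; have := mulr_ge0 k0 s1; have := mulr_ge0 k0 m0;
  have := mulr_ge0 (mulr_ge0 k0 m0) s1; lra.
Qed.

Local Notation kp := (kpush nu_w f_meas).
Implicit Types mu nu : {measure set T -> \bar R}.

Lemma kpush_fin mu : (mu setT < +oo)%E -> (kp mu setT < +oo)%E.
Proof.
move=> fin; rewrite kpushE; under eq_integral do rewrite preimage_setT probability_setT.
by rewrite integral_cst// mul1e.
Qed.

Lemma measurable_kernel_int (h : T -> \bar R) : measurable_fun [set: T] h ->
  (forall x, 0 <= h x)%E -> measurable_fun [set: T] (fun x => \int[nu_w]_w h (f x w))%E.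
Proof.
move=> mh h0.
apply: (@measurable_fun_fubini_tonelli_F _ _ _ _ _ nu_w (fun p : T * T => h (f p.1 p.2))) => //.
exact: (measurableT_comp mh f_meas).
Qed.

Lemma kpush_good phi : (forall x (A : set T), measurable A ->
    nu_w (f x @^-1` A) = leb_int_d (fun z => ((\1_A z : R) * phi x z)%:E)) ->
  forall mu, good mu -> good (kp mu).
Proof.
move=> phi_law mu gmu; split; last by move=> c c0; exact: kpush_hyperplane phi_law _ _ c0.
rewrite integral_kpush ?good_fin//; last 2 first.
- exact: measurable_EFin_wt.
- by move=> x; rewrite lee_fin wt_ge0.
apply: (@le_lt_trans _ _ (growth_const%:E * \int[mu]_x (wt x)%:E)%E).
  rewrite -ge0_integralZl_EFin ?(ltW growth_const_gt0)//; last 2 first.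
  - by move=> x _; rewrite lee_fin wt_ge0.
  - exact: measurable_EFin_wt.
  apply: ge0_le_integral => //.
  - by move=> x _; apply: integral_ge0 => w _; rewrite lee_fin wt_ge0.
  - apply: (measurable_kernel_int (h := fun x => (wt x)%:E)); first exact: measurable_EFin_wt.
    by move=> x; rewrite lee_fin wt_ge0.
  - by apply: emeasurable_funM => //; exact: measurable_EFin_wt.
  - by move=> x _; rewrite -EFinM kernel_wt.
rewrite lte_mul_pinfty// ?lee_fin ?(ltW growth_const_gt0)//.
exact: gmu.1.
Qed.

(** By duality: averaging a test function over the noise gives a test function for the original
    measures, up to the factor [growth_const]. *)
Lemma kpush_wclose mu nu e : (mu setT < +oo)%E -> (nu setT < +oo)%E ->
  wclose mu nu e -> wclose (kp mu) (kp nu) (growth_const * e).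
Proof.
move=> fmu fnu cl h mh hw.
have h0 x : (0 <= (h x)%:E)%E by rewrite lee_fin; case/andP: (hw x).
have mEh : measurable_fun [set: T] (fun x => (h x)%:E) by exact/measurable_EFinP.
pose P x := (\int[nu_w]_w (h (f x w))%:E)%E.
have P0 x : (0 <= P x)%E by apply: integral_ge0 => w _; exact: h0.
have Ple x : (P x <= (growth_const * wt x)%:E)%E.
  apply: le_trans (kernel_wt x); apply: ge0_le_integral => //.
  - exact: (measurableT_comp mEh (measurable_f2 f_meas x)).
  - exact: (measurableT_comp (@measurable_EFin_wt R d) (measurable_f2 f_meas x)).
  - by move=> w _; rewrite lee_fin; case/andP: (hw (f x w)).
have Pfin x : P x \is a fin_num.
  by rewrite ge0_fin_numE//; apply: le_lt_trans (Ple x) _; rewrite ltry.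
have mP : measurable_fun [set: T] (fun x => fine (P x)).
  apply: (measurableT_comp (fine_measurable measurableT)).
  exact: (measurable_kernel_int (h := fun x => (h x)%:E)).
have PE (m : {measure set T -> \bar R}) : (m setT < +oo)%E ->
    (\int[kp m]_x (h x)%:E = \int[m]_x (fine (P x))%:E)%E.
  by move=> fm; rewrite integral_kpush//; apply: eq_integral => x _; rewrite fineK.
have Pw x : 0 <= fine (P x) <= growth_const * wt x.
  by rewrite fine_ge0//= -lee_fin fineK.
rewrite !PE//; split.
- exact: (wclose_scale cl growth_const_gt0 mP Pw).
- exact: (wclose_scale (wclose_sym cl) growth_const_gt0 mP Pw).
Qed.

End KernelClose.

Section EqSetIntegral.
Import HBNNSimple.

(** Integrals are built from simple functions, which evaluate the set function on measurable sets
    only; no measure structure enters. *)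
Lemma eq_set_integral d (T : measurableType d) (R : realType)
    (mu mu' : set T -> \bar R) (D : set T) (g : T -> \bar R) :
  (forall A, measurable A -> mu A = mu' A) ->
  (\int[mu]_(x in D) g x = \int[mu']_(x in D) g x)%E.
Proof.
move=> mumu'.
have sE (h : {nnsfun T >-> R}) : sintegral mu h = sintegral mu' h.
  by apply: eq_fsbigr => x _; rewrite mumu'.
rewrite /integral; congr (_ - _)%E; congr ereal_sup; apply: eq_imagel => h _; exact: sE.
Qed.

End EqSetIntegral.

(** * Homogeneity of the cost-to-go and its objective as a sum over cells *)

Section CostToGo.
Variables (R : realType) (d M : nat).
Local Notation T := (d.-tuple R).
Hypothesis M_gt0 : (0 < M)%N.
Variables (f : T -> T -> T) (nu_w : probability T R).
Hypothesis f_meas : measurable_fun [set: T * T] (fun p : T * T => f p.1 p.2).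
Variables (phi : T -> T -> R) (C1 : R).
Hypothesis phi_law : forall x (A : set T), measurable A ->
  nu_w (f x @^-1` A) = leb_int_d (fun z => ((\1_A z : R) * phi x z)%:E).
Hypothesis phi_pos : forall x z, 0 < phi x z.
Hypothesis phi_lip : forall x z z', `|phi x z - phi x z'| <= C1 * eucl_dist z z'.
Variable Th : nat.

Local Notation kp := (kpush nu_w f_meas).
Local Notation J := (J_togo M Th phi).
Implicit Types mu nu : {measure set T -> \bar R}.

Lemma J_objective_congr (W : (set T -> \bar R) -> \bar R) (pi pi' : set T -> \bar R)
    (Q : T -> 'I_M) : Q_c d M Q -> (forall A, measurable A -> pi A = pi' A) ->
  J_objective Th phi W pi Q = J_objective Th phi W pi' Q.
Proof.
move=> qQ pipi'; rewrite /J_objective; congr (_ * _ + _)%E.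
  apply: eq_bigr => i _; congr ereal_inf; apply: eq_imagel => u _.
  exact: eq_set_integral.
apply: eq_bigr => m _; rewrite pipi'; last exact: (qQ m).1.
case: ifP => // _; congr (W _ * _)%E; rewrite /hat_pi; apply/funext => A.
congr leb_int_d; apply/funext => z; rewrite pipi'; last exact: (qQ m).1.
by congr (_ * _)%E; exact: eq_set_integral.
Qed.

Lemma J_congr k (pi pi' : set T -> \bar R) :
  (forall A, measurable A -> pi A = pi' A) -> J k pi = J k pi'.
Proof.
case: k => [//|k] pipi' /=; congr ereal_inf; apply: eq_imagel => Q qQ.
exact: J_objective_congr.
Qed.

Lemma kpush_congr mu mu' : (forall A, measurable A -> mu A = mu' A) ->
  forall A, kp mu A = kp mu' A.
Proof. by move=> mumu' A; rewrite !kpushE; exact: eq_set_integral. Qed.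

Lemma ereal_inf_cst (S : Type) (A : set S) (c : \bar R) :
  A !=set0 -> ereal_inf [set c | _ in A] = c.
Proof.
move=> [a Aa]; rewrite (_ : [set c | _ in A] = [set c]) ?ereal_inf1//.
by apply/seteqP; split=> [_ [_ _ <-]|_ ->]//; exists a.
Qed.

(** Reconciles the convention that null cells contribute 0 with the value of the zero measure. *)
Lemma J_zero k (pi : set T -> \bar R) :
  (forall A, measurable A -> pi A = 0%E) -> J k pi = 0%E.
Proof.
case: k => [//|k] pi0 /=; have [Q0 qQ0] := const_quantizer R d M_gt0.
transitivity (ereal_inf [set (0%E : \bar R) | _ in @Q_c R d M]); last first.
  by apply: ereal_inf_cst; exists Q0.
congr ereal_inf; apply: eq_imagel => Q qQ.
rewrite /J_objective big1 => [|i _]; last by rewrite pi0 ?eqxx//; exact: (qQ i).1.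
rewrite adde0 /quant_cost big1 ?mule0// => i _.
transitivity (ereal_inf [set (0%E : \bar R) | _ in [set: T]]); last first.
  by apply: ereal_inf_cst; exists [tuple 0 | i < d].
congr ereal_inf; apply: eq_imagel => u _.
by apply: (eq_trans (eq_set_integral (mu' := mzero) _ _ pi0)); rewrite integral_measure_zero.
Qed.

Lemma quant_cost_mres mu (Q : T -> 'I_M) : Q_c d M Q ->
  quant_cost mu Q = (\sum_(i < M) quad_cost (mres mu (qcell Q i)))%E.
Proof.
move=> qQ; apply: eq_bigr => i _; congr ereal_inf; apply: eq_imagel => u _.
rewrite integral_mres//; first exact: (qQ i).1.
- exact: measurable_EFin_sqdist.
- by move=> x; rewrite lee_fin eucl_sqdist_ge0.
Qed.

Lemma mres_fin mu A : measurable A -> (mu setT < +oo)%E -> (mres mu A setT < +oo)%E.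
Proof.
move=> mA; apply: le_lt_trans; rewrite mresE// setTI.
by apply: le_measure; rewrite ?inE.
Qed.

Section Scaling.
Variables (a : R) (a0 : 0 < a).

Definition scale_measure mu : {measure set T -> \bar R} := mscale (NngNum (ltW a0)) mu.

Arguments scale_measure : simpl never.

Lemma scale_measureE mu A : scale_measure mu A = (a%:E * mu A)%E.
Proof. by []. Qed.

Lemma integral_scale_measure mu D (g : T -> \bar R) : measurable D ->
  measurable_fun D g -> (forall x, D x -> 0 <= g x)%E ->
  (\int[scale_measure mu]_(x in D) g x = a%:E * \int[mu]_(x in D) g x)%E.
Proof. by move=> mD mg g0; rewrite [LHS]ge0_integral_mscale. Qed.

End Scaling.

Lemma hat_pi_scale a (a0 : 0 < a) mu (Q : T -> 'I_M) m : Q_c d M Q ->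
  hat_pi phi m (scale_measure a0 mu) Q = hat_pi phi m mu Q.
Proof.
move=> qQ; apply/funext => A; congr leb_int_d; apply/funext => z.
rewrite integral_scale_measure; first last.
- by move=> x _; rewrite lee_fin ltW.
- apply: (measurable_funS measurableT) => //; apply/measurable_EFinP.
  exact: (measurableT_comp (measurable_phi f_meas phi_law phi_pos phi_lip) (pair2_measurable z)).
- exact: (qQ m).1.
rewrite scale_measureE -!muleA; congr (_ * _)%E; rewrite muleA -EFinM; congr (_%:E * _)%E.
have [Hfin|] := boolP (mu (qcell Q m) \is a fin_num).
  by rewrite fineM//= invfM mulrAC mulVf ?mul1r// gt_eqF.
(* A cell of infinite mass has [fine] equal to 0 and inverse 0, so both sides vanish. *)
rewrite ge0_fin_numE// -leNgt leye_eq => /eqP ->.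
by rewrite gt0_muley ?lte_fin//= invr0 mul0r.
Qed.

(** The contribution of one cell, [nu] being the measure restricted to it; the next state keeps its
    unnormalized law [kp nu]. *)
Definition stage_value k nu : \bar R :=
  ((Th%:R^-1)%:E * quad_cost nu + J k (kp nu))%E.

Lemma J_hat k mu (Q : T -> 'I_M) m (c0 : 0 < (fine (mu (qcell Q m)))^-1) :
  (mu setT < +oo)%E -> Q_c d M Q ->
  J k (hat_pi phi m mu Q) = J k (scale_measure c0 (kp (mres mu (qcell Q m)))).
Proof.
move=> fin qQ; apply: J_congr => A mA.
by rewrite (hat_piE f_meas phi_law phi_pos phi_lip)//; exact: (qQ m).1.
Qed.

Lemma cell_mass mu (Q : T -> 'I_M) m : (mu setT < +oo)%E -> Q_c d M Q ->
  mu (qcell Q m) != 0%E -> 0 < fine (mu (qcell Q m)) /\ mu (qcell Q m) \is a fin_num.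
Proof.
move=> fin qQ mn0.
have mf : mu (qcell Q m) \is a fin_num.
  rewrite ge0_fin_numE//; apply: le_lt_trans fin; apply: le_measure; rewrite ?inE//.
  exact: (qQ m).1.
split=> //; rewrite -lte_fin fineK// lt0e mn0//=.
Qed.

Lemma Th_inv_ge0 : (0 <= (Th%:R^-1 : R)%:E)%E.
Proof. by rewrite lee_fin invr_ge0. Qed.

Lemma J_ge0 k mu : (mu setT < +oo)%E -> (0 <= J k mu)%E.
Proof.
elim: k mu => [//|k IH] mu fin /=.
apply: le_ereal_inf_tmp => _ [Q qQ <-]; rewrite /J_objective adde_ge0//.
  rewrite mule_ge0 ?Th_inv_ge0// quant_cost_mres// sume_ge0// => i _.
  exact: quad_cost_ge0.
apply: sume_ge0 => m _; case: ifPn => // mn0.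
have [c0 cfin] := cell_mass fin qQ mn0.
have ci0 : 0 < (fine (mu (qcell Q m)))^-1 by rewrite invr_gt0.
rewrite (J_hat _ ci0)// mule_ge0//; apply: IH.
rewrite scale_measureE lte_mul_pinfty ?lee_fin ?(ltW ci0)// kpush_fin//.
by apply: mres_fin => //; exact: (qQ m).1.
Qed.

(* Homogeneity lets the weight [mu (qcell Q m)] in the objective absorb the
   normalization of [hat_pi]. *)
Lemma J_scale k a (a0 : 0 < a) mu : (mu setT < +oo)%E ->
  J k (scale_measure a0 mu) = (a%:E * J k mu)%E.
Proof.
move=> fin; case: k => [|k] /=; first by rewrite mule0.
rewrite -ereal_inf_pZl// image_comp; congr ereal_inf; apply: eq_imagel => Q qQ /=.
have qc : quant_cost (scale_measure a0 mu) Q = (a%:E * quant_cost mu Q)%E.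
  rewrite /quant_cost ge0_sume_distrr; last first.
    move=> i _; apply: le_ereal_inf_tmp => _ [u _ <-]; apply: integral_ge0 => x _.
    by rewrite lee_fin eucl_sqdist_ge0.
  apply: eq_bigr => i _; rewrite -ereal_inf_pZl// image_comp; congr ereal_inf.
  apply: eq_imagel => u _ /=; rewrite integral_scale_measure//.
  - exact: (qQ i).1.
  - by apply: (measurable_funS measurableT) => //; exact: measurable_EFin_sqdist.
  - by move=> x _; rewrite lee_fin eucl_sqdist_ge0.
have t0 m : (0 <= if mu (qcell Q m) == 0 then 0
    else J k (hat_pi phi m mu Q) * mu (qcell Q m))%E.
  case: ifPn => // mn0; have [c0 cfin] := cell_mass fin qQ mn0.
  have ci0 : 0 < (fine (mu (qcell Q m)))^-1 by rewrite invr_gt0.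
  rewrite (J_hat _ ci0)// mule_ge0//; apply: J_ge0.
  rewrite scale_measureE lte_mul_pinfty ?lee_fin ?(ltW ci0)// kpush_fin//.
  by apply: mres_fin => //; exact: (qQ m).1.
have q0 : (0 <= quant_cost mu Q)%E.
  by rewrite quant_cost_mres// sume_ge0// => i _; exact: quad_cost_ge0.
rewrite /J_objective qc ge0_muleDr; last 2 first.
- by rewrite mule_ge0 ?Th_inv_ge0.
- by apply: sume_ge0 => m _; exact: t0.
congr (_ + _)%E; first by rewrite muleCA.
rewrite ge0_sume_distrr//; apply: eq_bigr => m _.
rewrite scale_measureE mule_eq0 eqe gt_eqF//=.
by case: ifP => _; rewrite ?mule0// hat_pi_scale// muleCA.
Qed.

Lemma J_objective_mres k mu (Q : T -> 'I_M) : (mu setT < +oo)%E -> Q_c d M Q ->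
  J_objective Th phi (J k) mu Q =
    (\sum_(i < M) stage_value k (mres mu (qcell Q i)))%E.
Proof.
move=> fin qQ; rewrite /J_objective /stage_value big_split /=; congr (_ + _)%E.
  rewrite quant_cost_mres// ge0_sume_distrr// => i _; exact: quad_cost_ge0.
apply: eq_bigr => m _; have mQ : measurable (qcell Q m) by exact: (qQ m).1.
have [m0|mn0] := eqVneq (mu (qcell Q m)) 0%E.
  apply/esym/J_zero => A mA; rewrite (kpush_congr (mu' := mzero)); last first.
    move=> B mB; rewrite mresE//; apply/eqP; rewrite eq_le measure_ge0 andbT -[leRHS]m0.
    by apply: le_measure; rewrite ?inE//; exact: measurableI.
  by rewrite kpushE integral_measure_zero.
have [c0 cfin] := cell_mass fin qQ mn0.
have ci0 : 0 < (fine (mu (qcell Q m)))^-1 by rewrite invr_gt0.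
rewrite (J_hat _ ci0)// J_scale; last by rewrite kpush_fin// mres_fin.
by rewrite -[X in (_ * X)%E](fineK cfin) muleC muleA -EFinM mulfV ?mul1e// gt_eqF.
Qed.

End CostToGo.

(** * Continuity of the cost-to-go and existence of minimizers *)

Section ValueContinuity.
Variables (R : realType) (d M : nat).
Local Notation T := (d.+1.-tuple R).
Hypothesis M_gt0 : (0 < M)%N.
Variables (f : T -> T -> T) (nu_w : probability T R).
Hypothesis f_meas : measurable_fun [set: T * T] (fun p : T * T => f p.1 p.2).
Variables (phi : T -> T -> R) (C1 : R).
Hypothesis phi_law : forall x (A : set T), measurable A ->
  nu_w (f x @^-1` A) = leb_int_d (fun z => ((\1_A z : R) * phi x z)%:E).
Hypothesis phi_pos : forall x z, 0 < phi x z.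
Hypothesis phi_lip : forall x z z', `|phi x z - phi x z'| <= C1 * eucl_dist z z'.
Variable K : R.
Hypothesis K_gt0 : 0 < K.
Hypothesis f_growth : forall x w, eucl_norm (f x w) <= K * (eucl_norm x + eucl_norm w).
Hypothesis nu_mom : (\int[nu_w]_z (eucl_sqnorm z)%:E < +oo)%E.
Variable Th : nat.

Local Notation kp := (kpush nu_w f_meas).
Local Notation J := (J_togo M Th phi).
Local Notation stage := (stage_value M nu_w f_meas phi Th).
Implicit Types mu nu : {measure set T -> \bar R}.

Lemma J_part_inf k mu : (mu setT < +oo)%E ->
  J k.+1 mu = part_inf M (stage k) mu.
Proof.
move=> fin; congr ereal_inf; apply: eq_imagel => Q qQ.
exact: (J_objective_mres M_gt0 f_meas phi_law phi_pos phi_lip).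
Qed.

Lemma Th_inv_le1 : (Th%:R^-1 : R) <= 1.
Proof. by case: Th => [|n]; rewrite ?invr0// invf_le1// ler1n. Qed.

Lemma stage_ge0 k mu : good mu -> (0 <= stage k mu)%E.
Proof.
move=> gmu; rewrite adde_ge0//.
  by rewrite mule_ge0 ?quad_cost_ge0// lee_fin invr_ge0.
have fin : (kp mu setT < +oo)%E by rewrite kpush_fin// good_fin.
exact: (J_ge0 M f_meas phi_law phi_pos phi_lip Th k fin).
Qed.

Lemma stage_fin k : (forall mu, good mu -> (J k mu < +oo)%E) ->
  forall mu, good mu -> (stage k mu < +oo)%E.
Proof.
move=> Jfin mu gmu; rewrite lte_add_pinfty//.
  rewrite lte_mul_pinfty// ?lee_fin ?invr_ge0//; exact: quad_cost_fin.
by apply: Jfin; exact: (kpush_good f_meas K_gt0 f_growth nu_mom phi_law).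
Qed.

Lemma stage_continuous k :
  wcontinuous (fun mu => J k mu) -> wcontinuous (stage k).
Proof.
move=> Jc mu gmu e e0.
have e20 : 0 < e / 2 by rewrite divr_gt0.
have g0 := growth_const_gt0 nu_w K.
have gkp : forall m, good m -> good (kp m).
  exact: (kpush_good f_meas K_gt0 f_growth nu_mom phi_law).
have near1 := quad_cost_continuous gmu e20.
have near2 := Jc _ (gkp _ gmu) _ e20.
have near3 : \forall del \near (0 : R)^'+, forall nu, good nu -> wclose mu nu del ->
    (J k (kp mu) <= J k (kp nu) + (e / 2)%:E)%E /\
    (J k (kp nu) <= J k (kp mu) + (e / 2)%:E)%E.
  apply: near_right0.
    by move=> a b a0 ab H nu gnu cl; apply: H => //; exact: wclose_le cl.
  have [del [del0 delP]] : exists del : R, 0 < del /\ forall nu, good nu ->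
      wclose (kp mu) nu del -> (J k (kp mu) <= J k nu + (e / 2)%:E)%E /\
      (J k nu <= J k (kp mu) + (e / 2)%:E)%E.
    near (0 : R)^'+ => del; exists del; split; near: del; last exact: near2.
    exact: nbhs_right_gt.
  (* Compensates the factor lost in [kpush_wclose]. *)
  exists (del / growth_const nu_w K); first by rewrite divr_gt0.
  move=> nu gnu cl; apply: delP; first exact: gkp.
  have := kpush_wclose f_meas K_gt0 f_growth nu_mom (good_fin gmu) (good_fin gnu) cl.
  by rewrite mulrC mulfVK// gt_eqF.
(* A factor at most 1 does not enlarge the error. *)
have scale a b : (a <= b + (e / 2)%:E)%E -> (0 <= b)%E ->
    ((Th%:R^-1)%:E * a <= (Th%:R^-1)%:E * b + (e / 2)%:E)%E.
  move=> ab b0; apply: (@le_trans _ _ ((Th%:R^-1)%:E * (b + (e / 2)%:E))%E).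
    by rewrite lee_wpmul2l// lee_fin invr_ge0.
  rewrite ge0_muleDr// ?lee_fin ?(ltW e20)// leeD2l// -EFinM lee_fin.
  by rewrite ler_piMl ?(ltW e20)// Th_inv_le1.
near=> del => nu gnu cl.
have [a1 a2] : (quad_cost mu <= quad_cost nu + (e / 2)%:E)%E /\
    (quad_cost nu <= quad_cost mu + (e / 2)%:E)%E.
  by apply: (near near1 del) => //; near: del.
have [b1 b2] : (J k (kp mu) <= J k (kp nu) + (e / 2)%:E)%E /\
    (J k (kp nu) <= J k (kp mu) + (e / 2)%:E)%E.
  by apply: (near near3 del) => //; near: del.
rewrite /stage_value (splitr e) EFinD; split.
  by rewrite addeACA leeD// scale ?quad_cost_ge0.
by rewrite addeACA leeD// scale ?quad_cost_ge0.
Unshelve. all: by end_near. Qed.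

(** Finiteness and continuity go through the induction together: [part_inf_continuous] needs both
    for the previous stage. *)
Lemma J_regular k : (forall mu, good mu -> (J k mu < +oo)%E) /\
  wcontinuous (fun mu => J k mu).
Proof.
elim: k => [|k [Jfin Jc]].
  split=> [mu _|mu gmu e e0]; first by rewrite /= ltry.
  by apply: filterE => del nu _ _ /=; rewrite add0e lee_fin ltW.
have sg := @stage_ge0 k; have sf := stage_fin Jfin; have sc := stage_continuous Jc.
split=> [mu gmu|mu gmu e e0].
  rewrite J_part_inf ?good_fin//; exact: part_inf_fin.
have := part_inf_continuous sg sf sc M_gt0 gmu e0.
apply: filterS => del H nu gnu cl.
by rewrite !J_part_inf ?good_fin//; exact: H.
Qed.

Lemma J_attained k mu : good mu ->
  exists2 Q, Q_c d.+1 M Q & J k.+1 mu = J_objective Th phi (J k) mu Q.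
Proof.
move=> gmu; have [Jfin Jc] := J_regular k.
have [Q qQ infE] := part_inf_attained (@stage_ge0 k) (stage_fin Jfin)
  (stage_continuous Jc) M_gt0 gmu.
exists Q => //; rewrite J_part_inf ?good_fin// infE; apply/esym.
by apply: (J_objective_mres M_gt0 f_meas phi_law phi_pos phi_lip); first exact: good_fin.
Qed.

(** Some cell carries infinite second moment but finite mass, so no [u] gives it finite cost; as all
    objectives equal [+oo], any quantizer attains the infimum. *)
Lemma J_attained_infinite k mu : (mu setT < +oo)%E ->
  (\int[mu]_x (wt x)%:E = +oo)%E ->
  (0 < Th)%N ->
  exists2 Q, Q_c d.+1 M Q & J k.+1 mu = J_objective Th phi (J k) mu Q.
Proof.
move=> fin winf Th0.
have objy Q : Q_c d.+1 M Q -> J_objective Th phi (J k) mu Q = +oo%E.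
  move=> qQ.
  have mQ i : measurable (qcell Q i) by exact: (qQ i).1.
  rewrite (J_objective_mres M_gt0 f_meas phi_law phi_pos phi_lip)//.
  have sum_wt : (\int[mu]_x (wt x)%:E = \sum_(i < M) \int[mu]_(x in qcell Q i) (wt x)%:E)%E.
    rewrite -ge0_integral_bigsetU//.
    - congr (integral _ _ _); apply/esym/seteqP; split=> // x _.
      by rewrite -bigcup_seq; exists (Q x) => //=; rewrite mem_index_enum.
    - exact: index_enum_uniq.
    - by move=> i j _ _ [x [/= <- <-]].
    - by apply: (measurable_funS measurableT) => //; exact: measurable_EFin_wt.
    - by move=> x _; rewrite lee_fin wt_ge0.
  have [i iy] : exists i, (\int[mu]_(x in qcell Q i) (wt x)%:E = +oo)%E.
    apply: contrapT => H; have : (\int[mu]_x (wt x)%:E < +oo)%E.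
      rewrite sum_wt; apply: lte_sum_pinfty => i _; rewrite ltey.
      by apply/negP => /eqP iy; apply: H; exists i.
    by rewrite winf ltxx.
  have qcy : quad_cost (mres mu (qcell Q i)) = +oo%E.
    apply/eqP; rewrite -leye_eq; apply: le_ereal_inf_tmp => _ [u _ <-].
    rewrite leNgt; apply/negP => ltu.
    suff : (\int[mu]_(x in qcell Q i) (wt x)%:E < +oo)%E by rewrite iy ltxx.
    set m := mres mu (qcell Q i) in ltu *.
    have mw := @measurable_EFin_wt R d.+1.
    have ms := @measurable_EFin_sqdist R d.+1 u.
    have s0 x : (0 <= (eucl_sqdist x u)%:E)%E by rewrite lee_fin eucl_sqdist_ge0.
    have w0 (x : T) : (0 <= (wt x)%:E)%E by rewrite lee_fin wt_ge0.
    have c0 : 0 <= 1 + 2 * eucl_sqnorm u by rewrite addr_ge0// mulr_ge0// eucl_sqnorm_ge0.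
    rewrite -(integral_mres _ (mQ i) mw w0) -/m.
    apply: (@le_lt_trans _ _ (\int[m]_x ((1 + 2 * eucl_sqnorm u)%:E + 2%:E * (eucl_sqdist x u)%:E))%E).
      apply: ge0_le_integral => //.
      - by apply: emeasurable_funD => //; apply: emeasurable_funM.
      - move=> x _; rewrite -EFinM -EFinD lee_fin /wt -addrA lerD2l.
        have := sqnorm_le_sqdist u x.
        have -> : eucl_sqdist u x = eucl_sqdist x u.
          by apply: eq_bigr => j _; rewrite -sqrrN opprB.
        lra.
    rewrite ge0_integralD//; last 2 first.
    - by move=> x _; rewrite mule_ge0// lee_fin.
    - by apply: emeasurable_funM.
    rewrite lte_add_pinfty//.
      rewrite integral_cst// lte_mul_pinfty// ?lee_fin//.
      exact: mres_fin.
    by rewrite ge0_integralZl_EFin// lte_mul_pinfty// lee_fin.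
  have Jk0 j : (0 <= J k (kp (mres mu (qcell Q j))))%E.
    have finj : (kp (mres mu (qcell Q j)) setT < +oo)%E by rewrite kpush_fin// mres_fin.
    exact: (J_ge0 M f_meas phi_law phi_pos phi_lip Th k finj).
  have stage0 j : (0 <= stage k (mres mu (qcell Q j)))%E.
    by rewrite adde_ge0// mule_ge0 ?quad_cost_ge0// lee_fin invr_ge0.
  have stagey : stage k (mres mu (qcell Q i)) = +oo%E.
    (* A positive horizon matters here: with [Th = 0] the factor would be 0, and 0 times [+oo] is
       0. *)
    rewrite /stage_value qcy gt0_muley ?lte_fin ?invr_gt0 ?ltr0n//.
    by rewrite addye// gt_eqF// (lt_le_trans ltNy0 (Jk0 i)).
  apply/eqP; rewrite -leye_eq -[X in (X <= _)%E]stagey (bigD1 i)//=.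
  by rewrite leeDl// sume_ge0.
have [Q qQ] := const_quantizer R d.+1 M_gt0; exists Q => //.
rewrite objy//=; transitivity (ereal_inf [set (+oo : \bar R)%E | _ in @Q_c R d.+1 M]).
  by congr ereal_inf; apply: eq_imagel => Q' qQ'; exact: objy.
by apply: ereal_inf_cst; exists Q.
Qed.

(** A point mass charges hyperplanes, so it is not [good]. Only the cell of [x0] contributes, at no
    immediate cost since [u = x0] is allowed, and every objective equals [J k (kp mu)]. *)
Lemma J_attained_dirac k mu (x0 : T) : (forall A, measurable A -> mu A = \d_x0 A) ->
  exists2 Q, Q_c d.+1 M Q & J k.+1 mu = J_objective Th phi (J k) mu Q.
Proof.
move=> muE.
have fin : (mu setT < +oo)%E by rewrite muE// diracT ltry.
have objE Q : Q_c d.+1 M Q -> J_objective Th phi (J k) mu Q = J k (kp mu).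
  move=> qQ; have mQ i : measurable (qcell Q i) by exact: (qQ i).1.
  rewrite (J_objective_mres M_gt0 f_meas phi_law phi_pos phi_lip)// /stage_value.
  have mresN i : i != Q x0 -> forall A, measurable A -> mres mu (qcell Q i) A = 0%E.
    move=> iQ A mA; rewrite mresE// muE; last exact: measurableI.
    by rewrite diracE memNset//= => -[_ /= /eqP]; rewrite eq_sym (negbTE iQ).
  have mresQ A : measurable A -> mres mu (qcell Q (Q x0)) A = mu A.
    move=> mA; rewrite mresE// !muE//; last exact: measurableI.
    rewrite !diracE; congr ((_ : bool)%:R%:E); apply/idP/idP; rewrite !inE.
      by case.
    by move=> Ax0; split.
  have qc0 i : quad_cost (mres mu (qcell Q i)) = 0%E.
    apply/eqP; rewrite eq_le quad_cost_ge0 andbT; apply: (le_trans (quad_cost_le _ x0)).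
    rewrite integral_mres//; [|exact: measurable_EFin_sqdist|by move=> x; rewrite lee_fin eucl_sqdist_ge0].
    rewrite (eq_set_integral (mu' := \d_x0))// integral_dirac//; last first.
      by apply: (measurable_funS measurableT) => //; exact: measurable_EFin_sqdist.
    by rewrite /eucl_sqdist big1 ?mule0// => j _; rewrite subrr expr0n.
  rewrite (bigD1 (Q x0))//= qc0 mule0 add0e big1 ?adde0.
    by apply: J_congr => A mA; exact: kpush_congr.
  move=> i iQ; rewrite qc0 mule0 add0e; apply: J_zero => // A mA.
  rewrite (kpush_congr (mu' := mzero) _ _ (mresN i iQ)).
  by rewrite kpushE integral_measure_zero.
have [Q qQ] := const_quantizer R d.+1 M_gt0; exists Q => //.
rewrite objE//=; transitivity (ereal_inf [set J k (kp mu) | _ in @Q_c R d.+1 M]).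
  by congr ereal_inf; apply: eq_imagel => Q' qQ'; exact: objE.
by apply: ereal_inf_cst; exists Q.
Qed.

End ValueContinuity.

(** * From weak to weighted convergence *)

Section Densities.
Variables (R : realType) (d : nat).
Local Notation T := (d.-tuple R).
Local Notation leb := (leb_tuple R d).

Lemma density_affine_null (mu : {measure set T -> \bar R}) p :
  has_leb_density mu p -> affine_null mu.
Proof.
move=> [_ muE] c c0; rewrite muE; last exact: measurable_aff_eq0.
apply: (leb_int_d_hyperplane c0) => z cz.
by rewrite indicE memNset ?mul0r//=; exact/eqP.
Qed.

Lemma integral_leb_density (mu : {measure set T -> \bar R}) p :
  measurable_fun [set: T] p -> has_leb_density mu p ->
  forall g : T -> R, measurable_fun [set: T] g -> (forall x, 0 <= g x) ->
  (\int[mu]_x (g x)%:E = \int[leb]_x (g x * p x)%:E)%E.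
Proof.
move=> mp [p0 muE] g mg g0.
rewrite (@integral_density _ _ _ mu leb p)//.
- move=> A mA; rewrite muE// leb_int_dE//.
    by apply/measurable_EFinP; apply: measurable_funM => //; exact: measurable_indic.
  by move=> x; rewrite lee_fin mulr_ge0.
- exact/measurable_EFinP.
Qed.

Lemma l1dist_le_eucl (x y : T) : l1dist x y <= d%:R * eucl_dist x y.
Proof.
rewrite /l1dist (le_trans (ler_sum (G := fun=> eucl_dist x y) _ _))//.
  move=> i _; rewrite /eucl_dist -sqrtr_sqr ler_sqrt.
    by rewrite /eucl_sqdist (bigD1 i)//= lerDl sumr_ge0// => j _; exact: sqr_ge0.
  exact: eucl_sqdist_ge0.
by rewrite sumr_const card_ord mulr_natl.
Qed.

Lemma l1dist_ge0 (x y : T) : 0 <= l1dist x y.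
Proof. exact: sumr_ge0. Qed.

Lemma l1dist_triangle (x y z : T) : `|l1dist x z - l1dist y z| <= l1dist x y.
Proof.
rewrite /l1dist -sumrB (le_trans (ler_norm_sum _ _ _))// ler_sum// => i _.
by rewrite (le_trans (ler_dist_dist _ _))// opprB addrA subrK.
Qed.

(** Admissible for weak convergence, and supported where an [L]-Lipschitz density varies by at most
    [L * r]. *)
Definition tent (z : T) (r : R) (y : T) : R := Num.max 0 (1 - l1dist y z / r).

Lemma tent_lip z r x y : 0 < r -> `|tent z r x - tent z r y| <= l1dist x y / r.
Proof.
move=> r0; have /ler_normlP[H1 H2] := l1dist_triangle x y z.
have A : l1dist x z / r - l1dist y z / r <= l1dist x y / r.
  by rewrite -mulrBl ler_pM2r ?invr_gt0.
have B : l1dist y z / r - l1dist x z / r <= l1dist x y / r.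
  by rewrite -mulrBl ler_pM2r ?invr_gt0//; lra.
have C : 0 <= l1dist x y / r by rewrite divr_ge0 ?l1dist_ge0// ltW.
by rewrite /tent /Num.max; case: ifPn => ?; case: ifPn => ?; rewrite ler_norml; apply/andP; split; lra.
Qed.

Lemma tent_bdd_cont z r : 0 < r -> bdd_cont_fun (tent z r).
Proof.
move=> r0; split.
  exists 1 => x; rewrite /tent ger0_norm ?le_max ?lexx// ge_max ler01/= lerBlDr lerDl.
  by rewrite divr_ge0 ?l1dist_ge0// ltW.
move=> x e e0; exists (e * r / (d%:R + 1)).
  by rewrite divr_gt0 ?mulr_gt0// ltr_wpDl.
move=> y; rewrite ltr_pdivlMr ?ltr_wpDl// => H.
apply: (le_lt_trans (tent_lip z x y r0)); rewrite ltr_pdivrMr//.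
apply: le_lt_trans H; apply: (le_trans (l1dist_le_eucl x y)).
by rewrite mulrC ler_wpM2l ?sqrtr_ge0// lerDl.
Qed.

Lemma measurable_tent z r : measurable_fun [set: T] (tent z r).
Proof.
apply: measurable_maxr => //; apply: measurable_funB => //.
by apply: measurable_funM => //; exact: measurable_l1dist.
Qed.

Lemma tent_ge0 z r y : 0 <= tent z r y.
Proof. by rewrite /tent le_max lexx. Qed.

Lemma tent_supp z r y : 0 < r -> r <= l1dist y z -> tent z r y = 0.
Proof.
by move=> r0 ry; apply/max_idPl; rewrite subr_le0 ler_pdivlMr// mul1r.
Qed.

Lemma tent_int z r : 0 < r ->
  exists2 V : R, 0 < V & (\int[leb]_y (tent z r y)%:E = V%:E)%E.
Proof.
move=> r0; have mt : measurable_fun [set: T] (fun y => (tent z r y)%:E).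
  by apply/measurable_EFinP; exact: measurable_tent.
have t0 y : (0 <= (tent z r y)%:E)%E by rewrite lee_fin tent_ge0.
(* On the box of radius [r'] the l1 distance to [z] is at most [r / 2], so the tent is at least one
   half there. *)
pose r' := r / (2 * (d%:R + 1)).
have D0 : 0 < 2 * (d%:R + 1) :> R by rewrite mulr_gt0// ltr_wpDl.
have r'0 : 0 < r' by rewrite divr_gt0.
have up : (\int[leb]_y (tent z r y)%:E <= ((2 * r) ^+ d)%:E)%E.
  rewrite -(leb_tuple_box z (ltW r0)) -[X in (_ <= leb X)%E]setIT.
  rewrite -integral_indic//; last exact: measurable_box.
  apply: ge0_le_integral => //.
    by apply/measurable_EFinP; apply: measurable_indic; exact: measurable_box.
  move=> y _; rewrite lee_fin indicE.
  have [yb|yb] := boolP (y \in box z r).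
    rewrite /tent ge_max ler01/= lerBlDr lerDl divr_ge0 ?l1dist_ge0//; exact: ltW.
  rewrite tent_supp// leNgt; apply/negP => H; move/negP: yb; apply.
  rewrite inE => i; apply: le_trans (ltW H).
  by rewrite /l1dist (bigD1 i)//= lerDl sumr_ge0.
have lo : ((2^-1 * (2 * r') ^+ d)%:E <= \int[leb]_y (tent z r y)%:E)%E.
  rewrite EFinM -(leb_tuple_box z (ltW r'0)) -[X in (_ * leb X <= _)%E]setIT.
  rewrite -integral_indic//; last exact: measurable_box.
  rewrite -ge0_integralZl_EFin//; last first.
    by apply/measurable_EFinP; apply: measurable_indic; exact: measurable_box.
  apply: ge0_le_integral => //.
    apply: emeasurable_funM => //.
    by apply/measurable_EFinP; apply: measurable_indic; exact: measurable_box.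
  move=> y _; rewrite -EFinM lee_fin indicE.
  have [yb|yb] := boolP (y \in box z r'); last by rewrite mulr0 tent_ge0.
  have yl : l1dist y z / r <= 2^-1.
    rewrite inE in yb; rewrite ler_pdivrMr//; apply: (le_trans (box_l1dist yb)).
    rewrite /r' mulrCA [leRHS]mulrC ler_pM2l//.
    rewrite ler_pdivrMr// mulrA mulVf// mul1r lerDl//.
  by rewrite mulr1 /tent le_max; apply/orP; right; lra.
have fin : (\int[leb]_y (tent z r y)%:E)%E \is a fin_num.
  rewrite ge0_fin_numE ?(le_lt_trans up) ?ltry//.
  exact: integral_ge0.
exists (fine (\int[leb]_y (tent z r y)%:E)%E); last by rewrite fineK.
rewrite -lte_fin fineK//; apply: lt_le_trans lo.
by rewrite lte_fin mulr_gt0// exprn_gt0// mulr_gt0.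
Qed.

Lemma tent_density (mu : {measure set T -> \bar R}) p L z r V : 0 <= L -> 0 < r -> 0 < V ->
  has_leb_density mu p -> (forall x y, `|p x - p y| <= L * l1dist x y) ->
  (\int[leb]_y (tent z r y)%:E = V%:E)%E ->
  exists2 I : R, (\int[mu]_y (tent z r y)%:E = I%:E)%E & `|I - p z * V| <= L * r * V.
Proof.
move=> L0 r0 V0 dens lip VE.
have mp := l1_lipschitz_measurable L0 lip.
have p0 x : 0 <= p x by exact: dens.1.
have mt := measurable_tent z r.
have t0 := tent_ge0 z r.
have cE (a : R) : 0 <= a -> (\int[leb]_y (tent z r y * a)%:E = (V * a)%:E)%E.
  move=> a0; rewrite EFinM -VE muleC -ge0_integralZl_EFin//.
  - by apply: eq_integral => y _; rewrite -EFinM mulrC.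
  - by move=> y _; rewrite lee_fin.
  - exact/measurable_EFinP.
have mtp : measurable_fun [set: T] (fun y => (tent z r y * p y)%:E).
  by apply/measurable_EFinP; apply: measurable_funM.
have mtc (a : R) : measurable_fun [set: T] (fun y => (tent z r y * a)%:E).
  by apply/measurable_EFinP; apply: measurable_funM.
have Lr : 0 <= L * r by rewrite mulr_ge0// ltW.
have near_p y : tent z r y != 0 -> `|p y - p z| <= L * r.
  move=> ty; apply: (le_trans (lip _ _)); rewrite ler_wpM2l// leNgt.
  by apply/negP => /ltW /(tent_supp r0)/eqP; apply/negP.
have muE := integral_leb_density mp dens mt t0.
have up : (\int[mu]_y (tent z r y)%:E <= (V * (p z + L * r))%:E)%E.
  rewrite muE -cE ?addr_ge0//; apply: ge0_le_integral => //.
  - by move=> y _; rewrite lee_fin mulr_ge0.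
  - move=> y _; rewrite lee_fin; have [->|/near_p] := eqVneq (tent z r y) 0; first by rewrite !mul0r.
    by rewrite ler_norml => /andP[_ H]; rewrite ler_wpM2l//; lra.
have lo : ((V * p z)%:E <= \int[mu]_y (tent z r y)%:E + (V * (L * r))%:E)%E.
  rewrite muE -(cE _ Lr) -cE// -ge0_integralD//; last 2 first.
  - by move=> y _; rewrite lee_fin mulr_ge0.
  - by move=> y _; rewrite lee_fin mulr_ge0.
  apply: ge0_le_integral => //.
  - by move=> y _; rewrite lee_fin mulr_ge0.
  - exact: emeasurable_funD.
  - move=> y _; rewrite -EFinD -mulrDr lee_fin; have [->|/near_p] := eqVneq (tent z r y) 0; first by rewrite !mul0r.
    by rewrite ler_norml => /andP[H _]; rewrite ler_wpM2l//; lra.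
have fin : (\int[mu]_y (tent z r y)%:E)%E \is a fin_num.
  rewrite ge0_fin_numE ?(le_lt_trans up) ?ltry//.
  by apply: integral_ge0 => y _; rewrite lee_fin.
exists (fine (\int[mu]_y (tent z r y)%:E)%E); first by rewrite fineK.
move: up lo; rewrite -(fineK fin) /= -EFinD !lee_fin; move: (fine _) => I up lo.
by rewrite ler_norml; apply/andP; split; lra.
Qed.

Lemma density_pointwise (mus : nat -> probability T R) (mu : probability T R)
    (ps : nat -> T -> R) (p : T -> R) L : 0 <= L ->
  (forall n, has_leb_density (mus n) (ps n)) -> has_leb_density mu p ->
  (forall n x y, `|ps n x - ps n y| <= L * l1dist x y) ->
  (forall x y, `|p x - p y| <= L * l1dist x y) ->
  weak_cvg_prob mus mu -> forall z, ps n z @[n --> \oo] --> p z.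
Proof.
move=> L0 dens den lips lip weak z; apply/cvgrPdist_le => e e0.
(* Makes [L * r] at most [e / 4]: each of the two densities loses a quarter of [e], and weak
   convergence the remaining half. *)
pose r := e / (4 * (L + 1)).
have r0 : 0 < r by rewrite divr_gt0// mulr_gt0// ltr_wpDl.
have Lr : L * r <= e / 4.
  rewrite /r (_ : L * _ = e / 4 * (L / (L + 1))); last first.
    by field; rewrite gt_eqF// ltr_wpDl.
  by rewrite ler_piMr ?divr_ge0 ?(ltW e0)// ler_pdivrMr ?ltr_wpDl// mul1r lerDl.
have [V V0 VE] := tent_int z r0.
have [I IE Ip] := tent_density L0 r0 V0 den lip VE.
have := weak _ (tent_bdd_cont z r0); rewrite IE => /fine_cvgP[_ /cvgrPdist_le].
have eV : 0 < e / 2 * V by rewrite mulr_gt0// divr_gt0.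
move=> /(_ _ eV); apply: filterS => n /=.
have [In InE Inp] := tent_density L0 r0 V0 (dens n) (lips n) VE.
rewrite InE /= => H.
have LrV : L * r * V <= e / 4 * V by rewrite ler_pM2r.
rewrite -(ler_pM2r V0) -[X in _ * X](ger0_norm (ltW V0)) -normrM mulrBl.
move: H Ip Inp; rewrite !ler_norml => /andP[H1 H2] /andP[H3 H4] /andP[H5 H6].
apply/andP; split; lra.
Qed.

(** The positive part of [p - ps n] is dominated by [p] and tends to 0, so its integral bounds the
    loss for all [h] at once. *)
Lemma scheffe (mus : nat -> probability T R) (mu : probability T R)
    (ps : nat -> T -> R) (p : T -> R) :
  (forall n, measurable_fun [set: T] (ps n)) -> measurable_fun [set: T] p ->
  (forall n, has_leb_density (mus n) (ps n)) -> has_leb_density mu p ->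
  (forall z, ps n z @[n --> \oo] --> p z) ->
  forall e : R, 0 < e -> \forall n \near \oo, forall (h : T -> R) (B : R),
    measurable_fun [set: T] h -> (forall x, 0 <= h x <= B) ->
    (\int[mu]_x (h x)%:E <= \int[mus n]_x (h x)%:E + (B * e)%:E)%E /\
    (\int[mus n]_x (h x)%:E <= \int[mu]_x (h x)%:E + (B * e)%:E)%E.
Proof.
move=> mps mp dens den ptw e e0.
have p0 x : 0 <= p x by exact: den.1.
have ps0 n x : 0 <= ps n x by exact: (dens n).1.
pose D n x : R := Num.max 0 (p x - ps n x).
have D0 n x : 0 <= D n x by rewrite le_max lexx.
have mD n : measurable_fun [set: T] (D n).
  by apply: measurable_maxr => //; apply: measurable_funB.
have mED n : measurable_fun [set: T] (EFin \o D n) by exact/measurable_EFinP.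
have Dp n x : D n x <= p x by rewrite ge_max p0/= lerBlDr lerDl.
have ip : (\int[leb]_x (p x)%:E = 1)%E.
  have H := integral_leb_density mp den (measurable_cst (1 : R)) (fun=> ler01).
  transitivity (\int[mu]_x (cst (1 : R) x)%:E)%E.
    by rewrite H; apply: eq_integral => x _; rewrite /= mul1r.
  transitivity (\int[mu]_x (cst (1%:E : \bar R) x))%E => //.
  by rewrite integral_cst// mul1e; exact: probability_setT.
have [|||| _ _ cvgD] := @dominated_convergence _ _ _ leb setT measurableT
    (fun n => EFin \o D n) (cst 0%E) (EFin \o p) mED.
- exact: measurable_cst.
- apply: aeW => x _; apply: cvg_EFin; first exact: filterE.
  apply/cvgrPdist_le => eps eps0; move/cvgrPdist_le: (ptw x) => /(_ eps eps0).
  apply: filterS => n /=; rewrite sub0r normrN (ger0_norm (D0 n x)) => H.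
  by rewrite ge_max (ltW eps0)/=; apply: le_trans H; exact: ler_norm.
- apply/integrableP; split; first exact/measurable_EFinP.
  rewrite (_ : \int[leb]_x `|(EFin \o p) x| = 1)%E ?ltry// -ip.
  by apply: eq_integral => x _ /=; rewrite ger0_norm.
- by apply: aeW => x n _ /=; rewrite lee_fin ger0_norm.
move: cvgD; rewrite integral0 => /fine_cvgP[Dfin /cvgrPdist_le/(_ e e0) De].
near=> n => h B mh hB.
have B0 : 0 <= B by case/andP: (hB point) => /le_trans /[apply].
have Dn : (\int[leb]_x (D n x)%:E <= e%:E)%E.
  have Dnf : (\int[leb]_x (D n x)%:E)%E \is a fin_num by near: n.
  rewrite -(fineK Dnf) lee_fin.
  have : `|0 - fine (\int[leb]_x (D n x)%:E)%E| <= e by near: n.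
  by rewrite sub0r normrN; apply: le_trans; exact: ler_norm.
have key (g : T -> R) : measurable_fun [set: T] g -> (forall x, 0 <= g x <= B) ->
    (\int[mu]_x (g x)%:E <= \int[mus n]_x (g x)%:E + (B * e)%:E)%E.
  move=> mg gB; have g0 x : 0 <= g x by case/andP: (gB x).
  have mDn : measurable_fun [set: T] (fun x => (D n x)%:E) := mED n.
  have D0e x : (0 <= (D n x)%:E)%E by rewrite lee_fin.
  have mBD : measurable_fun [set: T] (fun x => (B%:E * (D n x)%:E)%E).
    exact: emeasurable_funM.
  rewrite (integral_leb_density mp den)// (integral_leb_density (mps n) (dens n))//.
  apply: (@le_trans _ _ (\int[leb]_x (g x * ps n x)%:E + B%:E * \int[leb]_x (D n x)%:E)%E); last first.
    by rewrite leeD2l// EFinM lee_wpmul2l.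
  rewrite -ge0_integralZl_EFin//.
  rewrite -ge0_integralD//; last 3 first.
  - by move=> x _; rewrite lee_fin mulr_ge0.
  - by apply/measurable_EFinP; exact: measurable_funM.
  - by move=> x _; rewrite mule_ge0// lee_fin.
  apply: ge0_le_integral => //.
  - by move=> x _; rewrite lee_fin mulr_ge0.
  - by apply/measurable_EFinP; exact: measurable_funM.
  - apply: emeasurable_funD; last exact: mBD.
    by apply/measurable_EFinP; exact: measurable_funM.
  - move=> x _; rewrite -EFinM -EFinD lee_fin.
    have H : p x <= ps n x + D n x.
      by rewrite -lerBlDl /D le_max lexx orbT.
    have gx : g x <= B by case/andP: (gB x).
    apply: (le_trans (ler_wpM2l (g0 x) H)); rewrite mulrDr lerD2l.
    by rewrite ler_wpM2r.
split; first exact: key.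
(* Both measures have mass 1, so the reverse inequality for [h] is the first one for [B - h]. *)
have cstB (m : probability T R) : (\int[m]_x (cst B%:E x) = B%:E)%E.
  rewrite integral_cst// [X in (_ * X)%E](_ : _ = 1%E) ?mule1//.
  exact: probability_setT.
have compl (m : probability T R) : (\int[m]_x (h x)%:E + \int[m]_x (B - h x)%:E = B%:E)%E.
  rewrite -ge0_integralD//.
  - transitivity (\int[m]_x (cst B%:E x))%E; last exact: cstB.
    by apply: eq_integral => x _; rewrite -EFinD addrC subrK.
  - by move=> x _; rewrite lee_fin; case/andP: (hB x).
  - exact/measurable_EFinP.
  - by move=> x _; rewrite lee_fin subr_ge0; case/andP: (hB x).
  - by apply/measurable_EFinP; apply: measurable_funB.
have finh (m : probability T R) (g : T -> R) : (forall x, 0 <= g x <= B) -> measurable_fun [set: T] g ->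
    (\int[m]_x (g x)%:E)%E \is a fin_num.
  move=> gB mg; rewrite ge0_fin_numE; last first.
    by apply: integral_ge0 => x _; rewrite lee_fin; case/andP: (gB x).
  apply: (@le_lt_trans _ _ (\int[m]_x (cst B%:E x))%E); last by rewrite cstB ltry.
  apply: ge0_le_integral => //.
  - by move=> x _; rewrite lee_fin; case/andP: (gB x).
  - exact/measurable_EFinP.
  - by move=> x _; rewrite lee_fin; case/andP: (gB x).
have mBh : measurable_fun [set: T] (fun x => B - h x) by apply: measurable_funB.
have Bh x : 0 <= B - h x <= B by have /andP[? ?] := hB x; apply/andP; split; lra.
have := key _ mBh Bh; have := compl mu; have := compl (mus n).
rewrite -(fineK (finh mu _ hB mh)) -(fineK (finh (mus n) _ hB mh)).
rewrite -(fineK (finh mu _ Bh mBh)) -(fineK (finh (mus n) _ Bh mBh)).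
by rewrite -!EFinD !lee_fin => -[E1] -[E2] H; lra.
Unshelve. all: by end_near. Qed.

End Densities.

(** * Uniform integrability and the passage to the weighted norm *)

Section WeakToWeighted.
Variables (R : realType) (d : nat).
Local Notation T := (d.-tuple R).
Implicit Types mu nu : {measure set T -> \bar R}.

Definition tail (L : R) : set T := [set x | L <= eucl_sqnorm x].

Lemma measurable_tail L : measurable (tail L).
Proof.
have := measurable_fun_ler (measurable_cst L) (@measurable_sqnorm R d).
move=> /(_ measurableT [set true] I).
by rewrite setTI; congr measurable; apply/seteqP; split=> x /=.
Qed.

Lemma measurable_EFin_sqnorm : measurable_fun [set: T] (fun x => (eucl_sqnorm x)%:E).
Proof. by apply/measurable_EFinP; exact: measurable_sqnorm. Qed.

Lemma integral_indic_mul mu (A : set T) (g : T -> R) :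
  (\int[mu]_(x in A) (g x)%:E = \int[mu]_x ((\1_A x : R) * g x)%:E)%E.
Proof.
rewrite integral_mkcond; apply: eq_integral => x _.
by rewrite patchE indicE; case: ifPn; rewrite ?mul1r ?mul0r.
Qed.

(** Outside the tail [h] is at most [1 + L], which costs [(1 + L) * e]; on it [L >= 1] gives
    [wt x <= 2 ||x||^2], which costs [2 * t]. *)
Lemma tail_transfer mu nu (L e t : R) : 1 <= L -> 0 <= e ->
  (forall (h : T -> R) (B : R), measurable_fun [set: T] h -> (forall x, 0 <= h x <= B) ->
     (\int[mu]_x (h x)%:E <= \int[nu]_x (h x)%:E + (B * e)%:E)%E) ->
  (\int[mu]_(x in tail L) (eucl_sqnorm x)%:E <= t%:E)%E ->
  forall h : T -> R, measurable_fun [set: T] h -> (forall x, 0 <= h x <= wt x) ->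
    (\int[mu]_x (h x)%:E <= \int[nu]_x (h x)%:E + ((1 + L) * e + 2 * t)%:E)%E.
Proof.
move=> L1 e0 bdd tl h mh hw.
have h0 x : 0 <= h x by case/andP: (hw x).
have s0 x : 0 <= eucl_sqnorm (x : T) by exact: eucl_sqnorm_ge0.
have mC : measurable (~` tail L) by apply: measurableC; exact: measurable_tail.
pose g x : R := (\1_(~` tail L) x : R) * h x.
have mg : measurable_fun [set: T] g.
  by apply: measurable_funM => //; exact: measurable_indic.
have gB x : 0 <= g x <= 1 + L.
  rewrite /g mulr_ge0//= indicE; have [|_] := boolP (x \in ~` tail L); last first.
    by rewrite mul0r addr_ge0// (le_trans ler01).
  rewrite inE /= mul1r => /negP; rewrite -ltNge => sL.
  by have /andP[_ H] := hw x; rewrite (le_trans H)// lerD2l ltW.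
have mI : measurable_fun [set: T] (fun x => ((\1_(tail L) x : R) * eucl_sqnorm x)%:E).
  apply/measurable_EFinP; apply: measurable_funM; last exact: measurable_sqnorm.
  by apply: measurable_indic; exact: measurable_tail.
have I0 x : (0 <= ((\1_(tail L) x : R) * eucl_sqnorm x)%:E)%E by rewrite lee_fin mulr_ge0.
apply: (@le_trans _ _ (\int[mu]_x (g x)%:E + 2%:E * \int[mu]_(x in tail L) (eucl_sqnorm x)%:E)%E).
  rewrite [X in (_ <= _ + _ * X)%E]integral_indic_mul -ge0_integralZl_EFin// -ge0_integralD//; last 4 first.
  - by move=> x _; rewrite lee_fin; case/andP: (gB x).
  - exact/measurable_EFinP.
  - by move=> x _; rewrite mule_ge0.
  - exact: emeasurable_funM.
  apply: ge0_le_integral => //.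
  - by move=> x _; rewrite lee_fin.
  - exact/measurable_EFinP.
  - by apply: emeasurable_funD; [exact/measurable_EFinP|exact: emeasurable_funM].
  - move=> x _; rewrite -EFinM -EFinD lee_fin /g !indicE in_setC.
    have [xt|xt] := boolP (x \in tail L); rewrite /= ?mul0r ?mul1r ?mulr0 ?addr0 ?add0r//.
    have /andP[_ H] := hw x; apply: (le_trans H); rewrite /wt.
    by rewrite inE /tail /= in xt; lra.
apply: (@le_trans _ _ ((\int[nu]_x (g x)%:E + ((1 + L) * e)%:E) + (2 * t)%:E)%E).
  rewrite leeD//; first exact: bdd.
  by rewrite EFinM lee_wpmul2l.
rewrite EFinD addeA leeD2r// leeD2r//; apply: ge0_le_integral => //.
- by move=> x _; rewrite lee_fin; case/andP: (gB x).
- exact/measurable_EFinP.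
- exact/measurable_EFinP.
- move=> x _; rewrite lee_fin /g indicE; case: (_ \in _); rewrite ?mul1r ?mul0r//.
Qed.

Lemma tail_wt_fin mu (L t : R) : (mu setT < +oo)%E -> 0 <= L ->
  (\int[mu]_(x in tail L) (eucl_sqnorm x)%:E <= t%:E)%E ->
  (\int[mu]_x (wt x)%:E < +oo)%E.
Proof.
move=> fin L0 tl.
have s0 x : 0 <= eucl_sqnorm (x : T) by exact: eucl_sqnorm_ge0.
have mI : measurable_fun [set: T] (fun x => ((\1_(tail L) x : R) * eucl_sqnorm x)%:E).
  apply/measurable_EFinP; apply: measurable_funM; last exact: measurable_sqnorm.
  by apply: measurable_indic; exact: measurable_tail.
have I0 x : (0 <= ((\1_(tail L) x : R) * eucl_sqnorm x)%:E)%E by rewrite lee_fin mulr_ge0.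
apply: (@le_lt_trans _ _ (\int[mu]_x (cst (1 + L)%:E x) + \int[mu]_(x in tail L) (eucl_sqnorm x)%:E)%E).
  rewrite [X in (_ <= _ + X)%E]integral_indic_mul -ge0_integralD//; last first.
    by move=> x _; rewrite lee_fin addr_ge0.
  apply: ge0_le_integral => //.
  - by move=> x _; rewrite lee_fin wt_ge0.
  - exact: measurable_EFin_wt.
  - exact: emeasurable_funD.
  - move=> x _; rewrite -EFinD lee_fin indicE /wt.
    have [xt|xt] := boolP (x \in tail L); rewrite ?mul0r ?mul1r ?addr0.
      by rewrite lerD2r lerDl.
    by rewrite lerD2l leNgt; apply: contraNN xt => /ltW; rewrite inE.
rewrite lte_add_pinfty//; last exact: le_lt_trans tl (ltry _).
by rewrite integral_cst// lte_mul_pinfty// lee_fin addr_ge0.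
Qed.

(** Only bounded functions can be compared, so the tail is cut to [S k], where [||x||^2] is at most
    [k]; monotone convergence then removes the cut. *)
Lemma tail_limit (mus : nat -> {measure set T -> \bar R}) mu (L t : R) : 0 <= L ->
  (forall e : R, 0 < e -> \forall n \near \oo, forall (h : T -> R) (B : R),
    measurable_fun [set: T] h -> (forall x, 0 <= h x <= B) ->
    (\int[mu]_x (h x)%:E <= \int[mus n]_x (h x)%:E + (B * e)%:E)%E) ->
  (forall n, (\int[mus n]_(x in tail L) (eucl_sqnorm x)%:E <= t%:E)%E) ->
  (\int[mu]_(x in tail L) (eucl_sqnorm x)%:E <= t%:E)%E.
Proof.
move=> L0 bdd tl.
have s0 x : 0 <= eucl_sqnorm (x : T) by exact: eucl_sqnorm_ge0.
pose S (k : nat) : set T := tail L `\` tail k%:R.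
have mS k : measurable (S k) by apply: measurableD; exact: measurable_tail.
have Sk x k : S k x -> eucl_sqnorm x <= k%:R.
  by move=> [_ /negP]; rewrite -ltNge => /ltW.
have US : \bigcup_k S k = tail L.
  apply/seteqP; split=> [x [k _ []]//|x xL].
  exists (Num.truncn (eucl_sqnorm x)).+1 => //; split=> //=.
  by apply/negP; rewrite -ltNge truncnS_gt.
have mono : nondecreasing_seq S.
  move=> m n mn; apply/subsetPset => x [xL xm]; split=> // xn; apply: xm.
  by apply: le_trans xn; rewrite ler_nat.
rewrite -US.
have cv := @ge0_nondecreasing_set_cvg_integral _ _ _ S (fun x => (eucl_sqnorm x)%:E) mu
  mono mS.
have {}cv : ((fun i => \int[mu]_(x in S i) (eucl_sqnorm x)%:E) @ \oo)%E -->
    (\int[mu]_(x in \bigcup_i S i) (eucl_sqnorm x)%:E)%E.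
  apply: cv => k.
    by apply: (measurable_funS measurableT) => //; exact: measurable_EFin_sqnorm.
  by move=> x _; rewrite lee_fin.
rewrite -(cvg_lim _ cv)//; apply: lime_le; first exact: (cvgP _ cv).
apply: nearW => k; apply/lee_addgt0Pr => e e0.
have ek : 0 < e / (k%:R + 1) by rewrite divr_gt0// ltr_wpDl.
have /filter_ex[n nP] := bdd _ ek.
have mg : measurable_fun [set: T] (fun x => (\1_(S k) x : R) * eucl_sqnorm x).
  by apply: measurable_funM; [exact: measurable_indic|exact: measurable_sqnorm].
have gB x : 0 <= (\1_(S k) x : R) * eucl_sqnorm x <= k%:R.
  rewrite mulr_ge0//= indicE; have [|_] := boolP (x \in S k); last by rewrite mul0r.
  by rewrite inE mul1r => /Sk.
rewrite [X in (X <= _)%E]integral_indic_mul; apply: (le_trans (nP _ _ mg gB)).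
rewrite leeD//.
  apply: le_trans (tl n); rewrite [leRHS]integral_indic_mul; apply: ge0_le_integral => //.
  - by move=> x _; rewrite lee_fin mulr_ge0.
  - exact/measurable_EFinP.
  - apply/measurable_EFinP; apply: measurable_funM; last exact: measurable_sqnorm.
    by apply: measurable_indic; exact: measurable_tail.
  - move=> x _; rewrite lee_fin ler_wpM2r// !indicE.
    have [|//] := boolP (x \in S k); rewrite inE => -[xL _].
    by rewrite mem_set.
by rewrite lee_fin mulrCA ler_piMr ?(ltW e0)// ler_pdivrMr ?ltr_wpDl// mul1r lerDl.
Qed.

Lemma in_S_lip (C C1 : R) (mu : probability T R) : in_S C C1 mu ->
  exists2 p, has_leb_density mu p & forall x y, `|p x - p y| <= `|C1| * l1dist x y.
Proof.
move=> [p [den [_ lip]]]; exists p => // x y.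
apply: (le_trans (lip _ _)); apply: (@le_trans _ _ (`|C1| * eucl_dist x y)).
  by rewrite ler_wpM2r ?ler_norm// sqrtr_ge0.
by rewrite ler_wpM2l// eucl_dist_le_l1.
Qed.

Lemma weak_cvg_wclose (C C1 : R) (mus : nat -> probability T R) (mu : probability T R) :
  (forall n, in_S C C1 (mus n)) -> in_S C C1 mu -> weak_cvg_prob mus mu ->
  ((fun L : R => ereal_sup [set (\int[mus n]_(x in tail L) (eucl_sqnorm x)%:E)%E
     | n in [set: nat]]) @ +oo%R --> 0%E) ->
  [/\ good mu, forall n, good (mus n) &
    forall del : R, 0 < del -> \forall n \near \oo, wclose mu (mus n) del].
Proof.
move=> inS_n inS weak ui.
have [p den lip] := in_S_lip inS.
have exps n : exists p, has_leb_density (mus n) p /\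
    forall x y, `|p x - p y| <= `|C1| * l1dist x y.
  by have [q ? ?] := in_S_lip (inS_n n); exists q.
have [ps psP] := choice exps.
have L0 : 0 <= `|C1| by [].
have ptw := density_pointwise L0 (fun n => (psP n).1) den (fun n => (psP n).2) lip weak.
have sch := scheffe (fun n => l1_lipschitz_measurable L0 (psP n).2)
  (l1_lipschitz_measurable L0 lip) (fun n => (psP n).1) den ptw.
have tails (t : R) : 0 < t -> exists2 L : R, 1 <= L & forall n,
    (\int[mus n]_(x in tail L) (eucl_sqnorm x)%:E <= t%:E)%E.
  move=> t0; have /fine_cvgP[uifin /cvgrPdist_le/(_ t t0) uit] := ui.
  near (+oo : set_system R) => L.
  exists L; first by near: L; exact: nbhs_pinfty_ge.
  move=> n; apply: (@le_trans _ _ (ereal_sup [set (\int[mus n]_(x in tail L) (eucl_sqnorm x)%:E)%E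
     | n in [set: nat]])); first by apply: ereal_sup_ubound; exists n.
  have sf : (ereal_sup [set (\int[mus n]_(x in tail L) (eucl_sqnorm x)%:E)%E
     | n in [set: nat]]) \is a fin_num by near: L.
  rewrite -(fineK sf) lee_fin.
  have : `|0 - fine (ereal_sup [set (\int[mus n]_(x in tail L) (eucl_sqnorm x)%:E)%E
     | n in [set: nat]])| <= t by near: L.
  by rewrite sub0r normrN; apply: le_trans; exact: ler_norm.
have sch1 : forall e : R, 0 < e -> \forall n \near \oo, forall (h : T -> R) (B : R),
    measurable_fun [set: T] h -> (forall x, 0 <= h x <= B) ->
    (\int[mu]_x (h x)%:E <= \int[mus n]_x (h x)%:E + (B * e)%:E)%E.
  by move=> e e0; apply: filterS (sch e e0) => n H h B mh hB; exact: (H h B mh hB).1.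
have pfin (m : probability T R) : (m setT < +oo)%E by rewrite probability_setT ltry.
(* One tail level already makes the second moments finite, for every [mus n] and, through
   [tail_limit], for [mu]. *)
have [M1 M11 M1P] := tails 1 ltr01.
have M10 : 0 <= M1 by exact: le_trans ler01 M11.
split.
- split; last exact: density_affine_null den.
  apply: (tail_wt_fin (pfin mu) M10 (t := 1)).
  exact: (tail_limit (mus := mus) M10 sch1 M1P).
- move=> n; split; last exact: density_affine_null (psP n).1.
  exact: (tail_wt_fin (pfin (mus n)) M10 (M1P n)).
move=> del del0.
have t0 : 0 < del / 4 by rewrite divr_gt0.
have [L L1 LP] := tails _ t0.
have LL0 : 0 <= L by exact: le_trans ler01 L1.
have LPmu := tail_limit (mus := mus) LL0 sch1 LP.
(* In [tail_transfer] the bulk and the tail then cost [del / 2] each. *)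
have e0 : 0 < del / 2 / (1 + L) by rewrite !divr_gt0// ltr_wpDr.
have E : (1 + L) * (del / 2 / (1 + L)) + 2 * (del / 4) = del.
  by field; rewrite gt_eqF// ltr_wpDr.
apply: filterS (sch _ e0) => n H h mh hw; rewrite -[in X in X /\ _]E -[in X in _ /\ X]E; split.
- apply: (tail_transfer L1 (ltW e0) _ LPmu mh hw) => g B mg gB; exact: (H g B mg gB).1.
- apply: (tail_transfer L1 (ltW e0) _ (LP n) mh hw) => g B mg gB; exact: (H g B mg gB).2.
Unshelve. all: by end_near. Qed.

End WeakToWeighted.

Lemma J_cvg (R : realType) (d M Th k : nat) (phi : d.-tuple R -> d.-tuple R -> R)
    (mus : nat -> {measure set (d.-tuple R) -> \bar R})
    (mu : {measure set (d.-tuple R) -> \bar R}) :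
  (forall nu : {measure set (d.-tuple R) -> \bar R}, (nu setT < +oo)%E ->
    (0 <= J_togo M Th phi k nu)%E) ->
  (forall nu : {measure set (d.-tuple R) -> \bar R}, good nu -> (J_togo M Th phi k nu < +oo)%E) ->
  wcontinuous (fun nu : {measure set (d.-tuple R) -> \bar R} => J_togo M Th phi k nu) ->
  good mu -> (forall n, good (mus n)) ->
  (forall del : R, 0 < del -> \forall n \near \oo, wclose mu (mus n) del) ->
  J_togo M Th phi k (mus n) @[n --> \oo] --> J_togo M Th phi k mu.
Proof.
move=> J0 Jy Jc gmu gmus cl.
have Jfin nu : good nu -> J_togo M Th phi k nu \is a fin_num.
  by move=> gnu; rewrite ge0_fin_numE ?Jy// J0// good_fin.
rewrite -(fineK (Jfin _ gmu)); apply/fine_cvgP; split.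
  by apply: nearW => n; exact: Jfin.
apply/cvgrPdist_le => e e0.
have [del [del0 delP]] : exists del : R, 0 < del /\ forall nu, good nu ->
    wclose mu nu del -> (J_togo M Th phi k mu <= J_togo M Th phi k nu + e%:E)%E /\
    (J_togo M Th phi k nu <= J_togo M Th phi k mu + e%:E)%E.
  near (0 : R)^'+ => del; exists del; split; near: del; last exact: Jc.
  exact: nbhs_right_gt.
apply: filterS (cl _ del0) => n /(delP _ (gmus n)) [] /=.
rewrite -(fineK (Jfin _ gmu)) -(fineK (Jfin _ (gmus n))) -!EFinD !lee_fin /=.
by move=> H1 H2; rewrite ler_norml; apply/andP; split; lra.
Unshelve. all: by end_near. Qed.

Theorem theorem11 (R : realType) (d M : nat)
  (d_gt0 : (0 < d)%N) (M_gt0 : (0 < M)%N)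
  (* Assumption 1: the source x_{t+1} = f(x_t, w_t), w_t ~ nu_w i.i.d.,
     x_0 ~ pi0; phi x z = phi(z|x) is the density of the law of f(x, w_0). *)
  (f : d.-tuple R -> d.-tuple R -> d.-tuple R)
  (nu_w pi0 : probability (d.-tuple R) R)
  (phi : d.-tuple R -> d.-tuple R -> R) (C C1 : R)
  (f_meas : measurable_fun [set: d.-tuple R * d.-tuple R]
              (fun p : d.-tuple R * d.-tuple R => f p.1 p.2))
  (phi_law : forall x (A : set (d.-tuple R)), measurable A ->
     nu_w (f x @^-1` A) = leb_int_d (fun z => ((\1_A z : R) * phi x z)%:E))
  (phi_pos : forall x z, 0 < phi x z)
  (phi_bd : forall x z, phi x z <= C)
  (phi_lip : forall x z z', `|phi x z - phi x z'| <= C1 * eucl_dist z z')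
  (* Assumption 3 *)
  (K : R) (K_gt0 : 0 < K)
  (f_growth : forall x w, eucl_norm (f x w) <= K * (eucl_norm x + eucl_norm w))
  (nu_mom : (\int[nu_w]_z (eucl_sqnorm z)%:E < +oo)%E)
  (pi0_hyp : (exists p, has_leb_density pi0 p /\
                        (\int[pi0]_x (eucl_sqnorm x)%:E < +oo)%E) \/
             (exists x0 : d.-tuple R, forall A, measurable A -> pi0 A = \d_x0 A))
  (* horizon *)
  (Th : nat) (Th_ge1 : (1 <= Th)%N) :
  (* attainment for 1 <= t <= T-1 on S *)
  (forall t, (1 <= t < Th)%N ->
     forall pi : probability (d.-tuple R) R, in_S C C1 pi ->
     exists2 Q, Q_c d M Q &
       J_T M Th phi t pi = J_objective Th phi (J_T M Th phi t.+1) pi Q) /\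
  (* attainment for t = 0 on S ∪ {pi0} *)
  (forall pi : probability (d.-tuple R) R, in_S C C1 pi \/ pi = pi0 ->
     exists2 Q, Q_c d M Q &
       J_T M Th phi 0 pi = J_objective Th phi (J_T M Th phi 1) pi Q) /\
  (* continuity on S under uniform integrability of ||x||^2 *)
  (forall t, (t <= Th)%N ->
     forall (pis : nat -> probability (d.-tuple R) R)
            (pi : probability (d.-tuple R) R),
       (forall n, in_S C C1 (pis n)) -> in_S C C1 pi ->
       weak_cvg_prob pis pi ->
       ((fun L : R => ereal_sup
           [set \int[pis n]_(x in [set x | (L <= eucl_sqnorm x)%R]) (eucl_sqnorm x)%:E
           | n in [set: nat]]) @ +oo%R --> 0)%E ->
       ((fun n => J_T M Th phi t (pis n)) @ \oo --> J_T M Th phi t pi)%E).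
Proof.
(* Separation and compactness are stated in dimension [d.+1]. *)
case: d d_gt0 f nu_w pi0 phi f_meas phi_law phi_pos phi_bd phi_lip f_growth nu_mom pi0_hyp => //.
move=> d _ f nu_w pi0 phi f_meas phi_law phi_pos phi_bd phi_lip f_growth nu_mom pi0_hyp.
have Jstep t : (t < Th)%N -> J_T M Th phi t = J_togo M Th phi (Th - t.+1).+1.
  by move=> tT; rewrite /J_T subnSK.
have pfin (mu : probability (d.+1.-tuple R) R) : (mu setT < +oo)%E.
  by rewrite probability_setT ltry.
have attained_null t (mu : probability (d.+1.-tuple R) R) : (t < Th)%N -> affine_null mu ->
    exists2 Q, Q_c d.+1 M Q &
      J_T M Th phi t mu = J_objective Th phi (J_T M Th phi t.+1) mu Q.
  move=> tT nullmu; rewrite Jstep//.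
  (* Members of [S] and [pi] with a density ignore hyperplanes, so finite weighted mass is all that
     is missing for [good]; without it every quantizer costs [+oo]. *)
  have [winf|/eqP wfin] := eqVneq (\int[mu]_x (wt x)%:E)%E +oo%E.
    exact: (J_attained_infinite M_gt0 f_meas phi_law phi_pos phi_lip
      (Th - t.+1) (pfin mu) winf Th_ge1).
  apply: (J_attained M_gt0 f_meas phi_law phi_pos phi_lip K_gt0 f_growth nu_mom Th (Th - t.+1)).
  by split=> //; rewrite ltey; exact/eqP.
have in_S_null (mu : probability (d.+1.-tuple R) R) : in_S C C1 mu -> affine_null mu.
  by move=> [p [den _]]; exact: density_affine_null den.
split; [|split].
- by move=> t /andP[_ tT] pi piS; apply: attained_null => //; exact: in_S_null.
- move=> pi [piS|->]; first by apply: attained_null => //; exact: in_S_null.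
  case: pi0_hyp => [[p [den _]]|[x0 pi0E]].
    by apply: attained_null => //; exact: density_affine_null den.
  rewrite Jstep//.
  exact: (J_attained_dirac M_gt0 f_meas phi_law phi_pos phi_lip Th (Th - 1) pi0E).
- move=> t _ pis pi pisS piS weak ui.
  have [gpi gpis cl] := weak_cvg_wclose pisS piS weak ui.
  have [Jy Jc] := J_regular M_gt0 f_meas phi_law phi_pos phi_lip K_gt0 f_growth nu_mom Th (Th - t).
  apply: (J_cvg (mus := pis) (mu := pi)) => //.
  by move=> nu; exact: (J_ge0 M f_meas phi_law phi_pos phi_lip Th (Th - t)).
Qed.
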